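(* Let $\Lambda$ be an artin $R$-algebra and let $(\Psi,\mathbf{Q},\leq)$ be a proper costratifying system of size $t$ in $\mathrm{mod}(\Lambda)$, with $\Psi=\{\Psi(i)\}_{i=1}^t$, $\mathbf{Q}=\{Q(i)\}_{i=1}^t$ and $Q=\bigoplus_{i=1}^tQ(i)$. Let $\Gamma=\mathrm{End}_\Lambda(Q)^{op}$, $F=\mathrm{Hom}_\Lambda(Q,-):\mathrm{mod}(\Lambda)\to\mathrm{mod}(\Gamma)$ and $G=Q\otimes_\Gamma-:\mathrm{mod}(\Gamma)\to\mathrm{mod}(\Lambda)$. Let ${}_\Gamma P=\{F(Q(i)):i\in[1,t]\}$, and let ${}_\Gamma\overline{\Delta}=\{{}_\Gamma\overline{\Delta}(i):i\in[1,t]\}$ be the proper standard $\Gamma$-modules corresponding to the pair $({}_\Gamma P,\leq^{op})$, where $\leq^{op}$ is the opposite order of $\leq$. Then the following statements hold. (a) The family ${}_\Gamma P=\{F(Q(i)):i\in[1,t]\}$ is a representative set of the indecomposable projective $\Gamma$-modules (one module from each isomorphism class). In particular $\Gamma$ is a basic algebra and $\mathrm{rk}\,K_0(\Gamma)=t$. (b) The restriction $F|_{\mathcal F(\Psi)}:\mathcal F(\Psi)\to\mathcal F({}_\Gamma\overline{\Delta})$ is an exact equivalence of categories and $G|_{\mathcal F({}_\Gamma\overline{\Delta})}:\mathcal F({}_\Gamma\overline{\Delta})\to\mathcal F(\Psi)$ is a quasi-inverse of $F|_{\mathcal F(\Psi)}$. (c) $F(\Psi(i))\simeq{}_\Gamma\overline{\Delta}(i)$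 for all $i\in[1,t]$. (d) $(\Gamma^{op},\leq^{op})$ is a standardly stratified algebra. (e) $\mathrm{add}(Q)=\mathcal F(\Psi)\cap{}^{\perp_1}\mathcal F(\Psi)$. (f) $\mathcal F({}_\Gamma\overline{\Delta})$ is resolving and closed under direct summands in $\mathrm{mod}(\Gamma)$.
   Context: $R$ is a commutative artinian ring, algebras are artin $R$-algebras, and ''module'' means finitely generated left module; $\mathrm{mod}(\Lambda)$ is the category of these. $[1,t]=\{1,\dots,t\}$. $\mathrm{add}(M)$ is the full subcategory of finite direct sums of direct summands of $M$. For a class $\mathcal C$ of modules, $\mathcal F(\mathcal C)$ is the class of modules $M$ having a finite filtration $0=M_0\subseteq M_1\subseteq\cdots\subseteq M_s=M$ with every factor $M_{i+1}/M_i$ isomorphic to a module in $\mathcal C$. ${}^{\perp_1}\mathcal X=\{M:\mathrm{Ext}^1(M,X)=0\ \forall X\in\mathcal X\}$. A class is resolving if it is closed under extensions and kernels of epimorphisms and contains all projective modules. An exact equivalence is an equivalence taking short exact sequences (with terms in the given class) to short exact sequences. A proper costratifying system $(\Psi,\mathbf{Q},\leq)$ of size $t$ in $\mathrm{mod}(\Lambda)$ consists of families of $\Lambda$-modules $\Psi=\{\Psi(i)\}_{i=1}^t$ and $\mathbf{Q}=\{Q(i)\}_{i=1}^t$, each $Q(i)$ indecomposable, and a linear order $\leq$ on $[1,t]$ such that: (1) $\mathrm{End}_\Lambda(\Psi(i))$ is a division ring for all $i$; (2) $\mathrm{Hom}_\Lambda(\Psi(i),\Psi(j))=0$ if $i<j$;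 (3) for each $i$ there is an exact sequence $0\to Z(i)\to Q(i)\xrightarrow{\beta_i}\Psi(i)\to0$ with $Z(i)\in\mathcal F(\{\Psi(j):j\leq i\})$; (4) $\mathrm{Ext}^1_\Lambda(Q(i),\Psi(j))=0$ for all $i,j\in[1,t]$. Let $A$ be an algebra, $P=\{P(i):i\in[1,n]\}$ a representative set of the indecomposable projective $A$-modules and $\preceq$ a linear order on $[1,n]$. $\mathrm{Tr}_M(N)$ is the submodule of $N$ generated by the images of all morphisms $M\to N$. The standard modules for $(P,\preceq)$ are ${}_A\Delta(i)=P(i)/\mathrm{Tr}_{\oplus_{j\succ i}P(j)}(P(i))$ and the proper standard modules are ${}_A\overline{\Delta}(i)=P(i)/\mathrm{Tr}_{\oplus_{j\succeq i}P(j)}(\mathrm{rad}\,P(i))$. $(A,\preceq)$ is a standardly stratified algebra if every projective $A$-module belongs to $\mathcal F({}_A\Delta)$. Whenever the indecomposable projectives of $A$ are labelled $P(i)$, those of $A^{op}$ are labelled $P(i)^*=\mathrm{Hom}_A(P(i),A)$; in particular the indecomposable projective $\Gamma^{op}$-modules are labelled $\mathrm{Hom}_\Gamma(F(Q(i)),\Gamma)$. *)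

(* Defs.v *)
From HB Require Import structures.
From mathcomp Require Import all_boot all_algebra.
From mathcomp Require Import boolp freeg.

Set Implicit Arguments.
Unset Strict Implicit.
Unset Printing Implicit Defensive.

Import GRing.Theory.
Local Open Scope ring_scope.
Local Open Scope quotient_scope.

(* Rings are `pzRingType's, so the zero ring is allowed: it occurs as the       *)
(* endomorphism ring of an empty direct sum.  Modules are left modules.         *)

Section Submodule.
Variables (A : pzRingType) (M : lmodType A).

Record submodule : Type := Submodule {
  submodule_pred :> {pred M};
  submodule_closed : subsemimod_closed submodule_pred }.

HB.instance Definition _ (N : submodule) :=
  GRing.isSubmodClosed.Build A M (submodule_pred N) (submodule_closed N).

End Submodule.

Section SubQuotient.
Variables (A : pzRingType) (M : lmodType A).

Definition subm (N : submodule M) : Type := {x : M | x \in N}.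

HB.instance Definition _ (N : submodule M) := [isSub of subm N for @sval M _].
HB.instance Definition _ (N : submodule M) := [Choice of subm N by <:].
HB.instance Definition _ (N : submodule M) :=
  GRing.SubChoice_isSubLmodule.Build A M _ (subm N) (submodule_closed N).

Definition quotm (N : submodule M) : Type := Quotient.quot N.

HB.instance Definition _ (N : submodule M) := GRing.Zmodule.on (quotm N).
HB.instance Definition _ (N : submodule M) :=
  EqQuotient.on (quotm N).

Section Scale.
Variable N : submodule M.

Lemma quotmE (x y : M) : (\pi_(quotm N) x = \pi_(quotm N) y) <-> (x - y \in N).
Proof.
have -> : (x - y \in N) = (\pi_(quotm N) x == \pi_(quotm N) y).
  exact: (Quotient.idealrBE N).
by split=> /eqP.
Qed.

Lemma quotmD (x y : M) :
  \pi_(quotm N) (x + y) = \pi_(quotm N) x + \pi_(quotm N) y.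
Proof. exact: (@Quotient.pi_add M N). Qed.

Definition quotm_scale (a : A) (u : quotm N) : quotm N :=
  \pi_(quotm N) (a *: repr u).

Lemma quotm_scaleE a x : quotm_scale a (\pi x) = \pi_(quotm N) (a *: x).
Proof. by apply/quotmE; rewrite -scalerBr rpredZ//; apply/quotmE; rewrite reprK. Qed.

Fact quotm_scaleA a b u :
  quotm_scale a (quotm_scale b u) = quotm_scale (a * b) u.
Proof. by rewrite -[u]reprK !quotm_scaleE scalerA. Qed.

Fact quotm_scale1 : left_id 1 quotm_scale.
Proof. by move=> u; rewrite -[u]reprK quotm_scaleE scale1r. Qed.

Fact quotm_scaleDr : right_distributive quotm_scale +%R.
Proof.
move=> a u v; rewrite -[u]reprK -[v]reprK -quotmD !quotm_scaleE -quotmD.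
by rewrite scalerDr.
Qed.

Fact quotm_scaleDl u : {morph quotm_scale^~ u : a b / a + b}.
Proof. by move=> a b /=; rewrite -[u]reprK !quotm_scaleE -quotmD scalerDl. Qed.

HB.instance Definition _ := GRing.Zmodule_isLmodule.Build A (quotm N)
  quotm_scaleA quotm_scale1 quotm_scaleDr quotm_scaleDl.

End Scale.
End SubQuotient.

Section Generated.
Variables (A : pzRingType) (M : lmodType A).

Definition gen_submod_pred (S : M -> Prop) : {pred M} :=
  [pred x | `[< forall U : submodule M, (forall y, S y -> y \in U) -> x \in U >]].

Fact gen_submod_closed S : subsemimod_closed (gen_submod_pred S).
Proof.
split; first split.
- by apply/asboolP => U _; exact: rpred0.
- by move=> x y /asboolP hx /asboolP hy; apply/asboolP => U hU;
    rewrite rpredD ?hx ?hy.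
- by move=> a x /asboolP hx; apply/asboolP => U hU; rewrite rpredZ ?hx.
Qed.

Definition gen_submod S : submodule M := Submodule (gen_submod_closed S).

Lemma mem_gen_submod (S : M -> Prop) y : S y -> y \in gen_submod S.
Proof. by move=> hy; apply/asboolP => U; apply. Qed.

Lemma gen_submod_ker (S : M -> Prop) (N : lmodType A) (f : {linear M -> N}) :
  (forall y, S y -> f y = 0) -> forall x, x \in gen_submod S -> f x = 0.
Proof.
move=> fS x /asboolP xS; have cl : subsemimod_closed [pred y | f y == 0].
  split; first split; rewrite ?inE ?linear0 //.
    by move=> y z; rewrite !inE linearD => /eqP -> /eqP ->; rewrite addr0.
  by move=> a y; rewrite !inE linearZ => /eqP -> /=; rewrite scaler0.
by apply/eqP; apply: (xS (Submodule cl)) => y /fS fy; rewrite inE /= fy.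
Qed.

End Generated.

Section SubmoduleOperations.
Variables (A : pzRingType) (M M' : lmodType A).

Definition sub_image_pred (f : {linear M -> M'}) (N : submodule M) : {pred M'} :=
  [pred y | `[< exists2 x, x \in N & y = f x >]].

Fact sub_image_closed f N : subsemimod_closed (sub_image_pred f N).
Proof.
split; first split.
- by apply/asboolP; exists 0; rewrite ?rpred0 ?linear0.
- move=> _ _ /asboolP[x hx ->] /asboolP[y hy ->]; apply/asboolP.
  by exists (x + y); rewrite ?rpredD ?linearD.
- move=> a _ /asboolP[x hx ->]; apply/asboolP.
  by exists (a *: x); rewrite ?rpredZ ?linearZ.
Qed.

Definition sub_image f N : submodule M' := Submodule (sub_image_closed f N).

Definition restrict_pred (N N' : submodule M) : {pred subm N} :=
  [pred x | val x \in N'].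

Fact restrict_closed N N' : subsemimod_closed (@restrict_pred N N').
Proof.
split; first split; rewrite ?inE ?rpred0 //.
- by move=> x y; rewrite !inE => hx hy; rewrite raddfD rpredD.
- by move=> a x; rewrite !inE => hx; rewrite linearZ rpredZ.
Qed.

Definition restrict N N' : submodule (subm N) :=
  Submodule (@restrict_closed N N').

Definition maximal_submodule (U : submodule M) : Prop :=
  ~ (forall x, x \in U) /\
  forall V : submodule M, {subset U <= V} -> V =i U \/ forall x, x \in V.

Definition rad_pred : {pred M} :=
  [pred x | `[< forall U : submodule M, maximal_submodule U -> x \in U >]].

Fact rad_closed : subsemimod_closed rad_pred.
Proof.
split; first split.
- by apply/asboolP => U _; exact: rpred0.
- by move=> x y /asboolP hx /asboolP hy; apply/asboolP => U hU;
    rewrite rpredD ?hx ?hy.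
- by move=> a x /asboolP hx; apply/asboolP => U hU; rewrite rpredZ ?hx.
Qed.

Definition rad : submodule M := Submodule rad_closed.

End SubmoduleOperations.

Arguments rad {A} M.

(* N / N', meant for N' contained in N *)
Definition factor (A : pzRingType) (M : lmodType A) (N N' : submodule M) :
  lmodType A := quotm (@restrict _ M N N').

Section DirectSum.
Variables (A : pzRingType) (I : finType) (M : I -> lmodType A).

Definition dsum : Type := {dffun forall i, M i}.

HB.instance Definition _ := Choice.on dsum.

Definition dsum_zero : dsum := [ffun i => 0].
Definition dsum_opp (f : dsum) : dsum := [ffun i => - f i].
Definition dsum_add (f g : dsum) : dsum := [ffun i => f i + g i].
Definition dsum_scale (a : A) (f : dsum) : dsum := [ffun i => a *: f i].

Fact dsum_addA : associative dsum_add.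
Proof. by move=> f g h; apply/ffunP => i; rewrite !ffunE addrA. Qed.
Fact dsum_addC : commutative dsum_add.
Proof. by move=> f g; apply/ffunP => i; rewrite !ffunE addrC. Qed.
Fact dsum_add0 : left_id dsum_zero dsum_add.
Proof. by move=> f; apply/ffunP => i; rewrite !ffunE add0r. Qed.
Fact dsum_addN : left_inverse dsum_zero dsum_opp dsum_add.
Proof. by move=> f; apply/ffunP => i; rewrite !ffunE addNr. Qed.

HB.instance Definition _ := GRing.isZmodule.Build dsum
  dsum_addA dsum_addC dsum_add0 dsum_addN.

Fact dsum_scaleA a b f : dsum_scale a (dsum_scale b f) = dsum_scale (a * b) f.
Proof. by apply/ffunP => i; rewrite !ffunE scalerA. Qed.
Fact dsum_scale1 : left_id 1 dsum_scale.
Proof. by move=> f; apply/ffunP => i; rewrite !ffunE scale1r. Qed.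
Fact dsum_scaleDr : right_distributive dsum_scale +%R.
Proof. by move=> a f g; apply/ffunP => i; rewrite !ffunE scalerDr. Qed.
Fact dsum_scaleDl f : {morph dsum_scale^~ f : a b / a + b}.
Proof. by move=> a b; apply/ffunP => i; rewrite !ffunE scalerDl. Qed.

HB.instance Definition _ := GRing.Zmodule_isLmodule.Build A dsum
  dsum_scaleA dsum_scale1 dsum_scaleDr dsum_scaleDl.

End DirectSum.

Section Hom.
Variables (A : pzRingType) (M N : lmodType A).

Definition lhom : Type := {linear M -> N}.
Identity Coercion lhom_linear : lhom >-> GRing.Linear.type.

Lemma lhomP (f g : lhom) : f =1 g <-> f = g.
Proof.
split=> [fg|->//]; case: f g fg => f cf [g cg] /= /funext fg.
move: cf cg; rewrite fg => cf cg; congr GRing.Linear.Pack.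
case: cf cg => [[c1] [c2]] [[c3] [c4]]; congr GRing.Linear.Class.
  by congr Algebra.isNmodMorphism.Axioms_; exact: Prop_irrelevance.
by congr GRing.isScalable.Axioms_; exact: Prop_irrelevance.
Qed.

HB.instance Definition _ := gen_eqMixin lhom.
HB.instance Definition _ := gen_choiceMixin lhom.

Definition lhom_zero : lhom := \0.
Definition lhom_opp (f : lhom) : lhom := \- f.
Definition lhom_add (f g : lhom) : lhom := f \+ g.

Fact lhom_addA : associative lhom_add.
Proof. by move=> f g h; apply/lhomP => x /=; rewrite addrA. Qed.
Fact lhom_addC : commutative lhom_add.
Proof. by move=> f g; apply/lhomP => x /=; rewrite addrC. Qed.
Fact lhom_add0 : left_id lhom_zero lhom_add.
Proof. by move=> f; apply/lhomP => x /=; rewrite add0r. Qed.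
Fact lhom_addN : left_inverse lhom_zero lhom_opp lhom_add.
Proof. by move=> f; apply/lhomP => x /=; rewrite addNr. Qed.

HB.instance Definition _ := GRing.isZmodule.Build lhom
  lhom_addA lhom_addC lhom_add0 lhom_addN.

End Hom.

Section Endo.
Variables (A : pzRingType) (M : lmodType A).

Definition endo : Type := lhom M M.
Identity Coercion endo_lhom : endo >-> lhom.

HB.instance Definition _ := GRing.Zmodule.on endo.

Definition endo_one : endo := (idfun : {linear M -> M}).
Definition endo_mul (f g : endo) : endo := (f \o g : {linear M -> M}).

Fact endo_mulA : associative endo_mul.
Proof. by move=> f g h; apply/lhomP. Qed.
Fact endo_mul1 : left_id endo_one endo_mul.
Proof. by move=> f; apply/lhomP. Qed.
Fact endo_mulr1 : right_id endo_one endo_mul.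
Proof. by move=> f; apply/lhomP. Qed.
Fact endo_mulDl : left_distributive endo_mul +%R.
Proof. by move=> f g h; apply/lhomP. Qed.
Fact endo_mulDr : right_distributive endo_mul +%R.
Proof. by move=> f g h; apply/lhomP => x /=; rewrite linearD. Qed.

HB.instance Definition _ := GRing.Zmodule_isPzRing.Build endo
  endo_mulA endo_mul1 endo_mulr1 endo_mulDl endo_mulDr.

End Endo.

Definition division_ring (D : pzRingType) : Prop :=
  (1 : D) != 0 /\ forall x : D, x != 0 -> exists y, x * y = 1 /\ y * x = 1.

Section Modules.
Variable A : pzRingType.
Implicit Types M N P X Y Z : lmodType A.

Definition fg M : Prop :=
  exists n (v : 'I_n -> M), forall x, exists c : 'I_n -> A,
    x = \sum_(i < n) c i *: v i.

Definition iso M N : Prop := exists f : {linear M -> N}, bijective f.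

Definition zero_module M : Prop := forall x : M, x = 0.

Definition ses X Y Z (f : {linear X -> Y}) (g : {linear Y -> Z}) : Prop :=
  [/\ injective f, forall y, g y = 0 <-> (exists x, y = f x)
    & forall z, exists y, g y = z].

Definition direct_summand N M : Prop := exists N', iso M (N * N')%type.

Definition indecomposable M : Prop :=
  ~ zero_module M /\
  forall X Y, iso M (X * Y)%type -> zero_module X \/ zero_module Y.

(* For finitely generated P, lifting against all surjections amounts to lifting *)
(* against surjections of finitely generated modules.                           *)
Definition projective P : Prop :=
  forall (X Y : lmodType A) (g : {linear X -> Y}) (h : {linear P -> Y}),
    (forall y, exists x, g x = y) ->
    exists k : {linear P -> X}, forall p, g (k p) = h p.

Definition famclass I (C : I -> lmodType A) : lmodType A -> Prop :=
  fun X => exists i, X = C i.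

Definition filtered (C : lmodType A -> Prop) M : Prop :=
  exists (s : nat) (F : nat -> submodule M),
  [/\ forall x, (x \in F 0%N) = (x == 0),
      forall x, x \in F s,
      forall i, (i < s)%N -> {subset F i <= F i.+1}
    & forall i, (i < s)%N -> exists2 X, C X & iso (factor (F i.+1) (F i)) X].

Definition addclass M : lmodType A -> Prop := fun X =>
  exists n (N : 'I_n -> lmodType A),
    (forall i, direct_summand (N i) M) /\ iso X (dsum N).

Record resolving (C : lmodType A -> Prop) : Prop := {
  resolving_ext : forall (X Y Z : lmodType A) (f : {linear X -> Y}) (g : {linear Y -> Z}),
    fg X -> fg Y -> fg Z -> ses f g -> C X -> C Z -> C Y;
  resolving_ker : forall (X Y Z : lmodType A) (f : {linear X -> Y}) (g : {linear Y -> Z}),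
    fg X -> fg Y -> fg Z -> ses f g -> C Y -> C Z -> C X;
  resolving_proj : forall P, fg P -> projective P -> C P }.

Definition summand_closed (C : lmodType A -> Prop) : Prop :=
  forall M N, fg M -> fg N -> C M -> direct_summand N M -> C N.

End Modules.

(* Yoneda Ext^1(M, X): extensions 0 -> X -> E -> M -> 0 up to equivalence, with  *)
(* zero element the class of the split extension.  When X and M are finitely    *)
(* generated so is E, so this is also Ext^1 in the category of finitely         *)
(* generated modules.                                                           *)

Section Ext.
Variables (A : pzRingType) (M X : lmodType A).

Record extension := Extension {
  ext_mid : lmodType A;
  ext_inj : {linear X -> ext_mid};
  ext_proj : {linear ext_mid -> M};
  ext_ses : ses ext_inj ext_proj }.

Definition ext_equiv (e e' : extension) : Prop :=
  exists h : {linear ext_mid e -> ext_mid e'},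
  [/\ bijective h, forall x, h (ext_inj e x) = ext_inj e' x
    & forall y, ext_proj e' (h y) = ext_proj e y].

Definition split_inj (x : X) : (X * M)%type := (x, 0).

Fact split_inj_linear : linear split_inj.
Proof. by move=> a x y; congr (_, _); rewrite /= scaler0 addr0. Qed.

HB.instance Definition _ :=
  GRing.isLinear.Build A X (X * M)%type _ split_inj split_inj_linear.

Fact split_ses : ses split_inj (snd : {linear (X * M)%type -> M}).
Proof.
split=> [x y []// | [x m] /= | m]; last by exists (0, m).
by split=> [->|[y []]]; [exists x|].
Qed.

Definition split_extension : extension := Extension split_ses.

Definition Ext1_eq0 : Prop := forall e : extension, ext_equiv e split_extension.

End Ext.

Definition perp1 (A : pzRingType) (C : lmodType A -> Prop) (M : lmodType A) : Prop :=
  fg M /\ forall X, C X -> Ext1_eq0 M X.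

Section Functors.

Record modfunctor (A B : pzRingType) := ModFunctor {
  fobj :> lmodType A -> lmodType B;
  fmap : forall M N : lmodType A, {linear M -> N} -> {linear fobj M -> fobj N};
  fmap_id : forall M : lmodType A, fmap (idfun : {linear M -> M}) =1 id;
  fmap_comp : forall (M N L : lmodType A) (g : {linear N -> L}) (f : {linear M -> N}),
    fmap (g \o f : {linear M -> L}) =1 (fmap g \o fmap f) }.

Arguments fmap {A B} F {M N} f : rename.
Arguments fmap_id {A B} F {M} x : rename.
Arguments fmap_comp {A B} F {M N L} g f x : rename.

Definition idF (A : pzRingType) : modfunctor A A :=
  @ModFunctor A A id (fun M N f => f) (fun _ _ => erefl) (fun _ _ _ _ _ _ => erefl).

Section Composition.
Variables (A B C : pzRingType) (G : modfunctor B C) (F : modfunctor A B).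

Fact compF_id (M : lmodType A) :
  fmap G (fmap F (idfun : {linear M -> M})) =1 id.
Proof.
move=> x; rewrite -[RHS](fmap_id G); congr (GRing.Linear.sort (fmap G _) x).
by apply/lhomP => y; exact: fmap_id.
Qed.

Fact compF_comp (M N L : lmodType A) (g : {linear N -> L}) (f : {linear M -> N}) :
  fmap G (fmap F (g \o f : {linear M -> L})) =1
  (fmap G (fmap F g) \o fmap G (fmap F f)).
Proof.
move=> x; rewrite -(fmap_comp G (fmap F g) (fmap F f)).
congr (GRing.Linear.sort (fmap G _) x).
by apply/lhomP => y; exact: fmap_comp.
Qed.

Definition compF : modfunctor A C :=
  @ModFunctor A C (fun M => G (F M)) (fun M N f => fmap G (fmap F f))
    compF_id compF_comp.

End Composition.

Definition preserves_fg (A B : pzRingType) (F : modfunctor A B) : Prop :=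
  forall M, fg M -> fg (F M).

(* The full subcategory on C is what matters here: the components of eta at     *)
(* objects outside of C are unconstrained, e.g. 0.                              *)
Definition nat_iso_on (A B : pzRingType) (C : lmodType A -> Prop)
    (F G : modfunctor A B) : Prop :=
  exists eta : forall M, {linear F M -> G M},
    (forall M, C M -> bijective (eta M)) /\
    (forall (M N : lmodType A) (f : {linear M -> N}), C M -> C N ->
       forall x, eta N (fmap F f x) = fmap G f (eta M x)).

Record exact_equivalence_on (A B : pzRingType) (F : modfunctor A B)
    (C : lmodType A -> Prop) (D : lmodType B -> Prop) : Prop := {
  equiv_obj : forall M, C M -> D (F M);
  equiv_full : forall M N, C M -> C N ->
    forall g : {linear F M -> F N}, exists f, fmap F f =1 g;
  equiv_faithful : forall M N : lmodType A, C M -> C N ->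
    forall f f' : {linear M -> N}, fmap F f =1 fmap F f' -> f =1 f';
  equiv_dense : forall Y, D Y -> exists2 X, C X & iso (F X) Y;
  equiv_exact : forall (X Y Z : lmodType A) (f : {linear X -> Y}) (g : {linear Y -> Z}),
    C X -> C Y -> C Z -> ses f g -> ses (fmap F f) (fmap F g) }.

Definition quasi_inverse_on (A B : pzRingType) (F : modfunctor A B)
    (G : modfunctor B A) (C : lmodType A -> Prop) (D : lmodType B -> Prop) : Prop :=
  [/\ forall M, C M -> D (F M),
      forall Y, D Y -> C (G Y),
      nat_iso_on C (compF G F) (idF A)
    & nat_iso_on D (compF F G) (idF B)].

End Functors.

(* The functor Hom_A(Q, -) into the modules over End_A(Q)^op, acting by        *)
(* precomposition                                                              *)

Section HomFunctor.
Variables (A : pzRingType) (Q : lmodType A).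

Definition homF (M : lmodType A) : Type := lhom Q M.
Identity Coercion homF_lhom : homF >-> lhom.

HB.instance Definition _ M := GRing.Zmodule.on (homF M).

Section Scale.
Variable M : lmodType A.

Definition homF_scale (a : (endo Q)^c) (f : homF M) : homF M :=
  (f \o (a : endo Q) : {linear Q -> M}).

Fact homF_scaleA a b f : homF_scale a (homF_scale b f) = homF_scale (a * b) f.
Proof. by apply/lhomP. Qed.
Fact homF_scale1 : left_id 1 homF_scale.
Proof. by move=> f; apply/lhomP. Qed.
Fact homF_scaleDr : right_distributive homF_scale +%R.
Proof. by move=> a f g; apply/lhomP. Qed.
Fact homF_scaleDl f : {morph homF_scale^~ f : a b / a + b}.
Proof. by move=> a b; apply/lhomP => x /=; rewrite linearD. Qed.

HB.instance Definition _ := GRing.Zmodule_isLmodule.Build (endo Q)^c (homF M)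
  homF_scaleA homF_scale1 homF_scaleDr homF_scaleDl.

End Scale.

Section Map.
Variables (M N : lmodType A) (f : {linear M -> N}).

Definition homF_map (h : homF M) : homF N := (f \o h : {linear Q -> N}).

Fact homF_map_linear : linear homF_map.
Proof. by move=> a g h; apply/lhomP => x /=; rewrite linearD. Qed.

HB.instance Definition _ :=
  GRing.isLinear.Build (endo Q)^c (homF M) (homF N) _ homF_map homF_map_linear.

End Map.

Fact homF_map_id (M : lmodType A) : homF_map (idfun : {linear M -> M}) =1 id.
Proof. by move=> f; apply/lhomP. Qed.

Fact homF_map_comp (M N L : lmodType A) (g : {linear N -> L}) (f : {linear M -> N}) :
  homF_map (g \o f : {linear M -> L}) =1 (homF_map g \o homF_map f).
Proof. by move=> h; apply/lhomP. Qed.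

Definition Hom_functor : modfunctor A (endo Q)^c :=
  @ModFunctor A (endo Q)^c (fun M => homF M) (fun M N f => homF_map f)
    homF_map_id homF_map_comp.

End HomFunctor.

(* The functor Q (x)_Gamma -, where Gamma = End_A(Q)^op acts on the right of Q *)
(* by evaluation: Q (x) N is the free abelian group on Q x N modulo the         *)
(* subgroup generated by the balanced biadditivity relations.                   *)

Section TensorFunctor.
Variables (A : pzRingType) (Q : lmodType A).
Local Notation Gamma := ((endo Q)^c).

Section Object.
Variable N : lmodType Gamma.

Inductive tensor_rel : {freeg (Q * N)%type} -> Prop :=
| Tensor_addl q q' n :
    tensor_rel (<< (q + q', n) >> - << (q, n) >> - << (q', n) >>)
| Tensor_addr q n n' :
    tensor_rel (<< (q, n + n') >> - << (q, n) >> - << (q, n') >>)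
| Tensor_bal q (g : Gamma) n :
    tensor_rel (<< ((g : endo Q) q, n) >> - << (q, g *: n) >>).

Definition tensorZ : lmodType int := quotm (gen_submod tensor_rel).

Definition tensor : Type := tensorZ.

HB.instance Definition _ := GRing.Zmodule.on tensor.

Definition tens (q : Q) (n : N) : tensor := \pi_(quotm (gen_submod tensor_rel)) << (q, n) >>.

Lemma tensDl q q' n : tens (q + q') n = tens q n + tens q' n.
Proof.
rewrite /tens -[RHS]quotmD; apply/quotmE.
by rewrite opprD addrA; apply: mem_gen_submod; exact: Tensor_addl.
Qed.

Lemma tensDr q n n' : tens q (n + n') = tens q n + tens q n'.
Proof.
rewrite /tens -[RHS]quotmD; apply/quotmE.
by rewrite opprD addrA; apply: mem_gen_submod; exact: Tensor_addr.
Qed.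

Lemma tens_bal q (g : Gamma) n : tens ((g : endo Q) q) n = tens q (g *: n).
Proof. by apply/quotmE; apply: mem_gen_submod; exact: Tensor_bal. Qed.

End Object.

Section Lift.
Variables (N : lmodType Gamma) (V : lmodType int) (h : Q -> N -> V).

Local Notation lft := (fglift (fun x : Q * N => h x.1 x.2)).

Definition tensor_lift (u : tensor N) : V := lft (repr (u : tensorZ N)).

Fact fglift_linear : linear lft.
Proof.
have add : zmod_morphism lft by exact: lift_is_additive.
pose f : {additive {freeg (Q * N)%type} -> V} :=
  HB.pack lft (GRing.isZmodMorphism.Build _ _ lft add).
move=> a x y; rewrite -[lft]/(f : _ -> _) raddfD; congr (_ + _).
by rewrite -[a]intz !scaler_int raddfMz.
Qed.

Hypothesis hDl : forall q q' n, h (q + q') n = h q n + h q' n.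
Hypothesis hDr : forall q n n', h q (n + n') = h q n + h q n'.
Hypothesis hbal : forall q (g : Gamma) n, h ((g : endo Q) q) n = h q (g *: n).

Fact tensor_lift_pi u : tensor_lift (\pi_(quotm (gen_submod (@tensor_rel N))) u) = lft u.
Proof.
pose f : {linear {freeg (Q * N)%type} -> V} :=
  HB.pack lft (GRing.isLinear.Build _ _ _ _ lft fglift_linear).
apply/eqP; rewrite -subr_eq0 /tensor_lift -[lft]/(f : _ -> _) -linearB /=.
have fU x : f << x >> = h x.1 x.2 by rewrite /= liftU scale1r.
apply/eqP/(@gen_submod_ker _ _ (@tensor_rel N) _ f); last first.
  by apply/quotmE; rewrite reprK.
by move=> _ [q q' n|q n n'|q g n]; rewrite !linearB !fU /= ?hDl ?hDr ?hbal;
  rewrite ?[h q n + _]addrC ?addrK subrr.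
Qed.

Lemma tensor_liftE q n : tensor_lift (tens q n) = h q n.
Proof. by rewrite /tens tensor_lift_pi liftU scale1r. Qed.

Lemma tensor_liftD : {morph tensor_lift : u v / u + v}.
Proof.
move=> u v; rewrite -[u](@reprK _ (tensorZ N)) -[v](@reprK _ (tensorZ N)).
rewrite !tensor_lift_pi -quotmD tensor_lift_pi.
by rewrite -[X in lft (X + _)]scale1r fglift_linear scale1r.
Qed.

End Lift.

Lemma tensor_ind (N : lmodType Gamma) (P : tensor N -> Prop) :
  (forall u v, P u -> P v -> P (u - v)) -> (forall q n, P (tens q n)) ->
  forall u, P u.
Proof.
move=> PB Pt u; have P0 : P 0 by rewrite -(subrr (tens 0 0)); apply: PB; exact: Pt.
have PN v : P v -> P (- v) by move=> Pv; rewrite -sub0r; exact: (PB 0 v P0 Pv).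
have PD v w : P v -> P w -> P (v + w).
  by move=> Pv /PN Pw; rewrite -[w]opprK; exact: (PB v (- w) Pv Pw).
rewrite -[u](@reprK _ (tensorZ N)) -[repr _]freeg_sumE.
have pi0 : \pi_(quotm (gen_submod (@tensor_rel N))) 0 = 0 :> tensor N.
  by apply: (@addrI (tensor N) (tens 0 0)); rewrite addr0 -[LHS]quotmD addr0.
have Pk q n k : P (\pi_(quotm (gen_submod (@tensor_rel N))) (<< (q, n) >> *+ k)).
  by elim: k => [|k IH]; rewrite ?mulr0n ?pi0// mulrS quotmD; exact: (PD _ _ (Pt q n) IH).
elim: (dom _) => [|[q n] d IH]; first by rewrite big_nil pi0.
rewrite big_cons quotmD; apply: PD; last exact: IH.
rewrite -[X in << X *g _ >>]intz -freegU_mulz; case: (coeff _ _) => k; first exact: (Pk q n k).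
rewrite NegzE mulrNz; set v := _ *~ _.
suff -> : \pi_(quotm (gen_submod (@tensor_rel N))) (- v) =
          - (\pi_(quotm (gen_submod (@tensor_rel N))) v) :> tensor N by apply: PN; exact: Pk.
by apply: (@addrI (tensor N) (\pi_(quotm (gen_submod (@tensor_rel N))) v));
  rewrite subrr -[LHS]quotmD subrr.
Qed.

Section Scale.
Variable N : lmodType Gamma.

Definition tensor_scale (a : A) : tensor N -> tensor N :=
  @tensor_lift N (tensorZ N) (fun q n => tens (a *: q) n).

Fact tensor_scaleE a q n : tensor_scale a (tens q n) = tens (a *: q) n.
Proof.
apply: tensor_liftE => [q1 q2 m|q1 m1 m2|q1 g m].
- by rewrite scalerDr tensDl.
- by rewrite tensDr.
- by rewrite -tens_bal linearZ.
Qed.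

Fact tensor_scaleDr : right_distributive tensor_scale +%R.
Proof.
move=> a; apply: tensor_liftD => [q1 q2 m|q1 m1 m2|q1 g m].
- by rewrite scalerDr tensDl.
- by rewrite tensDr.
- by rewrite -tens_bal linearZ.
Qed.

Fact tensor_scaleB a u v : tensor_scale a (u - v) = tensor_scale a u - tensor_scale a v.
Proof. by apply/(canRL (addrK _)); rewrite -tensor_scaleDr subrK. Qed.

Fact tensor_scaleA a b u : tensor_scale a (tensor_scale b u) = tensor_scale (a * b) u.
Proof.
elim/tensor_ind: u => [u v IHu IHv|q n]; first by rewrite !tensor_scaleB IHu IHv.
by rewrite !tensor_scaleE scalerA.
Qed.

Fact tensor_scale1 : left_id 1 tensor_scale.
Proof.
elim/tensor_ind => [u v IHu IHv|q n]; first by rewrite !tensor_scaleB IHu IHv.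
by rewrite !tensor_scaleE scale1r.
Qed.

Fact tensor_scaleDl u : {morph tensor_scale^~ u : a b / a + b}.
Proof.
move=> a b /=; elim/tensor_ind: u => [u v IHu IHv|q n].
  by rewrite !tensor_scaleB IHu IHv opprD addrACA.
by rewrite !tensor_scaleE scalerDl tensDl.
Qed.

HB.instance Definition _ := GRing.Zmodule_isLmodule.Build A (tensor N)
  tensor_scaleA tensor_scale1 tensor_scaleDr tensor_scaleDl.

Lemma scale_tens (a : A) q n : a *: (tens q n : tensor N) = tens (a *: q) n.
Proof. exact: tensor_scaleE. Qed.

End Scale.

Section Map.
Variables (N N' : lmodType Gamma) (f : {linear N -> N'}).

Definition tensor_map : tensor N -> tensor N' :=
  @tensor_lift N (tensorZ N') (fun q n => tens q (f n)).

Lemma tensor_mapE q n : tensor_map (tens q n) = tens q (f n).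
Proof.
apply: tensor_liftE => [q1 q2 m|q1 m1 m2|q1 g m].
- by rewrite tensDl.
- by rewrite linearD tensDr.
- by rewrite tens_bal linearZ.
Qed.

Fact tensor_mapD : {morph tensor_map : u v / u + v}.
Proof.
apply: tensor_liftD => [q1 q2 m|q1 m1 m2|q1 g m].
- by rewrite tensDl.
- by rewrite linearD tensDr.
- by rewrite tens_bal linearZ.
Qed.

Fact tensor_mapB u v : tensor_map (u - v) = tensor_map u - tensor_map v.
Proof. by apply/(canRL (addrK _)); rewrite -tensor_mapD subrK. Qed.

Fact tensor_map_linear : linear tensor_map.
Proof.
move=> a u v; rewrite tensor_mapD; congr (_ + _).
elim/tensor_ind: u => [u w IHu IHw|q n].
  by rewrite !(scalerBr, tensor_mapB) IHu IHw.
by rewrite scale_tens !tensor_mapE scale_tens.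
Qed.

HB.instance Definition _ :=
  GRing.isLinear.Build A (tensor N) (tensor N') _ tensor_map tensor_map_linear.

End Map.

Fact tensor_map_id (N : lmodType Gamma) : tensor_map (idfun : {linear N -> N}) =1 id.
Proof.
elim/tensor_ind => [u v IHu IHv|q n]; first by rewrite tensor_mapB IHu IHv.
by rewrite tensor_mapE.
Qed.

Fact tensor_map_comp (N N' N'' : lmodType Gamma)
    (g : {linear N' -> N''}) (f : {linear N -> N'}) :
  tensor_map (g \o f : {linear N -> N''}) =1 (tensor_map g \o tensor_map f).
Proof.
elim/tensor_ind => [u v IHu IHv|q n].
  by rewrite /= !tensor_mapB IHu IHv.
by rewrite /= !tensor_mapE.
Qed.

Definition Tensor_functor : modfunctor Gamma A :=
  @ModFunctor Gamma A (fun N => tensor N) (fun N N' f => tensor_map f)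
    tensor_map_id tensor_map_comp.

End TensorFunctor.

Section Dual.
Variables (A : pzRingType) (P : lmodType A).

(* Hom_A(P, A), on which A^c acts through right multiplication on values *)
Definition dualm : Type := lhom P A^o.
Identity Coercion dualm_lhom : dualm >-> lhom.

HB.instance Definition _ := GRing.Zmodule.on dualm.

Fact dualm_scale_linear (a : A^c) (f : dualm) :
  linear (fun x : P => (f x : A) * (a : A) : A^o).
Proof.
move=> b x y; rewrite linearP mulrDl; congr (_ + _).
exact/esym/(mulrA b (f x : A) (a : A)).
Qed.

Definition dualm_scale (a : A^c) (f : dualm) : dualm :=
  HB.pack (fun x : P => (f x : A) * (a : A) : A^o)
    (GRing.isLinear.Build _ _ _ _ _ (dualm_scale_linear a f)).

Fact dualm_scaleA a b f : dualm_scale a (dualm_scale b f) = dualm_scale (a * b) f.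
Proof. by apply/lhomP => x /=; rewrite -mulrA. Qed.
Fact dualm_scale1 : left_id 1 dualm_scale.
Proof. by move=> f; apply/lhomP => x /=; rewrite mulr1. Qed.
Fact dualm_scaleDr : right_distributive dualm_scale +%R.
Proof. by move=> a f g; apply/lhomP => x /=; rewrite mulrDl. Qed.
Fact dualm_scaleDl f : {morph dualm_scale^~ f : a b / a + b}.
Proof. by move=> a b; apply/lhomP => x /=; rewrite mulrDr. Qed.

HB.instance Definition _ := GRing.Zmodule_isLmodule.Build A^c dualm
  dualm_scaleA dualm_scale1 dualm_scaleDr dualm_scaleDl.

End Dual.

(* Artin algebras.  An R-algebra is a ring A with a ring morphism R -> A of     *)
(* central image; the library's `algType` does not apply to the zero ring.      *)

Record algstr (R : comPzRingType) (A : pzRingType) := AlgStr {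
  alg_map :> {rmorphism R -> A};
  alg_central : forall r a, alg_map r * a = a * alg_map r }.

Definition artinian (R : comPzRingType) : Prop :=
  forall I : nat -> submodule R^o, (forall n, {subset I n.+1 <= I n}) ->
    exists n0, forall n, (n0 <= n)%N -> I n =i I n0.

Definition artin_algebra (R : comPzRingType) (A : pzRingType) (phi : algstr R A) : Prop :=
  artinian R /\
  exists n (v : 'I_n -> A), forall x, exists c : 'I_n -> R,
    x = \sum_(i < n) phi (c i) * v i.

Section AlgebraStructures.
Variables (R : comPzRingType) (A : pzRingType) (phi : algstr R A).

Fact op_map_zmod : zmod_morphism (phi : R -> A^c).
Proof. by move=> x y; exact: (rmorphB phi x y). Qed.
Fact op_map_monoid : monoid_morphism (phi : R -> A^c).
Proof.
split=> [|x y]; first exact: (rmorph1 phi).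
by rewrite mulrC; exact: (rmorphM phi y x).
Qed.

Definition op_map : {rmorphism R -> A^c} :=
  HB.pack (phi : R -> A^c) (GRing.isZmodMorphism.Build _ _ _ op_map_zmod)
    (GRing.isMonoidMorphism.Build _ _ _ op_map_monoid).

Definition op_algstr : algstr R A^c :=
  @AlgStr R A^c op_map (fun r a => esym (alg_central phi r a)).

Variable M : lmodType A.

Fact endo_map_linear r : linear (fun x : M => phi r *: x).
Proof. by move=> a x y; rewrite scalerDr !scalerA alg_central. Qed.

Definition endo_map_fun (r : R) : endo M :=
  HB.pack (fun x : M => phi r *: x)
    (GRing.isLinear.Build _ _ _ _ _ (endo_map_linear r)).

Fact endo_map_zmod : zmod_morphism endo_map_fun.
Proof. by move=> r s; apply/lhomP => x /=; rewrite rmorphB scalerBl. Qed.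
Fact endo_map_monoid : monoid_morphism endo_map_fun.
Proof.
split=> [|r s]; apply/lhomP => x /=; first by rewrite rmorph1 scale1r.
by rewrite rmorphM scalerA.
Qed.

Definition endo_map : {rmorphism R -> endo M} :=
  HB.pack endo_map_fun (GRing.isZmodMorphism.Build _ _ _ endo_map_zmod)
    (GRing.isMonoidMorphism.Build _ _ _ endo_map_monoid).

Fact endo_map_central r f : endo_map r * f = f * endo_map r.
Proof. by apply/lhomP => x /=; rewrite linearZ. Qed.

Definition endo_algstr : algstr R (endo M) := AlgStr endo_map_central.

End AlgebraStructures.

(* The Grothendieck group K_0(A) of mod(A): free abelian group on the finitely *)
(* generated modules, modulo [M] = [M'] + [M''] for 0 -> M' -> M -> M'' -> 0    *)
(* exact.  The generators are restricted to the set of modules A^n / N, among   *)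
(* which every finitely generated module occurs up to isomorphism.              *)

Section Grothendieck.
Variable A : pzRingType.

Definition pres : Type := {n : nat & submodule 'rV[A]_n}.

Definition pres_module (p : pres) : lmodType A := quotm (projT2 p).

Definition K0_gen : choiceType := {classic pres}.

Inductive K0_rel : {freeg K0_gen} -> Prop :=
  K0_ses (p' p p'' : pres) (f : {linear pres_module p' -> pres_module p})
    (g : {linear pres_module p -> pres_module p''}) of ses f g :
    K0_rel (<< (p : K0_gen) >> - << (p' : K0_gen) >> - << (p'' : K0_gen) >>).

Definition K0 : lmodType int := quotm (gen_submod K0_rel).

End Grothendieck.

Definition int_independent (V : lmodType int) (n : nat) (x : 'I_n -> V) : Prop :=
  forall c : 'I_n -> int, \sum_(i < n) c i *: x i = 0 -> forall i, c i = 0.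

(* an int-module is an abelian group *)
Definition rank_is (V : lmodType int) (n : nat) : Prop :=
  (exists x : 'I_n -> V, int_independent x) /\
  (forall m (x : 'I_m -> V), int_independent x -> (m <= n)%N).

Record rep_indec_proj (A : pzRingType) (n : nat) (P : 'I_n -> lmodType A) : Prop := {
  rep_fg : forall i, fg (P i);
  rep_indec : forall i, indecomposable (P i);
  rep_proj : forall i, projective (P i);
  rep_inj : forall i j, iso (P i) (P j) -> i = j;
  rep_surj : forall X : lmodType A, fg X -> indecomposable X -> projective X ->
    exists i, iso X (P i) }.

Definition basic_algebra (R : comPzRingType) (A : pzRingType) (phi : algstr R A) : Prop :=
  artin_algebra phi /\
  exists n (P : 'I_n -> lmodType A),
  [/\ forall i, indecomposable (P i), forall i j, iso (P i) (P j) -> i = j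
    & iso A^o (dsum P)].

Definition trace (A : pzRingType) (X N : lmodType A) : submodule N :=
  gen_submod (fun y : N => exists (f : {linear X -> N}) x, y = f x).

(* The index set [1, n] is represented by 'I_n. *)
Definition linear_order n (le : rel 'I_n) : Prop :=
  [/\ reflexive le, antisymmetric le, transitive le & total le].

Definition op_order n (le : rel 'I_n) : rel 'I_n := fun i j => le j i.

Definition strict n (le : rel 'I_n) : rel 'I_n := fun i j => le i j && (i != j).

Section Standard.
Variables (A : pzRingType) (n : nat) (P : 'I_n -> lmodType A) (le : rel 'I_n).

Definition standard (i : 'I_n) : lmodType A :=
  quotm (trace (dsum (fun j : {j | strict le i j} => P (val j))) (P i)).

Definition proper_standard (i : 'I_n) : lmodType A :=
  quotm (sub_image (val : {linear subm (rad (P i)) -> P i})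
    (trace (dsum (fun j : {j | le i j} => P (val j))) (subm (rad (P i))))).

End Standard.

(* P is the labelling of the indecomposable projective A-modules that gives le  *)
(* its meaning.                                                                 *)
Record standardly_stratified (R : comPzRingType) (A : pzRingType)
    (phi : algstr R A) (n : nat) (P : 'I_n -> lmodType A) (le : rel 'I_n) : Prop := {
  ss_artin : artin_algebra phi;
  ss_order : linear_order le;
  ss_rep : rep_indec_proj P;
  ss_filtered : forall X : lmodType A, fg X -> projective X ->
    filtered (famclass (standard P le)) X }.

Record proper_costratifying_system (A : pzRingType) (t : nat)
    (Psi Q : 'I_t -> lmodType A) (le : rel 'I_t) : Prop := {
  pcs_order : linear_order le;
  pcs_fgPsi : forall i, fg (Psi i);
  pcs_fgQ : forall i, fg (Q i);
  pcs_indec : forall i, indecomposable (Q i);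
  pcs_division : forall i, division_ring (endo (Psi i));
  pcs_hom0 : forall i j, strict le i j ->
    forall f : {linear Psi i -> Psi j}, forall x, f x = 0;
  pcs_seq : forall i, exists (Z : lmodType A)
      (alpha : {linear Z -> Q i}) (beta : {linear Q i -> Psi i}),
    ses alpha beta /\
    filtered (famclass (fun j : {j | le j i} => Psi (val j))) Z;
  pcs_ext0 : forall i j, Ext1_eq0 (Q i) (Psi j) }.

(* Main.v *)
Require Import Defs.
From HB Require Import structures.
From mathcomp Require Import all_boot all_algebra.
From mathcomp Require Import boolp classical_sets freeg.

(* F = Hom(Q, -) is exact on F(Psi) because Ext^1(Q, Psi(j)) = 0, and every       *)
(* object of F(Psi) has an add(Q)-presentation with kernels in F(Psi), obtained   *)
(* by the horseshoe lemma from 0 -> Z(i) -> Q(i) -> Psi(i) -> 0; hence the counit *)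
(* Q (x) Hom(Q, X) -> X, an isomorphism on add(Q), is one on F(Psi).  A map       *)
(* Q(i) -> Q(i) which is not bijective is killed by Q(i) -> Psi(i), and this       *)
(* identifies F(Z(i)) with the trace that defines the proper standard module.     *)
(* Since Ext^1(Psi(j), Psi(k)) = 0 for j < k, filtrations can be sorted: for a     *)
(* down-set D, an object of F(Psi) has a subobject filtered by the Psi(j), j in    *)
(* D, with quotient filtered by the others.  Peeling off the smallest index        *)
(* reduces (f) to filtrations by a single Psi(u), where a nonzero map to Psi(u)    *)
(* is onto with kernel again filtered.  For (d), the maps from Q(i) to Q that     *)
(* factor through Q(j)'s with j in D filter Hom(Q(i), Q), and the layer at k is   *)
(* a sum of copies of the standard module at k, indexed by a basis of             *)
(* Hom(Q(i), Psi(k)) over End(Psi(k)).  Finite length over R, and with it Fitting *)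
(* and Krull-Schmidt, comes from the Hopkins theorem for the artinian ring R.     *)

Set Implicit Arguments.
Unset Strict Implicit.
Unset Printing Implicit Defensive.

Import GRing.Theory.
Local Open Scope ring_scope.
Local Open Scope quotient_scope.

(** * Linear maps, submodules and short exact sequences *)

(** Since Ext^1(Q, -) vanishes on F(Psi), the functor F = Hom(Q, -) is exact there. The sequences
    Z(i) -> Q(i) -> Psi(i) are glued along a filtration by the horseshoe construction, so every X in
    F(Psi) is a quotient of an object of add(Q) by a kernel that lies again in F(Psi) ([FP_cover]).
    On add(Q) the functor F is fully faithful by Yoneda and the counit Q (x) F(X) -> X is injective;
    two steps of the resolution make the counit bijective on F(Psi) ([tensor_counit_bij]), whence F
    is fully faithful there. Splitting the cover gives (e).

    The image of F is found from F(Psi(i)). As End(Psi(i)) is a division ring and there are no maps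
    from smaller to larger indices, a nonzero map to Psi(i) from a module filtered by Psi(j), j <=
    i, is onto with a kernel filtered in the same way ([hom_Psi_surj]). With Fitting's lemma, beta_i
    : Q(i) -> Psi(i) then kills every endomorphism of Q(i) that is not bijective ([beta_nonbij]). So
    the kernel of F(beta_i) is the part of the radical of F(Q(i)) generated by maps from F(Q(j)), j
    <= i, which is the submodule that defines the proper standard module ([DeltaBar_mem]). Pushouts
    of Z(j) -> Q(j) then realize every object of F(DeltaBar) ([F_dense]).

    For (f), filtrations are sorted: an extension of Psi(j) by a module with larger indices splits,
    so for a down-set D each object has a submodule filtered by the indices in D whose quotient is
    filtered by the others ([FP_split]). Removing the smallest index reduces kernels and direct
    summands to a single Psi(u) ([FP_ker], [FP_retract]). An epimorphism in F(DeltaBar) comes from a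
    map in F(Psi) along which all maps from Q lift, and this makes the snake lemma applicable.

    For (d), the dual of F(Q(i)) is Hom(Q(i), Q), filtered by the maps that factor through Q(j)'s
    with j in a down-set. A layer is Hom(Q(i), T) with T filtered by one Psi(k). A basis of
    Hom(Q(i), Psi(k)) over End(Psi(k)), lifted to maps Q(i) -> Q(k), identifies it with a power of
    Hom(Q(k), T), where for the T of that layer Hom(Q(k), T) is the standard module at k
    ([factorS_step]).

    Finite length comes from Hopkins's theorem for R ([artinian_flen]). It gives Fitting and
    Krull-Schmidt; applied to Gamma, the sum of the pairwise non-isomorphic F(Q(i)), they yield (a),
    the rank of K_0 being computed with composition multiplicities ([K0_rank]). *)

Section LinearMaps.
Variable A : pzRingType.
Implicit Types M N X Y Z W : lmodType A.

Definition mklin M N (f : M -> N) (lf : linear f) : {linear M -> N} :=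
  HB.pack f (GRing.isLinear.Build A M N _ f lf).

(** Lifts and induced maps are given by their graph: stability under linear combinations reduces
    single-valuedness to the value at 0, and then makes the chosen function linear. *)
Lemma linrel_fun M N (rel : M -> N -> Prop) :
  (forall x, exists y, rel x y) ->
  (forall y, rel 0 y -> y = 0) ->
  (forall a x y x' y', rel x y -> rel x' y' -> rel (a *: x + x') (a *: y + y')) ->
  exists f : {linear M -> N}, forall x, rel x (f x).
Proof.
move=> tot fun0 cl.
have unq x y y' : rel x y -> rel x y' -> y = y'.
  move=> h h'; have := cl (-1) _ _ _ _ h h'; rewrite !scaleN1r addNr => /fun0.
  by move/eqP; rewrite addrC subr_eq0 => /eqP.
have [f fP] := choice tot.
have lf : linear f by move=> a x y; apply: (unq (a *: x + y)) => //; exact: cl.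
by exists (mklin lf).
Qed.

Lemma bijective_linv M N (f : {linear M -> N}) :
  bijective f -> exists g : {linear N -> M}, cancel f g /\ cancel g f.
Proof.
case=> g fK gK; have lg : linear g.
  by move=> a x y; apply: (can_inj fK); rewrite linearP !gK.
by exists (mklin lg).
Qed.

Lemma inj_surj_bij (S T : Type) (f : S -> T) :
  injective f -> (forall y, exists x, f x = y) -> bijective f.
Proof.
by move=> fi /choice[g gK]; exists g => // x; apply: fi; rewrite gK.
Qed.

Lemma lin_inj M N (f : {linear M -> N}) : (forall x, f x = 0 -> x = 0) -> injective f.
Proof.
by move=> f0 x y /eqP; rewrite -subr_eq0 -linearB => /eqP/f0/eqP; rewrite subr_eq0 => /eqP.
Qed.

Lemma iso_refl M : iso M M.
Proof. by exists idfun; exists id. Qed.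

Lemma iso_sym M N : iso M N -> iso N M.
Proof. by case=> f /bijective_linv[g [fK gK]]; exists g; exists f. Qed.

Lemma iso_trans M N W : iso M N -> iso N W -> iso M W.
Proof. by case=> f bf [g bg]; exists (g \o f); exact: bij_comp. Qed.

Lemma zero_module_iso M N : iso M N -> zero_module M -> zero_module N.
Proof.
by case=> f [g fK gK] M0 x; rewrite -[x]gK (M0 (g x)) linear0.
Qed.

Lemma zero_iso M N : zero_module M -> zero_module N -> iso M N.
Proof.
move=> M0 N0; exists \0; exists (fun _ => 0) => x; by rewrite ?(M0 x) ?(N0 x).
Qed.

Lemma zero_modulePn M : ~ zero_module M <-> exists x : M, x != 0.
Proof.
split=> [|[x /eqP nx] M0]; last exact: nx.
by move/existsNP => [x /eqP nx]; exists x.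
Qed.

Lemma lin_sum_fun M N (I : finType) (g : I -> {linear M -> N}) :
  exists f : {linear M -> N}, forall x, f x = \sum_i g i x.
Proof.
have lf : linear (fun x => \sum_i g i x).
  move=> a x y; rewrite scaler_sumr -big_split; apply: eq_bigr => i _.
  exact: linearP.
by exists (mklin lf).
Qed.

Fact scalar_map_linear M (x : M) : linear ((fun a : A => a *: x) : A^o -> M).
Proof. by move=> a b c; rewrite scalerDl scalerA. Qed.
Definition scalar_map M (x : M) : {linear A^o -> M} :=
  locked (mklin (scalar_map_linear x)).

Lemma scalar_mapE M (x : M) (a : A) : scalar_map x a = a *: x.
Proof. by rewrite /scalar_map -lock. Qed.

Definition pair_map X Y W (f : {linear X -> W}) (g : {linear Y -> W}) :
  {linear (X * Y)%type -> W} :=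
  locked ((f \o fst) \+ (g \o snd) : {linear _ -> _}).

Lemma pair_mapE X Y W (f : {linear X -> W}) (g : {linear Y -> W}) u :
  pair_map f g u = f u.1 + g u.2.
Proof. by rewrite /pair_map -lock. Qed.

Fact into_pair_linear X Y W (f : {linear W -> X}) (g : {linear W -> Y}) :
  linear (fun x => (f x, g x)).
Proof. by move=> a x y; rewrite !linearP. Qed.

Definition into_pair X Y W (f : {linear W -> X}) (g : {linear W -> Y}) :
  {linear W -> (X * Y)%type} := locked (mklin (into_pair_linear f g)).

Lemma into_pairE X Y W (f : {linear W -> X}) (g : {linear W -> Y}) x :
  into_pair f g x = (f x, g x).
Proof. by rewrite /into_pair -lock. Qed.

Lemma iso_prod X Y X' Y' : iso X X' -> iso Y Y' -> iso (X * Y)%type (X' * Y')%type.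
Proof.
move=> [f [f' fK f'K]] [g [g' gK g'K]]; exists (into_pair (f \o fst) (g \o snd)).
by exists (fun u => (f' u.1, g' u.2)) => -[x y] /=; rewrite into_pairE /= ?fK ?gK ?f'K ?g'K.
Qed.

End LinearMaps.

Section Submodules.
Variable A : pzRingType.
Implicit Types M N X Y Z W : lmodType A.

Definition closed_prop M (P : M -> Prop) : Prop :=
  [/\ P 0, forall x y, P x -> P y -> P (x + y) & forall a x, P x -> P (a *: x)].

Definition submodule_of_pred M (P : M -> Prop) : {pred M} := [pred x | `[< P x >]].

Fact submodule_of_closed M (P : M -> Prop) :
  closed_prop P -> subsemimod_closed (submodule_of_pred P).
Proof.
case=> P0 PD PZ; split; first split; first exact/asboolP.
  by move=> x y /asboolP hx /asboolP hy; apply/asboolP; exact: PD.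
by move=> a x /asboolP hx; apply/asboolP; exact: PZ.
Qed.

Definition submodule_of M (P : M -> Prop) (clP : closed_prop P) : submodule M :=
  Submodule (submodule_of_closed clP).

Lemma submodule_ofP M (P : M -> Prop) (clP : closed_prop P) x :
  reflect (P x) (x \in submodule_of clP).
Proof. exact: asboolP. Qed.

Fact kerS_closed M N (f : {linear M -> N}) : closed_prop (fun x => f x = 0).
Proof.
split; first exact: linear0.
  by move=> x y fx fy; rewrite linearD fx fy addr0.
by move=> a x fx; rewrite linearZ_LR fx scaler0.
Qed.
Definition kerS M N (f : {linear M -> N}) := submodule_of (kerS_closed f).
Lemma kerSP M N (f : {linear M -> N}) x : reflect (f x = 0) (x \in kerS f).
Proof. exact: submodule_ofP. Qed.

Fact imS_closed M N (f : {linear M -> N}) : closed_prop (fun y => exists x, f x = y).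
Proof.
split; first by exists 0; exact: linear0.
  by move=> _ _ [x <-] [y <-]; exists (x + y); rewrite linearD.
by move=> a _ [x <-]; exists (a *: x); rewrite linearZ_LR.
Qed.
Definition imS M N (f : {linear M -> N}) := submodule_of (imS_closed f).
Lemma imSP M N (f : {linear M -> N}) y : reflect (exists x, f x = y) (y \in imS f).
Proof. exact: submodule_ofP. Qed.

Fact preS_closed M N (f : {linear M -> N}) (U : submodule N) :
  closed_prop (fun x => f x \in U).
Proof.
split; first by rewrite linear0 rpred0.
  by move=> x y hx hy; rewrite linearD rpredD.
by move=> a x hx; rewrite linearZ_LR rpredZ.
Qed.
Definition preS M N (f : {linear M -> N}) (U : submodule N) := submodule_of (preS_closed f U).
Lemma preSP M N (f : {linear M -> N}) (U : submodule N) x : reflect (f x \in U) (x \in preS f U).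
Proof. exact: submodule_ofP. Qed.

Lemma sub_imageP M N (f : {linear M -> N}) (U : submodule M) y :
  reflect (exists2 x, x \in U & y = f x) (y \in sub_image f U).
Proof. exact: asboolP. Qed.

Fact joinS_closed M (U V : submodule M) :
  closed_prop (fun x => exists u v, [/\ u \in U, v \in V & x = u + v]).
Proof.
split; first by exists 0, 0; rewrite !rpred0 addr0.
  move=> _ _ [u [v [hu hv ->]]] [u' [v' [hu' hv' ->]]].
  by exists (u + u'), (v + v'); rewrite !rpredD // addrACA.
move=> a _ [u [v [hu hv ->]]]; exists (a *: u), (a *: v).
by rewrite !rpredZ // scalerDr.
Qed.
Definition joinS M (U V : submodule M) := submodule_of (joinS_closed U V).
Lemma joinSP M (U V : submodule M) x :
  reflect (exists u v, [/\ u \in U, v \in V & x = u + v]) (x \in joinS U V).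
Proof. exact: submodule_ofP. Qed.

Lemma joinSl M (U V : submodule M) : {subset U <= joinS U V}.
Proof. by move=> x xU; apply/joinSP; exists x, 0; rewrite rpred0 addr0. Qed.
Lemma joinSr M (U V : submodule M) : {subset V <= joinS U V}.
Proof. by move=> x xV; apply/joinSP; exists 0, x; rewrite rpred0 add0r. Qed.

Fact zeroS_closed M : closed_prop (fun x : M => x = 0).
Proof. by split=> // [x y -> ->|a x ->]; rewrite ?addr0 ?scaler0. Qed.
Definition zeroS M : submodule M := submodule_of (@zeroS_closed M).
Lemma zeroSP M (x : M) : reflect (x = 0) (x \in zeroS M).
Proof. exact: submodule_ofP. Qed.

Fact fullS_closed M : closed_prop (fun x : M => True).
Proof. by []. Qed.
Definition fullS M : submodule M := submodule_of (@fullS_closed M).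
Lemma in_fullS M (x : M) : x \in fullS M.
Proof. exact/submodule_ofP. Qed.

Definition inclS M (U : submodule M) : {linear subm U -> M} :=
  locked (val : {linear subm U -> M}).

Lemma inclSE M (U : submodule M) x : inclS U x = val x.
Proof. by rewrite /inclS -lock. Qed.

Lemma inclS_inj M (U : submodule M) : injective (inclS U).
Proof. by move=> x y; rewrite !inclSE; exact: val_inj. Qed.

Lemma inclSP M (U : submodule M) (x : subm U) : inclS U x \in U.
Proof. by rewrite inclSE; exact: valP. Qed.

Lemma inclS_ex M (U : submodule M) x : x \in U -> exists y, inclS U y = x.
Proof. by move=> xU; exists (exist _ x xU); rewrite inclSE. Qed.

Fact projQ_linear M (U : submodule M) : linear (fun x => \pi_(quotm U) x).
Proof. by move=> a x y; rewrite quotmD -quotm_scaleE. Qed.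
Definition projQ M (U : submodule M) : {linear M -> quotm U} :=
  locked (mklin (projQ_linear U)).

Lemma projQE M (U : submodule M) x : projQ U x = \pi_(quotm U) x.
Proof. by rewrite /projQ -lock. Qed.

Lemma projQ0 M (U : submodule M) x : projQ U x = 0 <-> x \in U.
Proof. by rewrite -(linear0 (projQ U)) !projQE quotmE subr0. Qed.

Lemma projQ_surj M (U : submodule M) y : exists x, projQ U x = y.
Proof. by exists (repr y); rewrite projQE reprK. Qed.

Lemma corestr M N (U : submodule N) (f : {linear M -> N}) :
  (forall x, f x \in U) ->
  exists g : {linear M -> subm U}, forall x, inclS U (g x) = f x.
Proof.
move=> fU; apply: (@linrel_fun A M (subm U) (fun x y => inclS U y = f x)).
- by move=> x; exact: inclS_ex.
- by move=> y; rewrite linear0 => y0; apply: (@inclS_inj _ U); rewrite y0 linear0.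
- by move=> a x y x' y' hx hx'; rewrite !linearP hx hx'.
Qed.

Lemma corestr_im M N (f : {linear M -> N}) :
  exists g : {linear M -> subm (imS f)},
    (forall x, inclS (imS f) (g x) = f x) /\ forall y, exists x, g x = y.
Proof.
have fim x : f x \in imS f by apply/imSP; exists x.
have [g gP] := corestr fim; exists g; split=> // y.
have /imSP[x gx] := inclSP y; exists x.
by apply: (@inclS_inj _ (imS f)); rewrite gP.
Qed.

Lemma quot_desc M N (U : submodule M) (f : {linear M -> N}) :
  (forall x, x \in U -> f x = 0) ->
  exists g : {linear quotm U -> N}, forall x, g (projQ U x) = f x.
Proof.
move=> fU.
have [|||g gP] := @linrel_fun A (quotm U) N (fun y z => exists2 x, projQ U x = y & f x = z).
- by move=> y; have [x <-] := projQ_surj y; exists (f x), x.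
- by move=> z [x /projQ0 /fU -> <-].
- move=> a x y x' y' [u <- <-] [v <- <-]; exists (a *: u + v); exact: linearP.
exists g => x; have [u /eqP] := gP (projQ U x).
rewrite -subr_eq0 -linearB => /eqP/projQ0/fU; rewrite linearB => /eqP.
by rewrite subr_eq0 => /eqP ->.
Qed.

End Submodules.

(** * Short exact sequences and the maps they induce *)

Section ShortExact.
Variable A : pzRingType.
Implicit Types M N X Y Z W : lmodType A.

Lemma ses_inj X Y Z (f : {linear X -> Y}) (g : {linear Y -> Z}) : ses f g -> injective f.
Proof. by case. Qed.
Lemma ses_surj X Y Z (f : {linear X -> Y}) (g : {linear Y -> Z}) :
  ses f g -> forall z, exists y, g y = z.
Proof. by case. Qed.
Lemma ses_comp0 X Y Z (f : {linear X -> Y}) (g : {linear Y -> Z}) :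
  ses f g -> forall x, g (f x) = 0.
Proof. by case=> _ ex _ x; apply/ex; exists x. Qed.
Lemma ses_exact X Y Z (f : {linear X -> Y}) (g : {linear Y -> Z}) :
  ses f g -> forall y, g y = 0 -> exists x, f x = y.
Proof. by case=> _ ex _ y /ex[x ->]; exists x. Qed.

Lemma mkses X Y Z (f : {linear X -> Y}) (g : {linear Y -> Z}) :
  (forall x, f x = 0 -> x = 0) -> (forall x, g (f x) = 0) ->
  (forall y, g y = 0 -> exists x, f x = y) -> (forall z, exists y, g y = z) -> ses f g.
Proof.
move=> fi gf ex gs; split=> //; first exact: lin_inj.
by move=> y; split=> [/ex[x <-]|[x ->]//]; exists x.
Qed.

Lemma ses_sub_quot M (U : submodule M) : ses (inclS U) (projQ U).
Proof.
apply: mkses => [x x0|x|y|z]; first by apply: (@inclS_inj _ _ U); rewrite x0 linear0.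
- by apply/projQ0; exact: inclSP.
- by move/projQ0; exact: inclS_ex.
- exact: projQ_surj.
Qed.

Lemma ses_ker M N (f : {linear M -> N}) :
  (forall y, exists x, f x = y) -> ses (inclS (kerS f)) f.
Proof.
move=> fs; apply: mkses => // [x x0|x|y].
- by apply: (@inclS_inj _ _ (kerS f)); rewrite x0 linear0.
- by apply/kerSP; exact: inclSP.
- by move/kerSP; exact: inclS_ex.
Qed.

Lemma ses_ker_im M N (f : {linear M -> N}) :
  exists g : {linear M -> subm (imS f)},
    (forall x, inclS (imS f) (g x) = f x) /\ ses (inclS (kerS f)) g.
Proof.
have [g [gP gs]] := corestr_im f; exists g; split=> //; apply: mkses => [x x0|x|y gy|//].
- by apply: (@inclS_inj _ _ (kerS f)); rewrite x0 linear0.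
- by apply: (@inclS_inj _ _ (imS f)); rewrite gP linear0; apply/kerSP/inclSP.
- by apply/inclS_ex/kerSP; rewrite -gP gy linear0.
Qed.

Lemma ses_lift X Y Z (f : {linear X -> Y}) (g : {linear Y -> Z}) W (h : {linear W -> Y}) :
  ses f g -> (forall w, g (h w) = 0) ->
  exists k : {linear W -> X}, forall w, f (k w) = h w.
Proof.
move=> s gh; apply: (@linrel_fun A W X (fun w x => f x = h w)).
- by move=> w; exact: ses_exact s _ (gh w).
- by move=> y; rewrite linear0 -(linear0 f) => /(ses_inj s).
- by move=> a x y x' y' hx hx'; rewrite !linearP hx hx'.
Qed.

Lemma surj_desc Y Z (g : {linear Y -> Z}) W (h : {linear Y -> W}) :
  (forall z, exists y, g y = z) -> (forall y, g y = 0 -> h y = 0) ->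
  exists k : {linear Z -> W}, forall y, k (g y) = h y.
Proof.
move=> gs gh.
have [|||k kP] := @linrel_fun A Z W (fun z w => exists2 y, g y = z & h y = w).
- by move=> z; have [y <-] := gs z; exists (h y), y.
- by move=> w [y /gh -> <-].
- move=> a x y x' y' [u <- <-] [v <- <-]; exists (a *: u + v); exact: linearP.
exists k => y; have [u /eqP] := kP (g y).
rewrite -subr_eq0 -linearB => /eqP/gh; rewrite linearB => /eqP.
by rewrite subr_eq0 => /eqP ->.
Qed.

Lemma ses_desc X Y Z (f : {linear X -> Y}) (g : {linear Y -> Z}) W (h : {linear Y -> W}) :
  ses f g -> (forall x, h (f x) = 0) ->
  exists k : {linear Z -> W}, forall y, k (g y) = h y.
Proof.
move=> s hf; apply: surj_desc; first exact: ses_surj s.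
by move=> y /(ses_exact s)[x <-].
Qed.

Lemma surj_iso M N N' (f : {linear M -> N}) (f' : {linear M -> N'}) :
  (forall y, exists x, f x = y) -> (forall y, exists x, f' x = y) ->
  (forall x, f x = 0 <-> f' x = 0) -> iso N N'.
Proof.
move=> fs fs' ff'; have [g gP] := surj_desc fs (fun x => proj1 (ff' x)).
exists g; apply: inj_surj_bij.
  apply: lin_inj => y; have [x <-] := fs y; rewrite gP => /ff' //.
by move=> y; have [x <-] := fs' y; exists (f x); rewrite gP.
Qed.

Lemma iso_ker M N (f : {linear M -> N}) (U : submodule M) :
  (forall y, exists x, f x = y) -> (forall x, x \in U <-> f x = 0) -> iso (quotm U) N.
Proof.
move=> fs fU; apply: (@surj_iso M _ _ (projQ U) f) => // [y|x]; first exact: projQ_surj.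
by rewrite projQ0.
Qed.

Lemma ses_iso_l X X' Y Z (f : {linear X -> Y}) (g : {linear Y -> Z}) (u : {linear X' -> X}) :
  bijective u -> ses f g -> ses (f \o u) g.
Proof.
move=> [v uK vK] s; apply: mkses => [x|x|y|] /=.
- by rewrite -(linear0 f) => /(ses_inj s); rewrite -{2}[x]uK => ->; rewrite -(linear0 u) uK.
- exact: ses_comp0 s _.
- by move=> /(ses_exact s)[x <-]; exists (v x); rewrite vK.
- exact: ses_surj s.
Qed.

Lemma ses_iso_m X Y Y' Z (f : {linear X -> Y}) (g : {linear Y -> Z}) :
  iso Y Y' -> ses f g ->
  exists (f' : {linear X -> Y'}) (g' : {linear Y' -> Z}), ses f' g'.
Proof.
move=> [u /bijective_linv[v [uK vK]]] s; exists (u \o f), (g \o v); apply: mkses => [x|x|y|z] /=.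
- by rewrite -(linear0 u) -(linear0 f) => /(can_inj uK)/(ses_inj s).
- by rewrite uK (ses_comp0 s).
- by move=> /(ses_exact s)[x fx]; exists x; rewrite fx vK.
- by have [y <-] := ses_surj s z; exists (u y); rewrite uK.
Qed.

Lemma ses_iso_r X Y Z Z' (f : {linear X -> Y}) (g : {linear Y -> Z}) (u : {linear Z -> Z'}) :
  bijective u -> ses f g -> ses f (u \o g).
Proof.
move=> [v uK vK] s; apply: mkses => [x|x|y|z] /=.
- by rewrite -(linear0 f) => /(ses_inj s).
- by rewrite (ses_comp0 s) linear0.
- by rewrite -(linear0 u) => /(can_inj uK)/(ses_exact s).
- by have [y gy] := ses_surj s (v z); exists y; rewrite gy.
Qed.

Lemma ses_bij X Y Z (f : {linear X -> Y}) (g : {linear Y -> Z}) :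
  ses f g -> zero_module Z -> bijective f.
Proof.
move=> s Z0; apply: inj_surj_bij; first exact: ses_inj s.
by move=> y; exact: ses_exact s _ (Z0 _).
Qed.

End ShortExact.

(** * Finite direct sums *)

Section DirectSums.
Variables (A : pzRingType) (I : finType) (M : I -> lmodType A).
Implicit Types (N : lmodType A).

Fact dproj_linear i : linear (fun f : dsum M => f i).
Proof. by move=> a x y; rewrite !ffunE. Qed.
Definition dproj i : {linear dsum M -> M i} := locked (mklin (dproj_linear i)).
Lemma dprojE i f : dproj i f = f i.
Proof. by rewrite /dproj -lock. Qed.

Definition dinj_fun i (x : M i) : dsum M :=
  [ffun j => dfwith (fun j => 0 : M j) x j].
Fact dinj_linear i : linear (@dinj_fun i).
Proof.
move=> a x y; apply/ffunP => j; rewrite !ffunE.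
case: (eqVneq i j) => [<-|ne]; first by rewrite !dfwith_in.
by rewrite !dfwith_out // scaler0 addr0.
Qed.
Definition dinj i : {linear M i -> dsum M} := locked (mklin (@dinj_linear i)).
Lemma dinjE i x : dinj i x = dinj_fun x.
Proof. by rewrite /dinj -lock. Qed.

Lemma dproj_inj i x : dproj i (dinj i x) = x.
Proof. by rewrite dprojE dinjE ffunE dfwith_in. Qed.

Lemma dproj_inj_neq i j x : i != j -> dproj j (dinj i x) = 0.
Proof. by move=> ne; rewrite dprojE dinjE ffunE dfwith_out. Qed.

Lemma dsum_ext (f g : dsum M) : (forall i, dproj i f = dproj i g) -> f = g.
Proof. by move=> fg; apply/ffunP => i; rewrite -!dprojE fg. Qed.

Lemma dsumE (f : dsum M) : f = \sum_i dinj i (dproj i f).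
Proof.
apply: dsum_ext => i; rewrite linear_sum (bigD1 i) //= big1 ?addr0 ?dproj_inj //.
by move=> j ji; rewrite dproj_inj_neq.
Qed.

Lemma dsum_from N (g : forall i, {linear M i -> N}) :
  exists f : {linear dsum M -> N}, forall i x, f (dinj i x) = g i x.
Proof.
have [f fE] := lin_sum_fun (fun i => g i \o dproj i : {linear dsum M -> N}).
exists f => i x; rewrite fE (bigD1 i) //= big1 ?addr0 ?dproj_inj //.
by move=> j ji; rewrite dproj_inj_neq 1?eq_sym // linear0.
Qed.

Lemma dsum_to N (g : forall i, {linear N -> M i}) :
  exists f : {linear N -> dsum M}, forall i x, dproj i (f x) = g i x.
Proof.
have [f fE] := lin_sum_fun (fun i => dinj i \o g i : {linear N -> dsum M}).
exists f => i x; rewrite fE linear_sum (bigD1 i) //= big1 ?addr0 ?dproj_inj //.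
by move=> j ji; rewrite dproj_inj_neq.
Qed.

End DirectSums.

(** * Length *)

Section Length.
Variables (A : pzRingType) (P : lmodType A).
Implicit Types M N L : lmodType A.

(* Chains of submodules are counted up to what Hom(P, -) detects.  For P = A^o  *)
(* this gives the length; for an indecomposable projective P it gives the       *)
(* multiplicity of the top of P as a composition factor.                        *)
Definition pstrict M (U V : submodule M) : Prop :=
  {subset U <= V} /\
  exists f : {linear P -> M}, (forall p, f p \in V) /\ exists p, f p \notin U.

Definition pchain M n (c : nat -> submodule M) : Prop :=
  forall i, (i < n)%N -> pstrict (c i) (c i.+1).

Definition plen_le M n : Prop :=
  forall k (c : nat -> submodule M), pchain k c -> (k <= n)%N.

Lemma pstrict_mono M (U U' V V' : submodule M) :
  {subset U' <= U} -> {subset V <= V'} -> pstrict U V -> pstrict U' V'.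
Proof.
move=> sU sV [sUV [f [fV [p fp]]]]; split; first by move=> x /sU/sUV/sV.
by exists f; split=> [q|]; [exact: sV|exists p; apply: contra fp; exact: sU].
Qed.

Lemma pstrict_image M N (f : {linear N -> M}) (U V : submodule N) :
  injective f -> pstrict U V -> pstrict (sub_image f U) (sub_image f V).
Proof.
move=> fi [sUV [h [hV [p hp]]]]; split.
  by move=> _ /sub_imageP[x xU ->]; apply/sub_imageP; exists x; first exact: sUV.
exists (f \o h); split=> [q|]; first by apply/sub_imageP; exists (h q).
by exists p; apply: contra hp => /sub_imageP[x xU] /fi ->.
Qed.

Lemma pchainS M n c (V : submodule M) : pchain n c -> pstrict (c n) V ->
  pchain n.+1 (fun i => if (i <= n)%N then c i else V).
Proof.
move=> cc st i; rewrite ltnS => lein /=; rewrite lein.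
by case: ltnP => [|lenj]; [exact: cc|rewrite (_ : i = n) //; apply/eqP; rewrite eqn_leq lein].
Qed.

Lemma plen_le_sub M N (f : {linear N -> M}) n : injective f -> plen_le M n -> plen_le N n.
Proof.
move=> fi h k c cc; apply: (h k (fun i => sub_image f (c i))) => i ik.
by apply: pstrict_image => //; exact: cc.
Qed.

Hypothesis projP : projective P.

Lemma pstrict_pre M L (g : {linear M -> L}) (U V : submodule L) :
  (forall y, exists x, g x = y) -> pstrict U V -> pstrict (preS g U) (preS g V).
Proof.
move=> gs [sUV [h [hV [p hp]]]]; split.
  by move=> x /preSP gx; apply/preSP; exact: sUV.
have [k gk] := projP h gs; exists k; split=> [q|]; first by apply/preSP; rewrite gk.
by exists p; apply: contra hp => /preSP; rewrite gk.
Qed.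

Lemma plen_le_quot M L (g : {linear M -> L}) n :
  (forall y, exists x, g x = y) -> plen_le M n -> plen_le L n.
Proof.
move=> gs h k c cc; apply: (h k (fun i => preS g (c i))) => i ik.
by apply: pstrict_pre => //; exact: cc.
Qed.

(* If a map f into V is not into U, then either it does not land in U + N, or,  *)
(* lifting it along U * N -> U + N, its component in N lands in V but not in U. *)
Lemma pstrict_split N M L (f : {linear N -> M}) (g : {linear M -> L}) (U V : submodule M) :
  ses f g -> pstrict U V ->
  pstrict (preS f U) (preS f V) \/ pstrict (sub_image g U) (sub_image g V).
Proof.
move=> s [sUV [h [hV [p hp]]]].
have sg : {subset sub_image g U <= sub_image g V}.
  by move=> _ /sub_imageP[x xU ->]; apply/sub_imageP; exists x; first exact: sUV.
case: (pselect (forall q, g (h q) \in sub_image g U)) => [ghU|/existsNP[q ghq]]; last first.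
  right; split=> //; exists (g \o h); split; last by exists q; exact/negP.
  by move=> r; apply/sub_imageP; exists (h r).
left; split; first by move=> x /preSP fx; apply/preSP; exact: sUV.
have [k kP] := corestr (f := g \o h) ghU.
have gU x : (g \o inclS U) x \in sub_image g U.
  by apply/sub_imageP; exists (inclS U x); first exact: inclSP.
have [u uP] := corestr gU.
have us y : exists x, u x = y.
  have /sub_imageP[x xU yx] := inclSP y; have [x' x'E] := inclS_ex xU.
  by exists x'; apply: (@inclS_inj _ _ (sub_image g U)); rewrite uP /= x'E.
have [l lP] := projP k us.
have [q|b bP] := @ses_lift _ _ _ _ _ _ _ (h \+ (\- (inclS U \o l)) : {linear P -> M}) s.
  by rewrite /= linearD linearN -[g (inclS U _)]uP lP kP /= subrr.
exists b; split=> [q|]; [|exists p]; rewrite -?topredE /=.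
  by apply/preSP; rewrite bP rpredB ?hV //; apply: sUV; exact: inclSP.
apply: contra hp => /preSP; rewrite bP => hU.
by rewrite -[h p](subrK (inclS U (l p))) rpredD // inclSP.
Qed.

(** Each strict step is charged to the submodule or to the quotient. The two inclusions at the end
    keep the new chains below the preimage and the image of [c k], so that the next step can be
    appended. *)
Lemma pchain_split N M L (f : {linear N -> M}) (g : {linear M -> L}) k c :
  ses f g -> pchain k c ->
  exists a b c1 c2, [/\ pchain a c1, pchain b c2, (k <= a + b)%N,
    {subset c1 a <= preS f (c k)} & {subset c2 b <= sub_image g (c k)}].
Proof.
move=> s; elim: k => [|k IH] cc.
  exists 0%N, 0%N, (fun=> preS f (c 0%N)), (fun=> sub_image g (c 0%N)); split=> //.
have [i ik|a [b [c1 [c2 [h1 h2 kab s1 s2]]]]] := IH; first by apply: cc; exact: ltnW.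
have st := cc _ (ltnSn k); have [sub _] := st.
have s1' : {subset c1 a <= preS f (c k.+1)}.
  by move=> x /s1/preSP fx; apply/preSP; exact: sub.
have s2' : {subset c2 b <= sub_image g (c k.+1)}.
  by move=> x /s2/sub_imageP[y yU ->]; apply/sub_imageP; exists y; first exact: sub.
case: (pstrict_split s st) => st'.
- exists a.+1, b, (fun i => if (i <= a)%N then c1 i else preS f (c k.+1)), c2; split=> //.
  + by apply: pchainS => //; exact: pstrict_mono st'.
  + by rewrite ltnn.
- exists a, b.+1, c1, (fun i => if (i <= b)%N then c2 i else sub_image g (c k.+1)); split=> //.
  + by apply: pchainS => //; exact: pstrict_mono st'.
  + by rewrite addnS.
  + by rewrite ltnn.
Qed.

Lemma plen_le_ses N M L (f : {linear N -> M}) (g : {linear M -> L}) a b :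
  ses f g -> plen_le N a -> plen_le L b -> plen_le M (a + b).
Proof.
move=> s ha hb k c /(pchain_split s)[a' [b' [c1 [c2 [h1 h2 kab _ _]]]]].
by rewrite (leq_trans kab) // leq_add ?(ha _ _ h1) ?(hb _ _ h2).
Qed.

Lemma pchain_ses N M L (f : {linear N -> M}) (g : {linear M -> L}) a b c1 c2 :
  ses f g -> pchain a c1 -> pchain b c2 ->
  pchain (a + b) (fun i => if (i <= a)%N then sub_image f (c1 i)
                           else preS g (c2 (i - a)%N)).
Proof.
move=> s h1 h2 i iab; case: (ltnP i a) => [ia|ai].
  by rewrite (ltnW ia); apply: pstrict_image; [exact: ses_inj s|exact: h1].
have ia : (i - a < b)%N by rewrite ltn_subLR.
have st := pstrict_pre (ses_surj s) (h2 _ ia).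
rewrite subSn //; apply: pstrict_mono st => // x.
case: ifP => // _ /sub_imageP[y _ ->]; apply/preSP.
by rewrite (ses_comp0 s) rpred0.
Qed.

Definition plen_is M n : Prop := plen_le M n /\ exists c, @pchain M n c.

Lemma plen_is_uniq M m n : plen_is M m -> plen_is M n -> m = n.
Proof.
move=> [hm [c cm]] [hn [d dn]]; apply/eqP; rewrite eqn_leq.
by rewrite (hn _ _ cm) (hm _ _ dn).
Qed.

Lemma plen_is_ses N M L (f : {linear N -> M}) (g : {linear M -> L}) a b :
  ses f g -> plen_is N a -> plen_is L b -> plen_is M (a + b).
Proof.
move=> s [ha [c1 h1]] [hb [c2 h2]]; split; first exact: plen_le_ses s ha hb.
by eexists; exact: pchain_ses s h1 h2.
Qed.

Lemma plen_is_ex M n : plen_le M n -> exists m, plen_is M m.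
Proof.
elim: n => [|n IH] hn.
  by exists 0%N; split=> //; exists (fun=> zeroS M).
case: (pselect (plen_le M n)) => [/IH //|/existsNP[k /existsNP[c /not_implyP[cc /negP nk]]]].
exists n.+1; split=> //; exists c.
suff <- : k = n.+1 by [].
by apply/eqP; rewrite eqn_leq (hn _ _ cc) ltnNge.
Qed.

End Length.

(** * Modules of finite length *)

Section FiniteLength.
Variable A : pzRingType.
Implicit Types M N L X Y Z K : lmodType A.

Lemma projective_regular : projective (A^o : lmodType A).
Proof.
move=> X Y g h gs; have [x gx] := gs (h 1); exists (scalar_map x) => p.
rewrite scalar_mapE linearZ_LR gx -linearZ_LR; congr (h _); exact: mulr1.
Qed.

Lemma strict_regular M (U V : submodule M) :
  pstrict A^o U V <-> {subset U <= V} /\ exists2 x, x \in V & x \notin U.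
Proof.
split=> -[sUV].
  by move=> [f [fV [p fp]]]; split=> //; exists (f p).
move=> [x xV xU]; split=> //; exists (scalar_map x); split.
  by move=> p; rewrite scalar_mapE rpredZ.
by exists 1; rewrite scalar_mapE scale1r.
Qed.

Notation len_le := (plen_le (A^o : lmodType A)).

Definition flen M : Prop := exists n, len_le M n.

Lemma flen_sub M N (f : {linear N -> M}) : injective f -> flen M -> flen N.
Proof. by move=> fi [n h]; exists n; exact: plen_le_sub fi h. Qed.

Lemma flen_sub_image M N (f : {linear N -> M}) (U : submodule N) :
  injective f -> flen (subm (sub_image f U)) -> flen (subm U).
Proof.
move=> fi; have fU z : (f \o inclS U) z \in sub_image f U.
  by apply/sub_imageP; exists (inclS U z); first exact: inclSP.
have [k kP] := corestr fU; apply: (flen_sub (f := k)) => y z yz.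
apply: (@inclS_inj _ _ U); apply: fi.
by rewrite -[f (inclS U y)]kP yz kP.
Qed.

Lemma flen_quot M L (g : {linear M -> L}) :
  (forall y, exists x, g x = y) -> flen M -> flen L.
Proof. by move=> gs [n h]; exists n; apply: plen_le_quot gs h; exact: projective_regular. Qed.

Lemma flen_ses N M L (f : {linear N -> M}) (g : {linear M -> L}) :
  ses f g -> flen N -> flen L -> flen M.
Proof.
move=> s [a ha] [b hb]; exists (a + b)%N.
by apply: plen_le_ses s ha hb; exact: projective_regular.
Qed.

Lemma flen_zero M : zero_module M -> flen M.
Proof.
move=> M0; exists 0%N => -[//|k] c /(_ 0%N isT)/strict_regular[_ [x _]].
by rewrite (M0 x) rpred0.
Qed.

Lemma len_le0 M : len_le M 0 -> zero_module M.
Proof.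
move=> h x; apply/eqP/negPn/negP => x0.
suff : (1 <= 0)%N by []; apply: (h 1%N (fun i => if i is 0%N then zeroS M else fullS M)).
case=> // _; apply/strict_regular; split; first by move=> y _; exact: in_fullS.
by exists x; rewrite ?in_fullS //; apply/negP => /zeroSP/eqP; rewrite (negbTE x0).
Qed.

Lemma len_le_ltl N M L (f : {linear N -> M}) (g : {linear M -> L}) n :
  ses f g -> ~ zero_module L -> len_le M n.+1 -> len_le N n.
Proof.
move=> s /zero_modulePn[y y0] h k c cc; rewrite -ltnS; have [x gx] := ses_surj s y.
apply: (h k.+1 (fun i => if (i <= k)%N then sub_image f (c i) else fullS M)).
apply: (@pchainS _ _ _ _ (fun i => sub_image f (c i))).
  by move=> i ik; apply: pstrict_image; [exact: ses_inj s|exact: cc].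
apply/strict_regular; split; first by move=> z _; exact: in_fullS.
exists x; first exact: in_fullS.
apply/negP => /sub_imageP[z _ xz]; move: y0; rewrite -gx xz (ses_comp0 s) eqxx //.
Qed.

Lemma len_le_ltr N M L (f : {linear N -> M}) (g : {linear M -> L}) n :
  ses f g -> ~ zero_module N -> len_le M n.+1 -> len_le L n.
Proof.
move=> s /zero_modulePn[x x0] h k c cc; rewrite -ltnS.
apply: (h k.+1 (fun i => if i is j.+1 then preS g (c j) else zeroS M)).
case=> [_|i ik] /=; last first.
  by apply: pstrict_pre; [exact: projective_regular|exact: ses_surj s|exact: cc].
apply/strict_regular; split; first by move=> z /zeroSP ->; rewrite rpred0.
exists (f x); first by apply/preSP; rewrite (ses_comp0 s) rpred0.
apply/negP => /zeroSP; rewrite -(linear0 f) => /(ses_inj s) x00.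
by rewrite x00 eqxx in x0.
Qed.

(** Induction on a bound for the length. A nonzero end of a short exact sequence lowers the bound
    for the other end, so each half of the induction hypothesis asks that the opposite end be
    nonzero. *)
Lemma flen_ind (T : lmodType A -> Prop) :
  (forall M, flen M ->
     (forall N L (f : {linear N -> M}) (g : {linear M -> L}),
        ses f g -> (~ zero_module L -> T N) /\ (~ zero_module N -> T L)) -> T M) ->
  forall M, flen M -> T M.
Proof.
move=> step M [n]; elim: n M => [|n IH] M h.
  apply: step => [|N L f g s]; first by exists 0%N.
  have M0 := len_le0 h; split=> -[] x; last first.
    by apply: (ses_inj s); rewrite linear0 (M0 (f x)).
  by have [y <-] := ses_surj s x; rewrite (M0 y) linear0.
apply: step => [|N L f g s]; first by exists n.+1.
split=> nz; apply: IH; [exact: len_le_ltl s nz h|exact: len_le_ltr s nz h].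
Qed.

Lemma flen_joint n K (N : 'I_n -> lmodType A) (g : forall i, {linear K -> N i}) :
  (forall i, flen (N i)) -> (forall x, (forall i, g i x = 0) -> x = 0) -> flen K.
Proof.
elim: n K N g => [|n IH] K N g fN g0; first by apply: flen_zero => x; apply: g0 => -[].
have [h [hP hs]] := corestr_im (g ord0).
apply: (@flen_ses _ _ _ (inclS (kerS h)) h).
- exact: ses_ker.
- pose g' i : {linear subm (kerS h) -> N (fintype.lift ord0 i)} :=
    g (fintype.lift ord0 i) \o inclS (kerS h).
  apply: (IH _ _ g') => // x gx.
  apply: (@inclS_inj _ _ (kerS h)); rewrite linear0; apply: g0 => i.
  have [j ->|->] := unliftP ord0 i; first exact: gx.
  by have /kerSP hx := inclSP x; rewrite -hP hx linear0.
- exact: flen_sub (@inclS_inj _ _ _) (fN ord0).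
Qed.

Lemma fg_quot M N (g : {linear M -> N}) : (forall y, exists x, g x = y) -> fg M -> fg N.
Proof.
move=> gs [n [v vP]]; exists n, (g \o v) => y; have [x <-] := gs y.
have [c ->] := vP x; exists c; rewrite linear_sum; apply: eq_bigr => i _.
by rewrite linearZ_LR.
Qed.

Lemma fg_fin (I : finType) M (v : I -> M) :
  (forall x, exists c : I -> A, x = \sum_i c i *: v i) -> fg M.
Proof.
move=> vP; exists #|I|, (v \o enum_val) => x; have [c ->] := vP x.
exists (c \o enum_val).
exact: (reindex _ (onW_bij _ (@enum_val_bij I))).
Qed.

(** The cyclic submodule on the first generator is a quotient of the regular module, and the
    quotient by it needs one generator fewer. *)
Lemma fg_sesP (T : lmodType A -> Prop) :
  (forall M, zero_module M -> T M) ->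
  (forall N M L (f : {linear N -> M}) (g : {linear M -> L}), ses f g -> T N -> T L -> T M) ->
  (forall M L (g : {linear M -> L}), (forall y, exists x, g x = y) -> T M -> T L) ->
  T A^o -> forall M, fg M -> T M.
Proof.
move=> T0 Tses Tq TA M [n [v vP]]; elim: n M v vP => [|n IH] M v vP.
  by apply: T0 => x; have [c ->] := vP x; rewrite big_ord0.
set U := imS (scalar_map (v ord0)); apply: (Tses _ _ _ _ _ (ses_sub_quot U)).
  by have [h [_ hs]] := corestr_im (scalar_map (v ord0)); exact: (Tq _ _ h) TA.
apply: (IH _ (fun i => projQ U (v (fintype.lift ord0 i)))) => y.
have [x <-] := projQ_surj y; have [c xE] := vP x.
exists (c \o fintype.lift ord0); rewrite xE big_ord_recl linearD linear_sum.
have -> : projQ U (c ord0 *: v ord0) = 0 by apply/projQ0/imSP; exists (c ord0); rewrite scalar_mapE.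
by rewrite add0r; apply: eq_bigr => i _; rewrite linearZ_LR.
Qed.

Lemma flen_fg_all : flen A^o -> forall M, fg M -> flen M.
Proof.
move=> fA; apply: fg_sesP => //; first exact: flen_zero.
  by move=> N M L f g s; exact: flen_ses s.
by move=> M L g; exact: flen_quot.
Qed.

Lemma fg_zero M : zero_module M -> fg M.
Proof.
by move=> M0; exists 0%N, (fun=> 0) => x; exists (fun=> 0); rewrite big_ord0 (M0 x).
Qed.

Lemma fg_ses N M L (f : {linear N -> M}) (g : {linear M -> L}) :
  ses f g -> fg N -> fg L -> fg M.
Proof.
move=> s [m [v vP]] [n [w wP]].
have [w' w'P] := choice (ses_surj s).
pose u (k : 'I_m + 'I_n) := match k with inl i => f (v i) | inr j => w' (w j) end.
apply: (@fg_fin _ _ u) => x; have [d dE] := wP (g x).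
have [y yE] : exists y, f y = x - \sum_j d j *: w' (w j).
  apply: (ses_exact s); rewrite linearB linear_sum dE; apply/eqP; rewrite subr_eq0.
  by apply/eqP/eq_bigr => j _; rewrite linearZ_LR w'P.
have [c cE] := vP y.
exists (fun k => match k with inl i => c i | inr j => d j end).
rewrite big_sumType /= -[LHS](subrK (\sum_j d j *: w' (w j))) -yE cE linear_sum.
by congr (_ + _); apply: eq_bigr => i _; rewrite linearZ_LR.
Qed.

Lemma fg_regular : fg A^o.
Proof.
exists 1%N, (fun=> 1) => x; exists (fun=> x); rewrite big_ord1.
by rewrite /GRing.scale /= mulr1.
Qed.

Lemma flen_fg M : flen M -> fg M.
Proof.
move: M; apply: flen_ind => M _ IH.
case: (pselect (zero_module M)) => [/fg_zero //|/zero_modulePn[x x0]].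
have s := ses_sub_quot (imS (scalar_map x)); apply: (fg_ses s).
  by have [h [_ hs]] := corestr_im (scalar_map x); exact: (fg_quot hs) fg_regular.
apply: (IH _ _ _ _ s).2; apply/zero_modulePn.
have /inclS_ex[y yE] : x \in imS (scalar_map x).
  by apply/imSP; exists 1; rewrite scalar_mapE scale1r.
exists y; apply: contra x0 => /eqP y0; by rewrite -yE y0 linear0.
Qed.

(** Without a maximal submodule every proper submodule would lie strictly inside another proper one,
    and chains would outgrow the length. *)
Lemma maximal_ex M : flen M -> ~ zero_module M -> exists U : submodule M, maximal_submodule U.
Proof.
move=> [n len] nz; apply: contrapT => nomax.
suff [c [cc _]] : exists c, pchain A^o n.+1 c /\ exists x : M, x \notin c n.+1.
  by have := len _ _ cc; rewrite ltnn.
elim: (n.+1) => [|m [c [cc [x xc]]]].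
  exists (fun=> zeroS M); split=> //; have /zero_modulePn[x x0] := nz.
  by exists x; apply: contra x0 => /zeroSP ->.
have [V [sV [y yV yc] [z zV]]] : exists V : submodule M,
    [/\ {subset c m <= V}, (exists2 y, y \in V & y \notin c m) & exists z, z \notin V].
  apply: contrapT => nV; apply: nomax; exists (c m); split=> [/(_ x)|V sV].
    by rewrite (negbTE xc).
  case: (pselect (forall z, z \in V)) => [|/existsNP[z /negP zV]]; first by right.
  left=> y; apply/idP/idP => [yV|/sV//]; apply: contrapT => /negP yc.
  by apply: nV; exists V; split=> //; [exists y|exists z].
exists (fun i => if (i <= m)%N then c i else V); split; last by exists z; rewrite ltnn.
by apply: pchainS => //; apply/strict_regular; split=> //; exists y.
Qed.

End FiniteLength.

(** * The Hopkins theorem for commutative artinian rings *)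

Section Hopkins.

Lemma max_avoiding (A : pzRingType) (M : lmodType A) (x : M) : x != 0 ->
  exists W : submodule M, x \notin W /\
    forall V : submodule M, {subset W <= V} -> x \notin V -> {subset V <= W}.
Proof.
move=> x0; pose T := {W : submodule M | x \notin W}.
pose r (V W : T) := `[< {subset sval V <= sval W} >].
have z0 : x \notin zeroS M by apply: contra x0 => /zeroSP ->.
have [||C totC|[W xW] maxW] := @ZL_preorder T (exist _ (zeroS M) z0) r.
- by move=> V; apply/asboolP.
- by move=> U V W /asboolP VU /asboolP UW; apply/asboolP => y /VU/UW.
- case: (pselect (exists V, C V)) => [[V0 CV0]|C0]; last first.
    by exists (exist _ (zeroS M) z0) => V CV; case: C0; exists V.
  have cl : closed_prop (fun y => exists2 V : T, C V & y \in sval V).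
    split=> [|y z [V CV yV] [W CW zW]|a y [V CV yV]]; first by exists V0; rewrite ?rpred0.
      case: (totC V W CV CW) => /asboolP sub; [exists W|exists V] => //; rewrite rpredD //;
        exact: sub.
    by exists V; rewrite ?rpredZ.
  have xC : x \notin submodule_of cl.
    by apply/submodule_ofP => -[[V xV]] _ /=; rewrite (negbTE xV).
  exists (exist (fun W : submodule M => x \notin W) _ xC) => V CV.
  apply/asboolP => y yV; apply/submodule_ofP.
  by exists V.
exists W; split=> // V sWV xV.
by apply/asboolP/(maxW (exist (fun W : submodule M => x \notin W) V xV))/asboolP.
Qed.

Variables (R : comPzRingType) (artR : artinian R).
Implicit Types I J : submodule R^o.

Lemma artinian_min (T : submodule R^o -> Prop) I : T I ->
  exists J, T J /\ forall J', {subset J' <= J} -> T J' -> {subset J <= J'}.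
Proof.
move=> TI; apply: contrapT => nomin.
pose S := {J | T J}.
have step (J : S) : exists J' : S, {subset sval J' <= sval J} /\
    exists2 x, x \in sval J & x \notin sval J'.
  apply: contrapT => nJ; apply: nomin; exists (sval J); split; first exact: svalP.
  move=> J' sJ TJ' x xJ; apply: contrapT => /negP xJ'; apply: nJ.
  by exists (exist _ J' TJ'); split=> //; exists x.
have [next nextP] := choice step.
pose c n := sval (iter n next (exist _ I TI)).
have [n|n0 cst] := artR (I := c); first exact: (nextP _).1.
have [x xc] := (nextP (iter n0 next (exist _ I TI))).2.
by have := cst n0.+1 (leqnSn _) x; rewrite /c /= => ->; rewrite xc.
Qed.

Fact mulmap_linear (r : R) : linear ((fun x : R => r * x) : R^o -> R^o).
Proof.
move=> a x y; rewrite mulrDr; congr (_ + _).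
exact: (etrans (mulrA r a x) (etrans (congr1 (fun s => s * x) (mulrC r a)) (esym (mulrA a r x)))).
Qed.
Definition mulmap (r : R) : {linear R^o -> R^o} := mklin (mulmap_linear r).

(* rI and the annihilator of r in I cannot both be proper in I, because one of  *)
(* them has infinite length.                                                    *)
Lemma min_infinite_cases I r :
  ~ flen (subm I) ->
  (forall J, {subset J <= I} -> ~ flen (subm J) -> {subset I <= J}) ->
  (forall x : subm I, r *: x = 0) \/
  (exists s : R, forall x : subm I, (s * r) *: x = x).
Proof.
move=> nI minI; pose h : {linear subm I -> R^o} := mulmap r \o inclS I.
have hE x : h x = r *: inclS I x by [].
case: (pselect (forall x, h x = 0)) => [h0|nh].
  by left=> x; apply: (@inclS_inj _ _ I); rewrite linearZ_LR -hE h0 linear0.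
right; have [g [_ ses_g]] := ses_ker_im h.
have fK : flen (subm (kerS h)).
  apply: contrapT => nK; apply: nh => x.
  have sK : {subset sub_image (inclS I) (kerS h) <= I}.
    by move=> _ /sub_imageP[y _ ->]; exact: inclSP.
  have /minI : ~ flen (subm (sub_image (inclS I) (kerS h))).
    by move=> fJ; apply: nK; exact: flen_sub_image (@inclS_inj _ _ I) fJ.
  by move=> /(_ sK _ (inclSP x))/sub_imageP[y /kerSP hy] /inclS_inj ->.
have sI : {subset I <= imS h}.
  apply: minI => [_ /imSP[x <-]|fI]; first by rewrite hE rpredZ ?inclSP.
  exact: nI (flen_ses ses_g fK fI).
have rI n (x : subm I) : exists y : subm I, inclS I x = r ^+ n * inclS I y.
  elim: n => [|n [y ->]]; first by exists x; rewrite mul1r.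
  have /imSP[z <-] := sI _ (inclSP y).
  by exists z; rewrite hE exprSr -mulrA.
(* The ideals generated by the powers of r stabilize: r^n0 = r^(n0+1) s, so s r acts as the identity
   on r^n0 I, which is I. *)
have [n|n0 cst] := artR (I := fun n => imS (mulmap (r ^+ n))).
  by move=> _ /imSP[x <-]; apply/imSP; exists (r * x); rewrite /= exprSr mulrA.
have /imSP[s sE] : r ^+ n0 \in imS (mulmap (r ^+ n0.+1)).
  by rewrite cst ?leqnSn //; apply/imSP; exists 1; rewrite /= mulr1.
exists s => x; apply: (@inclS_inj _ _ I); have [y xE] := rI n0 x.
rewrite linearZ_LR xE; transitivity ((s * r * r ^+ n0) * inclS I y); first exact: mulrA.
congr (_ * _); transitivity (r ^+ n0.+1 * s); last exact: sE.
by rewrite exprS [RHS]mulrC mulrA.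
Qed.

(** Take an ideal I minimal among those of infinite length, x nonzero in I, and W in I maximal among
    the submodules avoiding x. Every scalar acts on I as zero or invertibly. So an element y outside
    W, for which x lies in W + Ry, is a multiple of x modulo W, and I/W is generated by x. As W has
    finite length by minimality of I, and I/W has length at most 1, I has finite length, a
    contradiction. *)
Lemma artinian_flen : flen (R^o : lmodType R).
Proof.
apply: contrapT => nR.
have [|I [nI minI]] := @artinian_min (fun I => ~ flen (subm I)) (fullS _).
  move=> fR; apply: nR; apply: flen_quot fR => y.
  exact: (@inclS_ex _ _ (fullS (R^o)) y (in_fullS _)).
have [x x0] : exists x : subm I, x != 0.
  by apply/zero_modulePn => I0; apply: nI; exact: flen_zero.
have [W [xW maxW]] := max_avoiding x0.
have cases r := @min_infinite_cases I r nI (fun J sJ nJ => minI J sJ nJ).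
have IW y : exists r, y - r *: x \in W.
  case: (boolP (y \in W)) => yW; first by exists 0; rewrite scale0r subr0.
  have /joinSP[w [_ [wW /imSP[r <-] xE]]] : x \in joinS W (imS (scalar_map y)).
    apply: contrapT => /negP xV; case/negP: yW.
    apply: (maxW _ (@joinSl _ _ W _) xV); apply: joinSr.
    by apply/imSP; exists 1; rewrite scalar_mapE scale1r.
  rewrite scalar_mapE in xE; case: (cases r) => [r0|[s sr]].
    by move: xW; rewrite xE r0 addr0 wW.
  exists s; rewrite xE scalerDr scalerA sr opprD addrCA subrr addr0 rpredN.
  exact: rpredZ.
have fW : flen (subm W).
  have sJ : {subset sub_image (inclS I) W <= I}.
    by move=> _ /sub_imageP[y _ ->]; exact: inclSP.
  have fJ : flen (subm (sub_image (inclS I) W)).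
    apply: contrapT => /(minI _ sJ)/(_ _ (inclSP x))/sub_imageP[y yW] /inclS_inj xy.
    by rewrite xy yW in xW.
  exact: flen_sub_image (@inclS_inj _ _ I) fJ.
apply: nI; apply: (flen_ses (ses_sub_quot W) fW).
(* Two strict steps are impossible in I/W: the first contains a nonzero multiple of the class of x,
   whose scalar is then invertible on I, so it contains that generator. *)
exists 1%N => -[//|[//|k]] c cc.
have /strict_regular[_ [z zc2 zc1]] := cc 1%N isT.
have /strict_regular[_ [u uc1 uc0]] := cc 0%N isT.
have [u' uE] := projQ_surj u; have [r ur] := IW u'.
have uE' : u = r *: projQ W x.
  by rewrite -uE -linearZ_LR; apply/eqP; rewrite -subr_eq0 -linearB; apply/eqP/projQ0.
have [z' zE] := projQ_surj z; have [r' zr] := IW z'.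
have zE' : z = r' *: projQ W x.
  by rewrite -zE -linearZ_LR; apply/eqP; rewrite -subr_eq0 -linearB; apply/eqP/projQ0.
case/negP: zc1; rewrite zE'; apply: rpredZ.
case: (cases r) => [r0|[s sr]].
  by case/negP: uc0; rewrite uE' -linearZ_LR r0 linear0 rpred0.
by rewrite -[x]sr -scalerA linearZ_LR linearZ_LR -uE' rpredZ.
Qed.

End Hopkins.

(** * Modules over artin algebras *)

Section Restriction.
Variables (R : comPzRingType) (A : pzRingType) (phi : algstr R A).
Implicit Types M N L : lmodType A.

Definition resm M : Type := M.

Section Object.
Variable M : lmodType A.
HB.instance Definition _ := GRing.Zmodule.on (resm M).
Definition resm_scale (r : R) (x : resm M) : resm M := phi r *: (x : M).
Fact resm_scaleA a b x : resm_scale a (resm_scale b x) = resm_scale (a * b) x.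
Proof. by rewrite /resm_scale rmorphM scalerA. Qed.
Fact resm_scale1 : left_id 1 resm_scale.
Proof. by move=> x; rewrite /resm_scale rmorph1 scale1r. Qed.
Fact resm_scaleDr : right_distributive resm_scale +%R.
Proof. by move=> a x y; exact: scalerDr. Qed.
Fact resm_scaleDl x : {morph resm_scale^~ x : a b / a + b}.
Proof. by move=> a b; rewrite /resm_scale rmorphD scalerDl. Qed.
HB.instance Definition _ := GRing.Zmodule_isLmodule.Build R (resm M)
  resm_scaleA resm_scale1 resm_scaleDr resm_scaleDl.

End Object.

Fact res_map_linear M N (f : {linear M -> N}) : linear (f : resm M -> resm N).
Proof. by move=> a x y; rewrite linearD linearZ_LR. Qed.
Definition res_map M N (f : {linear M -> N}) : {linear resm M -> resm N} :=
  mklin (res_map_linear f).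

Lemma res_ses M N L (f : {linear N -> M}) (g : {linear M -> L}) :
  ses f g -> ses (res_map f) (res_map g).
Proof. by []. Qed.

Fact res_sub_closed M (U : submodule M) : closed_prop (fun x : resm M => x \in U).
Proof.
split; [exact: rpred0|move=> x y; exact: rpredD|move=> a x xU].
by change ((phi a *: (x : M) : M) \in U); exact: rpredZ.
Qed.

Lemma flen_res M : flen (resm M : lmodType R) -> flen M.
Proof.
move=> [n h]; exists n => k c cc; apply: (h k (fun i => submodule_of (res_sub_closed (c i)))).
move=> i ik; have /strict_regular[sc [x xc xnc]] := cc i ik.
apply/strict_regular; split; first by move=> y /submodule_ofP/sc yc; apply/submodule_ofP.
exists x; first exact/submodule_ofP.
by apply: contra xnc => /submodule_ofP.
Qed.

Hypothesis artA : artin_algebra phi.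

Lemma artin_flen_res M : fg M -> flen (resm M : lmodType R).
Proof.
have [artR [n [v vP]]] := artA; have flenR := artinian_flen artR.
move: M; apply: (@fg_sesP A (fun M => flen (resm M : lmodType R))) => [M|N M L f g s|M L g gs|].
- by move=> M0; apply: flen_zero => x; exact: M0.
- exact: flen_ses (res_ses s).
- exact: (flen_quot (g := res_map g)).
- by apply: flen_fg_all => //; exists n, v.
Qed.

Lemma artin_flen M : fg M -> flen M.
Proof. by move/artin_flen_res/flen_res. Qed.

Section HomModule.
Variables M N : lmodType A.
Definition homR : Type := lhom M N.
HB.instance Definition _ := GRing.Zmodule.on homR.
Fact homR_scale_linear (r : R) (f : homR) : linear (fun x : M => phi r *: (f : lhom M N) x).
Proof.
by move=> a x y; rewrite linearP scalerDr !scalerA alg_central.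
Qed.
Definition homR_scale (r : R) (f : homR) : homR := mklin (homR_scale_linear r f).
Fact homR_scaleA a b f : homR_scale a (homR_scale b f) = homR_scale (a * b) f.
Proof. by apply/lhomP => x /=; rewrite rmorphM scalerA. Qed.
Fact homR_scale1 : left_id 1 homR_scale.
Proof. by move=> f; apply/lhomP => x /=; rewrite rmorph1 scale1r. Qed.
Fact homR_scaleDr : right_distributive homR_scale +%R.
Proof. by move=> a f g; apply/lhomP => x /=; rewrite scalerDr. Qed.
Fact homR_scaleDl f : {morph homR_scale^~ f : a b / a + b}.
Proof. by move=> a b; apply/lhomP => x /=; rewrite rmorphD scalerDl. Qed.
HB.instance Definition _ := GRing.Zmodule_isLmodule.Build R homR
  homR_scaleA homR_scale1 homR_scaleDr homR_scaleDl.

(** A map is determined by its values on the generators of M, so Hom(M, N) embeds in a finite power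
    of N, which has finite length over R. *)
Lemma homR_flen : fg M -> fg N -> flen (homR : lmodType R).
Proof.
move=> [n [v vP]] fgN.
have ev_linear i : linear (fun f : homR => (f : lhom M N) (v i) : resm N) by move=> a f g.
apply: (@flen_joint R n homR (fun=> resm N : lmodType R) (fun i => mklin (ev_linear i))).
  by move=> _; exact: artin_flen_res.
move=> f f0; apply/lhomP => x; have [c ->] := vP x.
by rewrite linear_sum big1 // => i _; rewrite linearZ_LR [X in _ *: X](f0 i) scaler0.
Qed.

Lemma homR_span : fg M -> fg N ->
  exists n (v : 'I_n -> {linear M -> N}), forall f : {linear M -> N},
    exists c : 'I_n -> R, forall x, f x = \sum_(i < n) phi (c i) *: v i x.
Proof.
move=> fgM fgN; have [n [v vP]] := flen_fg (homR_flen fgM fgN).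
exists n, v => f; have [c fE] := vP f; exists c => x; rewrite fE {fE}.
have ev_linear : linear (fun f : homR => (f : lhom M N) x : resm N) by move=> a g h.
exact: (linear_sum (mklin ev_linear)).
Qed.

End HomModule.

End Restriction.

(** * Fitting's lemma and local endomorphism rings *)

Section Fitting.
Variable A : pzRingType.
Implicit Types M N L X Y Z K : lmodType A.

(** If L were nonzero, a bound n+1 for the length of M would give the bound n for the submodule,
    which is M again; the bound would descend to 0. *)
Lemma flen_self_sub M L (f : {linear M -> M}) (g : {linear M -> L}) :
  flen M -> ses f g -> zero_module L.
Proof.
move=> [n len] s; apply: contrapT => nL; apply: (nL) => y.
have [x <-] := ses_surj s y.
suff /len_le0 M0 : plen_le A^o M 0 by rewrite (M0 x) linear0.
by elim: n len => // n IH len; apply: IH; exact: len_le_ltl s nL len.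
Qed.

Lemma flen_self_quot M K (f : {linear K -> M}) (g : {linear M -> M}) :
  flen M -> ses f g -> zero_module K.
Proof.
move=> [n len] s; apply: contrapT => nK; apply: (nK) => x.
suff /len_le0 M0 : plen_le A^o M 0 by apply: (ses_inj s); rewrite linear0 (M0 (f x)).
by elim: n len => // n IH len; apply: IH; exact: len_le_ltr s nK len.
Qed.

Lemma flen_inj_bij M (f : {linear M -> M}) : flen M -> injective f -> bijective f.
Proof.
move=> fM fi; have s : ses f (projQ (imS f)).
  apply: mkses => [x|x|y|]; last exact: projQ_surj.
  - by move=> fx; apply: fi; rewrite fx linear0.
  - by apply/projQ0/imSP; exists x.
  - by move/projQ0/imSP.
exact: ses_bij s (flen_self_sub fM s).
Qed.

Lemma flen_surj_bij M (f : {linear M -> M}) :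
  flen M -> (forall y, exists x, f x = y) -> bijective f.
Proof.
move=> fM fs; apply: inj_surj_bij => //.
have K0 := flen_self_quot fM (ses_ker fs).
apply: lin_inj => x fx; have [y <-] : exists y, inclS (kerS f) y = x.
  exact/inclS_ex/kerSP.
by rewrite (K0 y) linear0.
Qed.

Lemma endoX M (f : endo M) n x : (f ^+ n) x = iter n f x.
Proof. by elim: n x => [|n IH] x //=; rewrite exprS -IH. Qed.

Lemma fitting M (f : {linear M -> M}) : flen M -> indecomposable M ->
  bijective f \/ exists n, forall x, iter n f x = 0.
Proof.
move=> fM [nM ind].
(* Otherwise the kernels of the iterates would form a strictly increasing chain of any length. *)
have [n nP] : exists n, forall x, iter n.+1 f x = 0 -> iter n f x = 0.
  apply: contrapT => nst; have [n len] := fM.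
  suff : (n.+1 <= n)%N by rewrite ltnn.
  apply: (len _ (fun i => kerS ((f : endo M) ^+ i))) => i _; apply/strict_regular.
  split; first by move=> x /kerSP; rewrite endoX => fx; apply/kerSP; rewrite endoX /= fx linear0.
  have /existsNP[x /not_implyP[fx nfx]] := (forallNP _).2 nst i.
  exists x; first by apply/kerSP; rewrite endoX.
  by apply/kerSP; rewrite endoX.
have nPk k x : iter (k + n) f x = 0 -> iter n f x = 0.
  elim: k x => [//|k IH] x; rewrite addSn iterSr => /IH; rewrite -iterSr.
  exact: nP.
(* For p = f^n the kernel of p^2 is that of p, so p is bijective on its image and M is the direct
   sum of the kernel and the image of p. One of the two is zero. *)
pose p : {linear M -> M} := (f : endo M) ^+ n; have pE x : p x = iter n f x by exact: endoX.
have pp x : p (p x) = 0 -> p x = 0 by rewrite !pE -iterD; exact: nPk.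
have piU x : (p \o inclS (imS p)) x \in imS p by apply/imSP; exists (inclS (imS p) x).
have [q qP] := corestr piU.
have qb : bijective q.
  apply: flen_inj_bij; first exact: flen_sub (@inclS_inj _ _ _) fM.
  apply: lin_inj => x qx; apply: (@inclS_inj _ _ (imS p)).
  have /imSP[y yE] := inclSP x; rewrite linear0 -yE; apply: pp.
  by have := qP x; rewrite qx linear0 /= -yE.
pose s := pair_map (inclS (kerS p)) (inclS (imS p)).
have sb : bijective s.
  apply: inj_surj_bij.
    apply: lin_inj => -[x y]; rewrite pair_mapE /= => xy.
    have /kerSP px := inclSP x; have y0 : y = 0.
      have [q' qK _] := qb; apply: (can_inj qK); rewrite linear0.
      apply: (@inclS_inj _ _ (imS p)); rewrite qP linear0 /=.
      by have := congr1 p xy; rewrite linearD px add0r linear0.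
    move: xy; rewrite y0 linear0 addr0 => x0.
    by congr (_, _); apply: (@inclS_inj _ _ (kerS p)); rewrite x0 linear0.
  move=> x; have [q' _ q'K] := qb.
  have [y yE] : exists y, inclS (imS p) y = p x by apply/inclS_ex/imSP; exists x.
  have [z zE] : exists z, inclS (kerS p) z = x - inclS (imS p) (q' y).
    apply/inclS_ex/kerSP; rewrite linearB -yE; apply/eqP; rewrite subr_eq0; apply/eqP.
    by rewrite -[in LHS](q'K y) qP.
  by exists (z, q' y); rewrite pair_mapE /= zE subrK.
have [] := ind _ _ (iso_sym (ex_intro _ s sb)) => [K0|I0]; [left|right].
- apply: flen_inj_bij => //; apply: lin_inj => x fx.
  have [y <-] : exists y, inclS (kerS p) y = x.
    apply/inclS_ex/kerSP; rewrite pE; apply: (nPk 1%N); rewrite add1n iterSr fx.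
    by rewrite -pE linear0.
  by rewrite (K0 y) linear0.
- exists n => x; rewrite -pE; have [y <-] : exists y, inclS (imS p) y = p x.
    by apply/inclS_ex/imSP; exists x.
  by rewrite (I0 y) linear0.
Qed.

(** Let k be the inverse of h. If k f is not bijective it is nilpotent; as g x = 0 forces k f x = x,
    g is then injective. *)
Lemma local_add M (f g h : {linear M -> M}) : flen M -> indecomposable M ->
  (forall x, f x + g x = h x) -> bijective h -> bijective f \/ bijective g.
Proof.
move=> fM iM fgh bh; have [k [hK kK]] := bijective_linv bh.
have kf u : bijective (k \o u) -> bijective u.
  by move=> bk; apply: (eq_bij (bij_comp bh bk)) => x /=; exact: kK.
have [bf|[n nil]] := fitting (k \o f) fM iM; [by left; exact: kf|right].
apply: flen_inj_bij => //; apply: lin_inj => x gx.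
have kfx : k (f x) = x by rewrite -[f x]addr0 -gx fgh hK.
by rewrite -(nil x); elim: n {nil} => //= n <-.
Qed.

Lemma indec_nz M : indecomposable M -> ~ zero_module M.
Proof. by case. Qed.

Lemma zero_not_bij M : indecomposable M -> ~ bijective (\0 : {linear M -> M}).
Proof.
move=> iM [k kK _]; apply: (indec_nz iM) => x; by rewrite -(kK x) -(kK 0).
Qed.

Lemma local_sum M (I : finType) (f : I -> {linear M -> M}) : flen M -> indecomposable M ->
  (forall x, x = \sum_i f i x) -> exists i, bijective (f i).
Proof.
move=> fM iM fE; apply: contrapT => nf.
have : exists F : {linear M -> M},
    (forall x, F x = \sum_(i <- index_enum I) f i x) /\ ~ bijective F.
  elim: (index_enum I) => [|i s [F [FE nF]]].
    by exists \0; split=> [x|]; [rewrite big_nil|exact: zero_not_bij].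
  exists (f i \+ F); split=> [x|b]; first by rewrite big_cons -FE.
  by have [bi|//] := local_add (h := f i \+ F) fM iM (fun x => erefl) b; apply: nf; exists i.
case=> F [FE]; apply; have bid : bijective (@id M) by exists id.
by apply: (eq_bij bid) => x; rewrite FE -fE.
Qed.

Lemma bij_comp_flen M (f g : {linear M -> M}) : flen M -> bijective (f \o g) ->
  bijective f /\ bijective g.
Proof.
move=> fM [k kK Kk]; split; last first.
  by apply: flen_inj_bij fM _ => x y gxy; rewrite -(kK x) -(kK y) /= gxy.
by apply: flen_surj_bij fM _ => y; exists (g (k y)); exact: Kk.
Qed.

End Fitting.

(** * Direct sum decompositions *)

Section KrullSchmidt.
Variable A : pzRingType.
Implicit Types M N L X Y Z K : lmodType A.

Lemma indecomposable_iso M N : iso M N -> indecomposable M -> indecomposable N.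
Proof.
move=> i [nM ind]; split=> [N0|X Y j]; first exact: nM (zero_module_iso (iso_sym i) N0).
exact: ind (iso_trans i j).
Qed.

Lemma flen_indec_dec M : flen M -> zero_module M \/ indecomposable M \/
  exists X Y, [/\ iso M (X * Y)%type, ~ zero_module X & ~ zero_module Y].
Proof.
move=> fM; case: (pselect (zero_module M)) => [|nM]; [by left|right].
case: (pselect (indecomposable M)) => [|nI]; [by left|right].
apply: contrapT => nXY; apply: nI; split=> // X Y i; apply: contrapT => /not_orP[nX nY].
by apply: nXY; exists X, Y.
Qed.

Definition retract N M : Prop :=
  exists (a : {linear N -> M}) (r : {linear M -> N}), forall x, r (a x) = x.

Lemma retract_trans L M N : retract L M -> retract M N -> retract L N.
Proof.
move=> [a [r ra]] [b [s sb]]; exists (b \o a), (r \o s) => x /=.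
by rewrite sb ra.
Qed.

Lemma iso_retract M N : iso M N -> retract M N.
Proof. by move=> [f /bijective_linv[g [fK _]]]; exists f, g. Qed.

Fact inl_linear X Y : linear (fun x : X => (x, 0) : (X * Y)%type).
Proof. by move=> a x y; congr (_, _); rewrite /= scaler0 addr0. Qed.
Definition inlm X Y : {linear X -> (X * Y)%type} := locked (mklin (@inl_linear X Y)).
Lemma inlmE X Y x : inlm X Y x = (x, 0).
Proof. by rewrite /inlm -lock. Qed.
Fact inr_linear X Y : linear (fun y : Y => (0, y) : (X * Y)%type).
Proof. by move=> a x y; congr (_, _); rewrite /= scaler0 addr0. Qed.
Definition inrm X Y : {linear Y -> (X * Y)%type} := locked (mklin (@inr_linear X Y)).
Lemma inrmE X Y y : inrm X Y y = (0, y).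
Proof. by rewrite /inrm -lock. Qed.

Lemma retract_prodl X Y : retract X (X * Y)%type.
Proof. by exists (inlm X Y), fst => x; rewrite inlmE. Qed.
Lemma retract_prodr X Y : retract Y (X * Y)%type.
Proof. by exists (inrm X Y), snd => x; rewrite inrmE. Qed.

Lemma retract_iso N M (a : {linear N -> M}) (r : {linear M -> N}) :
  (forall x, r (a x) = x) -> iso M (N * subm (kerS r))%type.
Proof.
move=> ra; apply: iso_sym; exists (pair_map a (inclS (kerS r))); apply: inj_surj_bij.
  apply: lin_inj => -[x k]; rewrite pair_mapE /= => e.
  have /kerSP rk := inclSP k.
  have x0 : x = 0 by have := congr1 r e; rewrite linearD ra rk addr0 linear0.
  move: e; rewrite x0 linear0 add0r => k0; congr (_, _).
  by apply: (@inclS_inj _ _ (kerS r)); rewrite k0 linear0.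
move=> y; have [k kE] : exists k, inclS (kerS r) k = y - a (r y).
  by apply/inclS_ex/kerSP; rewrite linearB ra subrr.
by exists (r y, k); rewrite pair_mapE /= kE addrC subrK.
Qed.

Lemma retract_summand N M : retract N M <-> direct_summand N M.
Proof.
split=> [[a [r ra]]|[N' i]]; first by exists (subm (kerS r)); exact: retract_iso ra.
exact: retract_trans (retract_prodl _ _) (iso_retract (iso_sym i)).
Qed.

Lemma retract_flen N M : retract N M -> flen M -> flen N.
Proof. by move=> [a [r ra]]; apply: flen_sub; exact: can_inj ra. Qed.

Lemma retract_fg N M : retract N M -> fg M -> fg N.
Proof. by move=> [a [r ra]]; apply: (fg_quot (g := r)) => x; exists (a x). Qed.

Lemma retract_projective N M : retract N M -> projective M -> projective N.
Proof.
move=> [a [r ra]] pM X Y g h gs; have [k kP] := pM _ _ g (h \o r) gs.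
by exists (k \o a) => x; rewrite /= kP /= ra.
Qed.

(* M is a direct summand of the direct sum of the N i.                          *)
Definition sumfac (I : finType) (N : I -> lmodType A) M : Prop :=
  exists (a : forall i, {linear M -> N i}) (b : forall i, {linear N i -> M}),
    forall x, x = \sum_i b i (a i x).

Lemma sumfac_retract (I : finType) (N : I -> lmodType A) M M' :
  retract M' M -> sumfac N M -> sumfac N M'.
Proof.
move=> [u [v vu]] [a [b ab]]; exists (fun i => a i \o u), (fun i => v \o b i) => x /=.
by rewrite -linear_sum -ab vu.
Qed.

Lemma sumfac_dsum (I : finType) (N : I -> lmodType A) : sumfac N (dsum N).
Proof. by exists (dproj N), (dinj N) => x; exact: dsumE. Qed.

Lemma sumfac_iso (I : finType) (N : I -> lmodType A) M :
  iso M (dsum N) -> sumfac N M.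
Proof. by move=> /iso_retract h; apply: sumfac_retract h (sumfac_dsum N). Qed.

Lemma sumfac_comp (I J : finType) (N : I -> lmodType A) (L : J -> lmodType A) M :
  sumfac N M -> (forall i, sumfac L (N i)) -> sumfac (fun k : I * J => L k.2) M.
Proof.
move=> [a [b ab]] /(_ _)/cid hN; have {hN} hN i := hN i.
pose c i := projT1 (hN i).
have hc i : exists d : forall j, {linear L j -> N i}, forall x, x = \sum_j d j (c i j x).
  exact: (projT2 (hN i)).
pose d i := projT1 (cid (hc i)).
have dP i : forall x, x = \sum_j d i j (c i j x) by exact: (projT2 (cid (hc i))).
exists (fun k => c k.1 k.2 \o a k.1), (fun k => b k.1 \o d k.1 k.2) => x.
rewrite -(pair_bigA _ (fun i j => b i (d i j (c i j (a i x))))) /= {1}[x]ab.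
by apply: eq_bigr => i _; rewrite -linear_sum -dP.
Qed.

(** The identity of M is the sum of the [b i \o a i], one of which is bijective since the
    endomorphism ring is local. This splits M off [N i], and the complement is zero. *)
Lemma krull_schmidt (I : finType) (N : I -> lmodType A) M :
  flen M -> indecomposable M -> (forall i, indecomposable (N i)) -> sumfac N M ->
  exists i, iso M (N i).
Proof.
move=> fM iM iN [a [b ab]]; have [i bi] := local_sum (f := fun i => b i \o a i) fM iM ab.
exists i; have [u [uK _]] := bijective_linv bi.
pose r : {linear N i -> M} := u \o b i; have ra x : r (a i x) = x by exact: uK.
have [_ ind] := iN i; case: (ind _ _ (retract_iso ra)) => [M0|K0].
  by case: (indec_nz iM).
exists (a i); exists r => // y.
have [k kE] : exists k, inclS (kerS r) k = y - a i (r y).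
  by apply/inclS_ex/kerSP; rewrite linearB ra subrr.
by apply/eqP; rewrite eq_sym -subr_eq0 -kE (K0 k) linear0.
Qed.

Section SumOf.
Variable C : lmodType A -> Prop.

(** Direct sums built one summand at a time, for proofs by induction; [SumOf_dsum] and [dsum_SumOf]
    pass to indexed sums and back. *)
Inductive SumOf M : Prop :=
| SumOf0 of zero_module M
| SumOfS X Y of C X & SumOf Y & iso M (X * Y)%type.

Lemma SumOf_iso M N : iso N M -> SumOf M -> SumOf N.
Proof.
move=> i [M0|X Y cX sY j]; first by apply: SumOf0; exact: zero_module_iso (iso_sym i) M0.
by apply: SumOfS cX sY _; exact: iso_trans i j.
Qed.

Fact prodA_linear X Y Z :
  linear (fun u : (X * Y * Z)%type => (u.1.1, (u.1.2, u.2)) : (X * (Y * Z))%type).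
Proof. by []. Qed.

Lemma iso_prodA X Y Z : iso (X * Y * Z)%type (X * (Y * Z))%type.
Proof.
exists (mklin (@prodA_linear X Y Z)); exists (fun u => (u.1, u.2.1, u.2.2)).
  by move=> [[x y] z].
by move=> [x [y z]].
Qed.

Lemma iso_prod0 X Y : zero_module X -> iso (X * Y)%type Y.
Proof.
move=> X0; exists snd; exists (fun y => (0, y)) => // -[x y].
by rewrite (X0 x).
Qed.

Lemma iso_prodr0 X Y : zero_module Y -> iso (X * Y)%type X.
Proof.
move=> X0; exists fst; exists (fun y => (y, 0)) => // -[x y].
by rewrite (X0 y).
Qed.

Lemma SumOf_prod X Y M : SumOf X -> SumOf Y -> iso M (X * Y)%type -> SumOf M.
Proof.
move=> sX; elim: sX M => {X} [X X0|X X1 X2 cX1 _ IH i] M sY j.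
  by apply: SumOf_iso sY; exact: iso_trans j (iso_prod0 _ X0).
apply: SumOfS cX1 (IH _ sY (iso_refl _)) _.
apply: iso_trans (iso_prodA _ _ _); apply: iso_trans j _.
exact: iso_prod (iso_refl _).
Qed.

Lemma SumOf1 X : C X -> SumOf X.
Proof.
have Z0 : zero_module (subm (zeroS X)).
  by move=> x; apply: (@inclS_inj _ _ (zeroS X)); rewrite linear0; apply/zeroSP/inclSP.
move=> cX; exact: SumOfS cX (SumOf0 Z0) (iso_sym (iso_prodr0 _ Z0)).
Qed.

Lemma flen_SumOf M : flen M ->
  (forall N, retract N M -> indecomposable N -> C N) -> SumOf M.
Proof.
move: M; apply: flen_ind => M fM IH hC.
have [M0|[iM|[X [Y [i nX nY]]]]] := flen_indec_dec fM; first exact: SumOf0.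
  by apply: SumOf1; apply: hC => //; exact/iso_retract/iso_refl.
have [f [g s]] : exists (f : {linear X -> M}) (g : {linear M -> Y}), ses f g.
  exact: ses_iso_m (iso_sym i) (split_ses _ _).
have [hX hY] := IH _ _ _ _ s; have rM := iso_retract (iso_sym i).
apply: (SumOf_prod _ _ i); [apply: hX => // N rN|apply: hY => // N rN]; apply: hC.
  exact: retract_trans rN (retract_trans (retract_prodl _ _) rM).
exact: retract_trans rN (retract_trans (retract_prodr _ _) rM).
Qed.

Lemma iso_dsum_recl n (N : 'I_n.+1 -> lmodType A) :
  iso (N ord0 * dsum (fun i => N (fintype.lift ord0 i)))%type (dsum N).
Proof.
have [f fP] := dsum_from (fun i => dinj N (fintype.lift ord0 i)).
have [g gP] := dsum_to (fun i => dproj N (fintype.lift ord0 i)).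
exists (pair_map (dinj N ord0) f); exists (into_pair (dproj N ord0) g).
  move=> [x y]; rewrite into_pairE pair_mapE /=; congr (_, _).
    rewrite linearD dproj_inj [y]dsumE !linear_sum big1 ?addr0 // => i _.
    by rewrite fP dproj_inj_neq.
  apply: dsum_ext => i; rewrite gP linearD dproj_inj_neq // add0r.
  rewrite {1}[y]dsumE linear_sum linear_sum (bigD1 i) //= fP dproj_inj big1 ?addr0 // => j ji.
  by rewrite fP dproj_inj_neq // (inj_eq lift_inj).
move=> u; rewrite into_pairE pair_mapE /= [RHS]dsumE big_ord_recl; congr (_ + _).
rewrite [g u]dsumE linear_sum; apply: eq_bigr => i _; by rewrite fP gP.
Qed.

Lemma SumOf_dsum M : SumOf M ->
  exists n (N : 'I_n -> lmodType A), (forall i, C (N i)) /\ iso M (dsum N).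
Proof.
elim=> {M} [M M0|M X Y cX _ [n [N [cN i]]] j].
  have nA (i : 'I_0) : lmodType A by case: i.
  exists 0%N, nA; split=> [[]//|]; apply: zero_iso => // x.
  by apply: dsum_ext => -[].
pose N' (i : 'I_n.+1) := if unlift ord0 i is Some k then N k else X.
have N'S k : N' (fintype.lift ord0 k) = N k by rewrite /N' liftK.
have N'0 : N' ord0 = X by rewrite /N' unlift_none.
exists n.+1, N'; split=> [k|].
  by have [l ->|->] := unliftP ord0 k; rewrite ?N'S ?N'0.
apply: iso_trans (iso_dsum_recl _); rewrite N'0 (funext N'S).
exact: iso_trans j (iso_prod (iso_refl _) i).
Qed.

Lemma dsum_SumOf n (N : 'I_n -> lmodType A) : (forall i, C (N i)) -> SumOf (dsum N).
Proof.
elim: n N => [|n IH] N cN; first by apply: SumOf0 => x; apply: dsum_ext => -[].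
apply: (SumOfS (cN ord0) (IH _ (fun i => cN _))).
exact: iso_sym (iso_dsum_recl _).
Qed.

End SumOf.

End KrullSchmidt.

(** * Projective modules and the Grothendieck group *)

Section LocalProjective.
Variables (A : pzRingType) (P : lmodType A).
Hypotheses (fP : flen P) (iP : indecomposable P) (pP : projective P).

(** If U were not inside a maximal submodule V, then U + V = P. Lifting the identity of P along the
    map from U x V writes it as a sum of endomorphisms with values in U and in V; one of them is
    bijective, although both submodules are proper. *)
Lemma proper_sub_rad (U : submodule P) : ~ (forall x, x \in U) -> {subset U <= Defs.rad P}.
Proof.
move=> nU x xU; apply/asboolP => V [nV maxV].
case: (maxV (joinS U V) (@joinSr _ _ U V)) => [eqV|full].
  by rewrite -eqV; exact: joinSl.
pose s := pair_map (inclS U) (inclS V).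
have ss y : exists z, s z = y.
  have /joinSP[u [v [/inclS_ex[u' <-] /inclS_ex[v' <-] ->]]] := full y.
  by exists (u', v'); rewrite pair_mapE.
have [k kP] := pP (idfun : {linear P -> P}) ss.
have fg y : (inclS U \o (fst \o k)) y + (inclS V \o (snd \o k)) y = idfun y.
  by rewrite -[RHS]kP pair_mapE.
have bid : bijective (idfun : {linear P -> P}) by exists id.
by case: (local_add fP iP fg bid) => -[g _ gK]; [case: nU|case: nV] => y; rewrite -(gK y);
  exact: inclSP.
Qed.

Lemma rad_proper : exists x : P, x \notin Defs.rad P.
Proof.
have [U maxU] := maximal_ex fP (indec_nz iP); have [/existsNP[x /negP xU] _] := maxU.
by exists x; apply: contra xU => /asboolP; apply.
Qed.

(** A form of Nakayama's lemma: the image is not contained in the radical, so it is not a proper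
    submodule. *)
Lemma hom_top_surj (N : lmodType A) (f : {linear N -> P}) :
  (exists x, f x \notin Defs.rad P) -> forall y, exists x, f x = y.
Proof.
move=> [x fx]; apply: contrapT => /existsNP[y nfy]; case/negP: fx.
suff sub : {subset imS f <= Defs.rad P} by apply: sub; apply/imSP; exists x.
by apply: proper_sub_rad => /(_ y)/imSP.
Qed.

End LocalProjective.

(** * Rings that are sums of pairwise non-isomorphic indecomposable projectives *)

Section BasicDecomposition.
Variables (B : pzRingType) (t : nat) (X : 'I_t -> lmodType B).
Hypotheses (fB : flen B^o) (isoB : iso B^o (dsum X)) (iX : forall i, indecomposable (X i))
  (nX : forall i j, iso (X i) (X j) -> i = j).
Implicit Types M N Y : lmodType B.

Lemma summand_regular i : retract (X i) B^o.
Proof.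
apply: (retract_trans _ (iso_retract (iso_sym isoB))); exists (dinj X i), (dproj X i).
exact: dproj_inj.
Qed.

Let fgX i : fg (X i) := retract_fg (summand_regular i) (fg_regular B).
Let fX i : flen (X i) := retract_flen (summand_regular i) fB.
Let pX i : projective (X i) := retract_projective (summand_regular i) (@projective_regular B).

Lemma fg_proj_sumfac Y : fg Y -> projective Y ->
  exists n, sumfac (fun k : 'I_n * 'I_t => X k.2) Y.
Proof.
move=> [n [v vP]] pY; exists n.
have [g gP] := dsum_from (M := fun _ : 'I_n => B^o : lmodType B) (fun i => scalar_map (v i)).
have gs y : exists x, g x = y.
  have [c ->] := vP y; exists (\sum_i dinj (fun _ : 'I_n => B^o : lmodType B) i (c i)).
  by rewrite linear_sum; apply: eq_bigr => i _; rewrite gP scalar_mapE.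
have [k kP] := pY _ _ g (idfun : {linear Y -> Y}) gs.
apply: sumfac_comp (fun _ => sumfac_iso isoB); apply: sumfac_retract (sumfac_dsum _).
by exists k, g.
Qed.

Lemma fg_proj_SumOf Y : fg Y -> projective Y -> SumOf (fun N => exists i, iso N (X i)) Y.
Proof.
move=> fgY pY; apply: flen_SumOf; first exact: flen_fg_all.
move=> N rN iN; have [n sN] := fg_proj_sumfac (retract_fg rN fgY) (retract_projective rN pY).
have fN : flen N by exact: flen_fg_all (retract_fg rN fgY).
by have [k ik] := krull_schmidt fN iN (fun k => iX k.2) sN; exists k.2.
Qed.

Lemma basic_rep_indec_proj : rep_indec_proj X.
Proof.
split=> // Y fgY iY pY; have [n sY] := fg_proj_sumfac fgY pY.
have [k ik] := krull_schmidt (flen_fg_all fB fgY) iY (fun k => iX k.2) sY.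
by exists k.2.
Qed.

Let top i : lmodType B := quotm (Defs.rad (X i)).

(** A nonzero map to the top of [X j] lifts to a map onto [X j], which splits; since [X i] is
    indecomposable this is an isomorphism. *)
Lemma hom_top0 i j (f : {linear X i -> top j}) : i != j -> forall x, f x = 0.
Proof.
move=> ij x; apply: contrapT => fx.
have [k kP] := pX f (@projQ_surj _ _ (Defs.rad (X j))).
have ks : forall y, exists z, k z = y.
  by apply: (hom_top_surj (fX j) (iX j) (@pX j)); exists x; apply/negP => /projQ0; rewrite kP.
have [s sP] := pX (idfun : {linear X j -> X j}) ks.
have [_ ind] := iX i; case: (ind _ _ (retract_iso sP)) => [z|K0].
  exact: indec_nz (iX j) z.
move/eqP: ij; apply; apply: nX; exists k; apply: inj_surj_bij => //.
apply: lin_inj => y ky; have [z <-] : exists z, inclS (kerS k) z = y by apply/inclS_ex/kerSP.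
by rewrite (K0 z) linear0.
Qed.

Lemma top_ses M : flen M -> ~ zero_module M ->
  exists i N (f : {linear N -> M}) (g : {linear M -> top i}), ses f g.
Proof.
move=> fM nM; have [U [nU maxU]] := maximal_ex fM nM.
have [x xU] : exists x, x \notin U.
  by apply: contrapT => nx; apply: nU => x; apply: contrapT => /negP xU; apply: nx; exists x.
have [b [b' bK]] := sumfac_iso isoB.
pose h i : {linear X i -> quotm U} := projQ U \o (scalar_map x \o b' i).
have [i hi] : exists i, exists y, h i y <> 0.
  apply: contrapT => nh; case/negP: xU; apply/projQ0.
  have -> : x = scalar_map x 1 by rewrite scalar_mapE scale1r.
  rewrite [1]bK !linear_sum big1 // => i _; apply: contrapT => hi; apply: nh.
  by exists i, (b i 1).
(* Simplicity of M/U: a submodule that [h i] does not kill already maps onto M/U. *)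
have im_full (V : submodule (X i)) : (exists2 y, y \in V & h i y <> 0) ->
    forall z, exists2 y, y \in V & h i y = z.
  move=> [y yV hy]; pose W := preS (projQ U) (sub_image (h i) V).
  have sUW : {subset U <= W}.
    by move=> u /projQ0 u0; apply/preSP/sub_imageP; exists 0; rewrite ?rpred0 ?linear0.
  case: (maxU W sUW) => [eqW|full] z.
    have [w wE] := projQ_surj (h i y).
    case: hy; rewrite -wE; apply/projQ0; rewrite -eqW.
    by apply/preSP/sub_imageP; exists y.
  have [w <-] := projQ_surj z; have /preSP/sub_imageP[y' yV' ->] := full w.
  by exists y'.
have hs z : exists y, h i y = z.
  have [|y _ <-] := im_full (fullS _) _ z; last by exists y.
  by have [y hy] := hi; exists y => //; exact: in_fullS.
(* The kernel is proper, hence inside the radical; by simplicity of M/U it is maximal, hence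
   contains the radical. *)
have kerE y : h i y = 0 <-> projQ (Defs.rad (X i)) y = 0.
  rewrite projQ0; split=> [hy|/asboolP yr].
    suff sub : {subset kerS (h i) <= Defs.rad (X i)} by apply/sub/kerSP.
    apply: (proper_sub_rad (fX i) (iX i) (@pX i)).
    by have [z hz] := hi; move=> /(_ z)/kerSP.
  apply/kerSP/yr; split=> [kf|V sV].
    by have [z hz] := hi; apply: hz; exact/kerSP/kf.
  case: (pselect (exists2 y, y \in V & h i y <> 0)) => [/im_full Vf|nV].
    right=> z; have [v vV hv] := Vf (h i z); rewrite -(subrK v z) rpredD //.
    by apply: sV; apply/kerSP; rewrite linearB hv subrr.
  left=> z; apply/idP/idP => [zV|/sV//]; apply/kerSP; apply: contrapT => hz; apply: nV.
  by exists z.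
have [u bu] := surj_iso hs (@projQ_surj _ _ (Defs.rad (X i))) kerE.
by exists i, (subm U), (inclS U), (u \o projQ U); apply: ses_iso_r bu (ses_sub_quot U).
Qed.

(** * The rank of the Grothendieck group *)

Section GrothendieckRank.

Lemma pres_fg (p : pres B) : fg (pres_module p).
Proof.
apply: (fg_quot (@projQ_surj _ _ (projT2 p))).
exists (projT1 p), (fun j => delta_mx 0 j) => x; exists (fun j => x 0 j).
exact: row_sum_delta.
Qed.

Lemma pres_ex M : fg M -> exists p : pres B, iso (pres_module p) M.
Proof.
move=> [n [v vP]].
have lf : linear (fun x : 'rV[B]_n => \sum_j x 0 j *: v j).
  move=> a x y; rewrite scaler_sumr -big_split; apply: eq_bigr => j _ /=.
  by rewrite !mxE scalerDl scalerA.
pose f := mklin lf; exists (existT _ n (kerS f)); apply: (iso_ker (f := f)) => [y|x].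
  by have [c ->] := vP y; exists (\row_j c j); apply: eq_bigr => j _; rewrite mxE.
by split=> /kerSP.
Qed.

Definition K0_class (p : pres B) : K0 B := projQ (gen_submod (@K0_rel B)) << (p : K0_gen B) >>.

Lemma K0_class_ses p' p p'' (f : {linear pres_module p' -> pres_module p})
  (g : {linear pres_module p -> pres_module p''}) :
  ses f g -> K0_class p = K0_class p' + K0_class p''.
Proof.
move=> s; apply/eqP; rewrite -subr_eq0 opprD addrA -!linearB; apply/eqP/projQ0.
by apply: mem_gen_submod; exact: K0_ses s.
Qed.

Lemma K0_ind (T : K0 B -> Prop) : T 0 -> (forall u v, T u -> T v -> T (u + v)) ->
  (forall u, T u -> T (- u)) -> (forall p, T (K0_class p)) -> forall u, T u.
Proof.
move=> T0 TD TN Tp u; have [x <-] := projQ_surj u; rewrite -[x]freeg_sumE.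
elim: (dom x) => [|p s IH]; first by rewrite big_nil linear0.
rewrite big_cons linearD; apply: (TD) => //; move: (coeff p x) => k.
rewrite -[X in << X *g _ >>]intz -freegU_mulz.
have Tn n : T (projQ (gen_submod (@K0_rel B)) (<< p >> *+ n)).
  by elim: n => [|n IHn]; rewrite ?mulr0n ?linear0 // mulrS linearD; exact: (TD _ _ (Tp p) IHn).
case: k => n; first exact: Tn n.
by rewrite NegzE mulrNz linearN; apply/TN/Tn.
Qed.

(** The universal property of K_0; it will be applied to composition multiplicities. *)
Lemma K0_lift (m : pres B -> int) :
  (forall p' p p'' (f : {linear pres_module p' -> pres_module p})
     (g : {linear pres_module p -> pres_module p''}), ses f g -> m p = m p' + m p'') ->
  exists F : {linear K0 B -> int^o}, forall p, F (K0_class p) = m p.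
Proof.
move=> mD; pose l := fglift (m : K0_gen B -> int^o).
have ladd : zmod_morphism l by exact: lift_is_additive.
pose la : {additive {freeg (K0_gen B)} -> int^o} :=
  HB.pack l (GRing.isZmodMorphism.Build _ _ l ladd).
have llin : linear l.
  move=> a x y; rewrite -[l]/(la : _ -> _) raddfD; congr (_ + _).
  by rewrite -[a]intz !scaler_int raddfMz.
have lU p : mklin llin << p >> = m p by rewrite /= /l liftU scale1r.
have [|F FE] := @quot_desc _ _ _ (gen_submod (@K0_rel B)) (mklin llin).
  apply: gen_submod_ker => _ [p' p p'' f g s].
  by rewrite !linearB !lU (mD _ _ _ _ _ s) [X in X - _ - _]addrC addrK subrr.
by exists F => p; rewrite FE lU.
Qed.

Lemma int_dependent m n (a : 'I_m -> 'I_n -> int) : (n < m)%N ->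
  exists c : 'I_m -> int, (exists i, c i != 0) /\ forall j, \sum_i c i * a i j = 0.
Proof.
move=> nm; pose M : 'M[rat]_(m, n) := \matrix_(i, j) (a i j)%:~R.
have kn0 : kermx M != 0.
  by rewrite -mxrank_eq0 mxrank_ker subn_eq0 -ltnNge (leq_ltn_trans (rank_leq_col _)).
pose v := nz_row (kermx M); have v0 : v != 0 by rewrite nz_row_eq0.
have vM : v *m M = 0 by apply/sub_kermxP; exact: nz_row_sub.
(* The rational kernel vector multiplied by the product of all its denominators. *)
pose c i : int := numq (v 0 i) * \prod_(j | j != i) denq (v 0 j).
have cE i : (c i)%:~R = (\prod_j denq (v 0 j))%:~R * v 0 i :> rat.
  rewrite (bigD1 i) //= /c !intrM -[X in _ = _ * X]divq_num_den [RHS]mulrC mulrA divfK //.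
  by rewrite intr_eq0 denq_neq0.
have d0 : (\prod_j denq (v 0 j))%:~R != 0 :> rat.
  by rewrite intr_eq0; apply/prodf_neq0 => j _; exact: denq_neq0.
exists c; split.
  have /rV0Pn[i vi] := v0; exists i; rewrite -(intr_eq0 rat) cE mulf_neq0 //.
move=> j; apply/eqP; rewrite -(intr_eq0 rat) rmorph_sum /=.
have /rowP/(_ j) := vM; rewrite !mxE => vj.
rewrite (eq_bigr (fun i => (\prod_j denq (v 0 j))%:~R * (v 0 i * M i j))).
  by rewrite -mulr_sumr vj mulr0.
by move=> i _; rewrite intrM cE mxE mulrA.
Qed.

Lemma plen_regular (P : lmodType B) M n : plen_le B^o M n -> plen_le P M n.
Proof.
move=> h k c cc; apply: (h k c) => i ik; have [sc [f [fV [p fp]]]] := cc i ik.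
by apply/strict_regular; split=> //; exists (f p).
Qed.

(** The classes of the tops generate, by induction on length. They are independent because the
    length detected by Hom([X i], -) is additive, vanishes on the other tops and is positive on
    [top i]. More than t elements are dependent by [int_dependent]. *)
Lemma K0_rank : rank_is (K0 B) t.
Proof.
have ftop i : fg (top i) by exact: fg_quot (@projQ_surj _ _ _) (fgX i).
have [S SP] := choice (fun i => pres_ex (ftop i)).
pose sigma i := K0_class (S i).
have gen : forall u, exists c : 'I_t -> int, u = \sum_i c i *: sigma i.
  apply: (K0_ind (T := fun u => exists c : 'I_t -> int, u = \sum_i c i *: sigma i)).
  - by exists (fun=> 0); rewrite big1 // => i _; rewrite scale0r.
  - move=> x y [c ->] [d ->]; exists (fun i => c i + d i); rewrite -big_split.
    by apply: eq_bigr => i _; rewrite scalerDl.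
  - move=> x [c ->]; exists (fun i => - c i); rewrite -sumrN.
    by apply: eq_bigr => i _; rewrite scaleNr.
  suff h M : flen M -> forall p, iso (pres_module p) M ->
      exists c : 'I_t -> int, K0_class p = \sum_i c i *: sigma i.
    by move=> p; apply: (h (pres_module p)) (iso_refl _); exact: flen_fg_all (pres_fg p).
  move: M; apply: flen_ind => M fM IH p ip.
  case: (pselect (zero_module M)) => [M0|nM].
    exists (fun=> 0); rewrite big1 => [|i _]; last by rewrite scale0r.
    have p0 := zero_module_iso (iso_sym ip) M0.
    (* For a zero module p the sequence p -> p -> p is exact, so [p] = [p] + [p]. *)
    have s : ses (idfun : {linear pres_module p -> pres_module p})
                 (idfun : {linear pres_module p -> pres_module p}).
      by apply: mkses => [//|x|y|z]; rewrite ?(p0 x) //; [exists y|exists z].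
    by have /eqP := K0_class_ses s; rewrite -subr_eq0 opprD addrA subrr sub0r oppr_eq0 => /eqP.
  have [i [N [f [g s]]]] := top_ses fM nM.
  have [q qN] := pres_ex (flen_fg (flen_sub (ses_inj s) fM)).
  have ntop : ~ zero_module (top i).
    move=> z; have [x /negP xr] := rad_proper (fX i) (iX i); apply: xr.
    by apply/projQ0; exact: z.
  have [c cE] := (IH _ _ _ _ s).1 ntop q qN.
  have [f1 [g1 s1]] := ses_iso_m (iso_sym ip) s.
  have [u bu] := qN; have s2 := ses_iso_l bu s1.
  have [w bw] := iso_sym (SP i); have s3 := ses_iso_r bw s2.
  exists (fun j => c j + (j == i)%:R); rewrite (K0_class_ses s3) cE.
  rewrite -[X in _ + X](_ : \sum_j (j == i)%:R *: sigma j = _).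
    by rewrite -big_split; apply: eq_bigr => j _; rewrite scalerDl.
  by rewrite (bigD1 i) //= eqxx scale1r big1 ?addr0 // => j /negPf ->; rewrite scale0r.
have len_ex i p : exists n, plen_is (X i) (pres_module p) n.
  have [n h] := flen_fg_all fB (pres_fg p).
  exact: plen_is_ex (plen_regular (P := X i) h).
have [lenf lenfP] := choice (fun ip : 'I_t * pres B => len_ex ip.1 ip.2).
pose len i p := lenf (i, p); have lenP i p : plen_is (X i) (pres_module p) (len i p).
  exact: lenfP (i, p).
have lenF i : exists F : {linear K0 B -> int^o}, forall p, F (K0_class p) = (len i p)%:Z.
  apply: K0_lift => p' p p'' f g s.
  rewrite -PoszD; congr Posz; apply: plen_is_uniq (lenP i p) _.
  exact: (plen_is_ses (@pX i) s (lenP i _) (lenP i _)).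
have len0 i j : i != j -> len i (S j) = 0%N.
  move=> ij; have [_ [c cc]] := lenP i (S j); case: (len i (S j)) cc => // n /(_ 0%N isT).
  move=> [_ [f [_ [x fx]]]]; have [u [v uK vK]] := SP j.
  have := hom_top0 (u \o f) ij x; rewrite /= -(linear0 u) => /(can_inj uK) f0.
  by rewrite f0 rpred0 in fx.
have len1 i : (0 < len i (S i))%N.
  have [h _] := lenP i (S i); have [u bu] := iso_sym (SP i).
  apply: (h 1%N (fun k => if k is 0%N then zeroS _ else fullS _)) => -[_|//].
  split=> [y _|]; first exact: in_fullS.
  exists (u \o projQ (Defs.rad (X i))); split=> [p|]; first exact: in_fullS.
  have [x xr] := rad_proper (fX i) (iX i); exists x; apply: contra xr => /zeroSP ux.
  have [v uK _] := bu; by apply/projQ0; apply: (can_inj uK); rewrite linear0 -[RHS]ux.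
split=> [|m x indx].
  exists sigma => c c0 i; have [F FE] := lenF i; have := congr1 F c0.
  rewrite linear_sum linear0 (bigD1 i) //= big1 => [|j ji]; last first.
    by rewrite linearZ_LR FE len0 1?eq_sym // scaler0.
  rewrite addr0 linearZ_LR FE => /eqP; rewrite mulf_eq0 => /orP[/eqP //|].
  by case: (len i (S i)) (len1 i).
have [a aE] := choice (fun i => gen (x i)).
rewrite leqNgt; apply/negP => /(int_dependent a)[c [[i /eqP ci] ca]]; apply: ci.
apply: indx; rewrite (eq_bigr (fun i => \sum_j (c i * a i j) *: sigma j)).
  rewrite exchange_big big1 // => j _.
  by rewrite -scaler_suml ca scale0r.
move=> k _; rewrite {1}aE scaler_sumr; apply: eq_bigr => j _; by rewrite scalerA.
Qed.

End GrothendieckRank.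

End BasicDecomposition.

(** * Filtrations and relative projectivity *)

Section Filtrations.
Variable A : pzRingType.
Implicit Types M N L X Y Z K : lmodType A.
Implicit Types C : lmodType A -> Prop.

(** Filtrations peeled off from their top factor, which gives structural induction; [filteredP]
    identifies this form with chains of submodules. *)
Inductive Filt C M : Prop :=
| Filt0 of zero_module M
| FiltS X Z (f : {linear X -> M}) (g : {linear M -> Z}) of Filt C X & C Z & ses f g.

Lemma Filt_iso C M N : iso M N -> Filt C M -> Filt C N.
Proof.
move=> i [M0|X Z f g fX cZ s]; first by apply: Filt0; exact: zero_module_iso i M0.
by have [f' [g' s']] := ses_iso_m i s; exact: FiltS fX cZ s'.
Qed.

(** Induction on the filtration of the quotient: the preimage in Y of its submodule [Z1] is an
    extension of [Z1] by X. *)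
Lemma Filt_ses C X Y Z (f : {linear X -> Y}) (g : {linear Y -> Z}) :
  ses f g -> Filt C X -> Filt C Z -> Filt C Y.
Proof.
move=> s fX fZ; elim: fZ Y f g s => {Z} [Z Z0|Z Z1 Z2 a b _ IH cZ2 sab] Y f g s.
  exact: Filt_iso (ex_intro _ f (ses_bij s Z0)) fX.
pose h : {linear Y -> Z2} := b \o g.
have hs z : exists y, h y = z.
  by have [w <-] := ses_surj sab z; have [y <-] := ses_surj s w; exists y.
apply: FiltS cZ2 (ses_ker hs).
have fh x : f x \in kerS h by apply/kerSP; rewrite /= (ses_comp0 s) linear0.
have [f' f'P] := corestr fh.
have [g' g'P] : exists g' : {linear subm (kerS h) -> Z1},
    forall y, a (g' y) = g (inclS (kerS h) y).
  apply: (ses_lift (h := g \o inclS (kerS h)) sab) => y.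
  by have /kerSP := inclSP y.
apply: (IH _ f' g'); apply: mkses => [x x0|x|y y0|z].
- by apply: (ses_inj s); rewrite -f'P x0 !linear0.
- by apply: (ses_inj sab); rewrite g'P f'P (ses_comp0 s) linear0.
- have [x xE] := ses_exact s (etrans (esym (g'P y)) (etrans (congr1 a y0) (linear0 a))).
  by exists x; apply: (@inclS_inj _ _ (kerS h)); rewrite f'P.
- have [y yE] := ses_surj s (a z).
  have [y' y'E] : exists y', inclS (kerS h) y' = y.
    by apply/inclS_ex/kerSP; rewrite /= yE (ses_comp0 sab).
  by exists y'; apply: (ses_inj sab); rewrite g'P y'E.
Qed.

Lemma Filt1 C X : C X -> Filt C X.
Proof.
move=> cX; have Z0 : zero_module (subm (zeroS X)).
  by move=> x; apply: (@inclS_inj _ _ (zeroS X)); rewrite linear0; apply/zeroSP/inclSP.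
apply: (FiltS (f := inclS (zeroS X)) (g := idfun) (Filt0 _ Z0) cX).
apply: mkses => [x _|x|y y0|z]; [exact: Z0|by rewrite (Z0 x) linear0| |by exists z].
by exists 0; rewrite linear0 -y0.
Qed.

Lemma Filt_bind C D M : (forall X, C X -> Filt D X) -> Filt C M -> Filt D M.
Proof.
move=> CD; elim=> {M} [M M0|M X Z f g _ IH cZ s]; first exact: Filt0.
exact: Filt_ses s IH (CD _ cZ).
Qed.

Lemma Filt_prod C X Y : Filt C X -> Filt C Y -> Filt C (X * Y)%type.
Proof. exact: Filt_ses (split_ses _ _). Qed.

Lemma SumOf_Filt C D M : (forall X, C X -> Filt D X) -> SumOf C M -> Filt D M.
Proof.
move=> CD; elim=> {M} [M M0|M X Y /CD fX _ fY i]; first exact: Filt0.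
exact: Filt_iso (iso_sym i) (Filt_prod fX fY).
Qed.

Lemma factor_iso M (U V : submodule M) X (g : {linear subm V -> X}) :
  (forall x, exists y, g y = x) -> (forall y, g y = 0 <-> inclS V y \in U) ->
  iso (factor V U) X.
Proof. by move=> gs gU; apply: (iso_ker gs) => x; rewrite gU inclSE. Qed.

Lemma filteredP C M : filtered C M <-> Filt C M.
Proof.
split=> [[s [F [F0 Fs Fsub FC]]]|fM].
  have FP i : (i <= s)%N -> Filt C (subm (F i)).
    elim: i => [_|i IH lis].
      apply: Filt0 => x; apply: (@inclS_inj _ _ (F 0%N)); apply/eqP.
      by rewrite linear0 -F0; exact: inclSP.
    have [X cX [u bu]] := FC i lis.
    have FF x : inclS (F i) x \in F i.+1 by apply: Fsub; rewrite ?inclSP.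
    have [f fP] := corestr FF; apply: (FiltS (f := f) (IH (ltnW lis)) cX).
    apply: (ses_iso_r (g := projQ (restrict (F i.+1) (F i))) bu).
    apply: mkses => [x x0|x|y /projQ0 yF|y]; last exact: projQ_surj.
    - by apply: (@inclS_inj _ _ (F i)); rewrite -fP x0 !linear0.
    - by apply/projQ0; rewrite inE -inclSE fP inclSP.
    - have [x xE] : exists x, inclS (F i) x = inclS (F i.+1) y.
        by apply: inclS_ex; rewrite inclSE.
      by exists x; apply: (@inclS_inj _ _ (F i.+1)); rewrite fP.
  apply: Filt_iso (FP s (leqnn s)); exists (inclS (F s)); apply: inj_surj_bij.
    exact: inclS_inj.
  by move=> y; exact: inclS_ex.
elim: fM => {M} [M M0|M X Z f g _ [s [F [F0 Fs Fsub FC]]] cZ sfg].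
  exists 0%N, (fun=> zeroS M); split=> // x; rewrite (M0 x) ?rpred0 ?eqxx //.
(* The chain of the submodule X is pushed into M, and M itself is put on top. *)
pose G i := if (i <= s)%N then sub_image f (F i) else fullS M.
have GS : G s = sub_image f (F s) by rewrite /G leqnn.
exists s.+1, G; split=> [x|x|i|i].
- apply/sub_imageP/eqP => [[y]|->]; last by exists 0; rewrite ?rpred0 ?linear0.
  by rewrite F0 => /eqP -> ->; rewrite linear0.
- by rewrite /G ltnn in_fullS.
- rewrite ltnS /G => lis x; rewrite lis; case: ifP => [lis'|_ _]; last exact: in_fullS.
  by move=> /sub_imageP[y yF ->]; apply/sub_imageP; exists y; first exact: Fsub.
- rewrite ltnS leq_eqVlt => /predU1P[->|lis].
    exists Z => //; rewrite {1}/G ltnn GS.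
    apply: (factor_iso (g := g \o inclS (fullS M))) => [z|y].
      have [x <-] := ses_surj sfg z; have [y <-] := inclS_ex (in_fullS x).
      by exists y.
    split=> [/(ses_exact sfg)[x <-]|/sub_imageP[x _ /= ->]]; last exact: ses_comp0 sfg _.
    by apply/sub_imageP; exists x.
  have [X' cX' [u bu]] := FC i lis; exists X' => //.
  rewrite /G lis (ltnW lis).
  have hP (y : subm (sub_image f (F i.+1))) :
      exists x : subm (F i.+1), f (inclS _ x) = inclS _ y.
    by have /sub_imageP[x /inclS_ex[x' <-] ->] := inclSP y; exists x'.
  have [||| h hE] := @linrel_fun A (subm (sub_image f (F i.+1))) (subm (F i.+1))
      (fun y x => f (inclS _ x) = inclS _ y).
  + exact: hP.
  + move=> x; rewrite linear0 -(linear0 f) => /(ses_inj sfg) x0.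
    by apply: (@inclS_inj _ _ (F i.+1)); rewrite x0 linear0.
  + by move=> a x y x' y' h h'; rewrite !linearP h h'.
  apply: (factor_iso (g := u \o (projQ (restrict (F i.+1) (F i)) \o h))) => [z|y].
    have [v _ vK] := bu; have [x xE] := projQ_surj (v z).
    have [y yE] : exists y, inclS (sub_image f (F i.+1)) y = f (inclS _ x).
      by apply/inclS_ex/sub_imageP; exists (inclS _ x); first exact: inclSP.
    exists y; rewrite /= -[z]vK -xE; congr (u (projQ _ _)).
    by apply: (@inclS_inj _ _ (F i.+1)); apply: (ses_inj sfg); rewrite hE.
  have -> : (u \o (projQ (restrict (F i.+1) (F i)) \o h)) y = 0 <-> inclS _ (h y) \in F i.
    rewrite /= -{1}(linear0 u); split=> [/(bij_inj bu)/projQ0|yF].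
      by rewrite inE -inclSE.
    by congr (u _); apply/projQ0; rewrite inE -inclSE.
  split=> [yF|/sub_imageP[x xF]]; first by apply/sub_imageP; exists (inclS _ (h y)).
  by rewrite -hE => /(ses_inj sfg) ->.
Qed.

Lemma Filt_fg C M : (forall X, C X -> fg X) -> Filt C M -> fg M.
Proof.
move=> Cfg; elim=> {M} [M /fg_zero //|M X Z f g _ fgX cZ s].
exact: fg_ses s fgX (Cfg _ cZ).
Qed.

(** Here E is M modulo [X1]: by the third isomorphism theorem it contains X modulo [X1] with
    quotient Z. *)
Lemma ses_quot_sub X1 X2 X M Z (a : {linear X1 -> X}) (b : {linear X -> X2})
    (f : {linear X -> M}) (g : {linear M -> Z}) : ses a b -> ses f g ->
  exists (E : lmodType A) (p : {linear M -> E}) (u : {linear X2 -> E}) (v : {linear E -> Z}),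
    [/\ ses (f \o a : {linear X1 -> M}) p, ses u v, forall m, v (p m) = g m
      & forall x, p (f x) = u (b x)].
Proof.
move=> sab sfg; pose i : {linear X1 -> M} := f \o a; pose p := projQ (imS i).
have [v vP] : exists v : {linear quotm (imS i) -> Z}, forall m, v (p m) = g m.
  by apply: quot_desc => _ /imSP[x <-]; exact: ses_comp0 sfg _.
have [u uP] : exists u : {linear X2 -> quotm (imS i)}, forall x, u (b x) = (p \o f) x.
  by apply: (ses_desc sab) => x; apply/projQ0/imSP; exists x.
exists _, p, u, v; split=> [||//|x]; last exact: esym (uP x).
  apply: mkses => [x|x|y|]; last exact: projQ_surj.
  - rewrite -(linear0 i) => /(ses_inj sfg)/(ses_inj sab) //.
  - by apply/projQ0/imSP; exists x.
  - by move/projQ0/imSP.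
apply: mkses => [x|x|y|z].
- have [y <-] := ses_surj sab x; rewrite uP => /projQ0/imSP[w /(ses_inj sfg) <-].
  exact: ses_comp0 sab _.
- have [y <-] := ses_surj sab x; rewrite uP vP; exact: ses_comp0 sfg _.
- have [m <-] := projQ_surj y; rewrite vP => /(ses_exact sfg)[x <-].
  by exists (b x); rewrite uP.
- by have [m <-] := ses_surj sfg z; exists (p m).
Qed.

(** The kernel part of the snake lemma: surjectivity of [g1] is what corrects a lift of an element
    of the kernel of [g2] to an element of the kernel of g. *)
Lemma snake Y1 Y Y2 Z1 Z Z2 K (a : {linear Y1 -> Y}) (b : {linear Y -> Y2})
    (c : {linear Z1 -> Z}) (d : {linear Z -> Z2}) (g1 : {linear Y1 -> Z1})
    (g : {linear Y -> Z}) (g2 : {linear Y2 -> Z2}) (k : {linear K -> Y}) :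
  ses a b -> ses c d -> ses k g ->
  (forall y, c (g1 y) = g (a y)) -> (forall y, g2 (b y) = d (g y)) ->
  (forall z, exists y, g1 y = z) ->
  exists (f : {linear subm (kerS g1) -> K}) (h : {linear K -> subm (kerS g2)}), ses f h.
Proof.
move=> sab scd sk ac bd g1s.
have [f fP] : exists f : {linear subm (kerS g1) -> K}, forall x, k (f x) = (a \o inclS (kerS g1)) x.
  by apply: (ses_lift sk) => x /=; have /kerSP g1x := inclSP x; rewrite -ac g1x linear0.
have bk x : (b \o k) x \in kerS g2 by apply/kerSP; rewrite /= bd (ses_comp0 sk) linear0.
have [h hP] := corestr bk; exists f, h; apply: mkses => [x x0|x|y y0|z].
- apply: (@inclS_inj _ _ (kerS g1)); apply: (ses_inj sab); have := fP x.
  by rewrite x0 !linear0.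
- apply: (@inclS_inj _ _ (kerS g2)); rewrite hP /= fP linear0; exact: ses_comp0 sab _.
- have [|y1 y1E] := ses_exact sab (y := k y) _.
    by have := hP y; rewrite y0 linear0 => /esym.
  have [x xE] : exists x, inclS (kerS g1) x = y1.
    apply/inclS_ex/kerSP/(ses_inj scd); rewrite ac y1E linear0; exact: ses_comp0 sk _.
  by exists x; apply: (ses_inj sk); rewrite fP /= xE.
- have [y yE] := ses_surj sab (inclS (kerS g2) z).
  have [|z1 z1E] := ses_exact scd (y := g y) _.
    by rewrite -bd yE; apply/kerSP/inclSP.
  have [y1 y1E] := g1s z1.
  have [|x xE] := ses_exact sk (y := y - a y1) _.
    by rewrite linearB -ac y1E z1E subrr.
  exists x; apply: (@inclS_inj _ _ (kerS g2)).
  by rewrite hP /= xE linearB (ses_comp0 sab) subr0.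
Qed.

End Filtrations.

(** * Vanishing of Ext^1 as a lifting property *)

Section RelativeProjectivity.
Variable A : pzRingType.
Implicit Types M N L X Y Z K : lmodType A.

(** Equivalent to Ext^1(M, X) = 0 by [Ext1_relproj] and [relproj_Ext1]. In this form, stability
    under extensions in X and under sums and summands in M is plain diagram chasing. *)
Definition relproj M X : Prop :=
  forall Y Z (f : {linear X -> Y}) (g : {linear Y -> Z}), ses f g ->
  forall h : {linear M -> Z}, exists k : {linear M -> Y}, forall m, g (k m) = h m.

Lemma Ext1_relproj M X : Ext1_eq0 M X -> relproj M X.
Proof.
move=> ext0 Y Z f g s h.
(* The kernel of d is the pullback of g along h, an extension of M by X; a splitting of it yields
   the lift. *)
pose d : {linear (M * Y)%type -> Z} := pair_map h (\- g).
have dE u : d u = h u.1 - g u.2 by exact: pair_mapE.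
have fd x : (inrm M Y \o f) x \in kerS d.
  by apply/kerSP; rewrite dE /= inrmE linear0 (ses_comp0 s) subr0.
have [i iP] := corestr fd.
pose p : {linear subm (kerS d) -> M} := fst \o inclS (kerS d).
have sip : ses i p.
  apply: mkses => [x x0|x|y y0|m].
  - by apply: (ses_inj s); have := iP x; rewrite x0 !linear0 /= inrmE => -[<-].
  - by rewrite /= iP /= inrmE.
  - have /kerSP := inclSP y; rewrite dE [(inclS _ y).1]y0 linear0 sub0r => /eqP.
    rewrite oppr_eq0 => /eqP/(ses_exact s)[x xE]; exists x.
    apply: (@inclS_inj _ _ (kerS d)); rewrite iP /= inrmE xE.
    by rewrite [RHS]surjective_pairing [(inclS _ y).1]y0.
  - have [y yE] := ses_surj s (h m).
    have [w wE] : exists w, inclS (kerS d) w = (m, y).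
      by apply/inclS_ex/kerSP; rewrite dE /= yE subrr.
    by exists w; rewrite /= wE.
have [e [be _ eP]] := ext0 (Extension sip).
have [e' [_ e'K]] := bijective_linv be.
exists (snd \o (inclS (kerS d) \o (e' \o inrm X M))) => m.
set w := e' (inrm X M m); have /kerSP := inclSP w; rewrite dE => /eqP.
rewrite subr_eq0 => /eqP <-; congr (h _).
by have := eP w; rewrite /w e'K /= inrmE.
Qed.

Lemma relproj_Ext1 M X : relproj M X -> Ext1_eq0 M X.
Proof.
move=> rel [E f p s].
have [k kP] := rel _ _ _ _ s (idfun : {linear M -> M}).
have [q qP] : exists q : {linear E -> X},
    forall y, f (q y) = (idfun \+ (\- (k \o p)) : {linear E -> E}) y.
  by apply: (ses_lift s) => y; rewrite /= linearB kP subrr.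
exists (into_pair q p); split=> [|x|y] /=; rewrite ?into_pairE //.
- apply: inj_surj_bij => [|[x m]].
    apply: lin_inj => y; rewrite into_pairE => -[qy py].
    by have := qP y; rewrite qy /= py !linear0 addr0 => <-.
  exists (f x + k m); rewrite into_pairE; congr (_, _); last first.
    by rewrite linearD (ses_comp0 s) kP add0r.
  apply: (ses_inj s); rewrite qP /= [p _]linearD (ses_comp0 s) kP add0r /=.
  by rewrite addrK.
- congr (_, _); last exact: ses_comp0 s x.
  by apply: (ses_inj s); rewrite qP /= (ses_comp0 s) linear0 subr0.
Qed.

Lemma relproj_zero M X : zero_module X -> relproj M X.
Proof.
move=> X0 Y Z f g s h; have bg : bijective g.
  apply: inj_surj_bij; last exact: ses_surj s.
  by apply: lin_inj => y /(ses_exact s)[x <-]; rewrite (X0 x) linear0.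
have [k [_ kK]] := bijective_linv bg.
by exists (k \o h) => m; rewrite /= kK.
Qed.

(** The map is lifted first to the quotient of Y by [X1], then to Y. *)
Lemma relproj_ses M X1 X X2 (a : {linear X1 -> X}) (b : {linear X -> X2}) :
  ses a b -> relproj M X1 -> relproj M X2 -> relproj M X.
Proof.
move=> sab r1 r2 Y Z f g s h.
have [E [p [u [v [s1 s2 vp _]]]]] := ses_quot_sub sab s.
have [k kP] := r2 _ _ _ _ s2 h; have [l lP] := r1 _ _ _ _ s1 k.
by exists l => m; rewrite -vp lP kP.
Qed.

Lemma relproj_sumfac (I : finType) (N : I -> lmodType A) M X :
  (forall i, relproj (N i) X) -> sumfac N M -> relproj M X.
Proof.
move=> rN [a [b ab]] Y Z f g s h.
have [k kP] : exists k : forall i, {linear N i -> Y}, forall i x, g (k i x) = h (b i x).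
  have ex i := cid (rN i _ _ _ _ s (h \o b i)).
  by exists (fun i => projT1 (ex i)) => i x; exact: (projT2 (ex i)).
have [l lP] := lin_sum_fun (fun i => k i \o a i : {linear M -> Y}).
exists l => m; rewrite lP linear_sum [in RHS](ab m) linear_sum.
by apply: eq_bigr => i _; exact: kP.
Qed.

Lemma relproj_Filt M (C : lmodType A -> Prop) X :
  (forall Z, C Z -> relproj M Z) -> Filt C X -> relproj M X.
Proof.
move=> rC; elim=> {X} [X|X Y Z f g _ rY /rC rZ s]; first exact: relproj_zero.
exact: relproj_ses s rY rZ.
Qed.

End RelativeProjectivity.

(** * Proper costratifying systems *)

Section LinearOrder.
Variables (t : nat) (le : rel 'I_t) (lin : linear_order le).

Lemma linear_order_op : linear_order (op_order le).
Proof.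
have [r a tr to] := lin; split=> [x|x y h|y x z h1 h2|x y]; rewrite /op_order //.
- by apply: a; rewrite andbC.
- exact: tr h2 h1.
Qed.

(** An element of U with the fewest predecessors is the least one. *)
Lemma linear_order_min (U : pred 'I_t) i0 : U i0 -> exists2 u, U u & forall j, U j -> le u j.
Proof.
have [r a tr to] := lin => Ui0.
case: (arg_minnP (fun i => #|[pred j | le j i]|) Ui0) => u Uu umin.
exists u => // j Uj; case/orP: (to u j) => // leju.
have sub : {subset [pred i | le i j] <= [pred i | le i u]}.
  by move=> i; rewrite !inE => /tr; apply.
have eqc : [pred i | le i j] =i [pred i | le i u].
  by apply/subset_cardP; [apply/eqP; rewrite eqn_leq umin // subset_leq_card //;
    apply/fintype.subsetP|apply/fintype.subsetP].
by have := eqc u; rewrite !inE r => ->.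
Qed.

Lemma le_strict_trans i j k : le i j -> strict le j k -> strict le i k.
Proof.
have [r a tr to] := lin; move=> ij /andP[jk njk]; rewrite /strict (tr _ _ _ ij jk) /=.
by apply: contra njk => /eqP ik; apply/eqP/a; rewrite jk -ik.
Qed.

Lemma strict_nle i j : ~~ le j i -> strict le i j.
Proof.
have [r a tr to] := lin; move=> h; have := to i j; rewrite (negPf h) orbF /strict => -> /=.
by apply: contra h => /eqP ->.
Qed.

Definition downset (D : pred 'I_t) : Prop := forall i j, le i j -> D j -> D i.

Lemma downset_le k : downset (fun j => le j k).
Proof. by have [r a tr to] := lin; move=> i j ij jk; exact: tr ij jk. Qed.

Lemma downset_sep (D : pred 'I_t) i j u : downset D -> D i -> le j i -> ~~ D u -> strict le j u.
Proof.
move=> dD Di ji nDu; apply: strict_nle; apply: contra nDu => uj.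
exact: dD uj (dD _ _ ji Di).
Qed.

End LinearOrder.

(** * Modules filtered by the Psi(j): covers by add(Q), maps to Psi(i), sorting *)

Section Costratifying.
Variables (R : comPzRingType) (A : pzRingType) (phi : algstr R A) (t : nat)
  (Psi Q : 'I_t -> lmodType A) (le : rel 'I_t).
Hypotheses (artA : artin_algebra phi) (pcs : proper_costratifying_system Psi Q le).
Implicit Types M N X Y Z K W : lmodType A.
Implicit Types D U : pred 'I_t.

Let lin : linear_order le := pcs_order pcs.
Let le_refl i : le i i. Proof. by case: lin. Qed.

(* FP D is F({Psi(j) : j in D}).                                                *)
Definition PsiC D X : Prop := exists2 j, D j & X = Psi j.
Definition FP D : lmodType A -> Prop := Filt (PsiC D).

Lemma FP_elim D (T : lmodType A -> Prop) :
  (forall X, zero_module X -> T X) ->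
  (forall X Y j (f : {linear X -> Y}) (g : {linear Y -> Psi j}),
     FP D X -> T X -> D j -> ses f g -> T Y) ->
  forall X, FP D X -> T X.
Proof.
move=> T0 TS X; elim=> {X} [X X0|Y X Z f g fX TX [j Dj eZ] s]; first exact: T0.
by subst Z; exact: TS fX TX Dj s.
Qed.

Lemma FP_sub D D' X : (forall j, D j -> D' j) -> FP D X -> FP D' X.
Proof. by move=> DD'; apply: Filt_bind => Y [j Dj ->]; apply: Filt1; exists j; rewrite ?DD'. Qed.

Lemma FP_Psi D j : D j -> FP D (Psi j).
Proof. by move=> Dj; apply: Filt1; exists j. Qed.

Lemma FP_famclass X : filtered (famclass Psi) X <-> FP predT X.
Proof.
rewrite filteredP; split; apply: Filt_bind => Y.
  by move=> [j ->]; exact: FP_Psi.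
by move=> [j _ ->]; apply: Filt1; exists j.
Qed.

Lemma FP_fg D X : FP D X -> fg X.
Proof. by apply: Filt_fg => Y [j _ ->]; exact: pcs_fgPsi pcs j. Qed.

Lemma FP_flen D X : FP D X -> flen X.
Proof. by move/FP_fg/(artin_flen artA). Qed.

Lemma flenQ i : flen (Q i). Proof. by apply: (artin_flen artA); exact: (pcs_fgQ pcs). Qed.

Lemma FP_empty D X : (forall j, ~~ D j) -> FP D X -> zero_module X.
Proof. by move=> D0 [|Y Z f g _ [j Dj]]; [|rewrite (negPf (D0 j)) in Dj]. Qed.

Lemma Psi_nz i : ~ zero_module (Psi i).
Proof.
move=> z; have [/eqP n1 _] := pcs_division pcs i; apply: n1.
by apply/lhomP => x; rewrite (z x); exact: z.
Qed.

Lemma approx_ex i : exists Z (alpha : {linear Z -> Q i}) (beta : {linear Q i -> Psi i}),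
  ses alpha beta /\ FP (fun j => le j i) Z.
Proof.
have [Z [alpha [beta [s fZ]]]] := pcs_seq pcs i; exists Z, alpha, beta; split=> //.
move/filteredP: fZ; apply: Filt_bind => Y [[j jle] ->]; exact: FP_Psi.
Qed.

Definition kerQ i : lmodType A := projT1 (cid (approx_ex i)).
Definition alpha i : {linear kerQ i -> Q i} := projT1 (cid (projT2 (cid (approx_ex i)))).
Definition beta i : {linear Q i -> Psi i} :=
  projT1 (cid (projT2 (cid (projT2 (cid (approx_ex i)))))).
Lemma beta_ses i : ses (alpha i) (beta i).
Proof. exact: (projT2 (cid (projT2 (cid (projT2 (cid (approx_ex i))))))).1. Qed.
Lemma FP_kerQ i : FP (fun j => le j i) (kerQ i).
Proof. exact: (projT2 (cid (projT2 (cid (projT2 (cid (approx_ex i))))))).2. Qed.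

Lemma FP_Q i : FP (fun j => le j i) (Q i).
Proof. apply: Filt_ses (beta_ses i) (FP_kerQ i) _; exact: FP_Psi (le_refl i). Qed.

Lemma beta_nz i : ~ (forall x, beta i x = 0).
Proof.
by move=> b0; apply: (Psi_nz (i := i)) => y; have [x <-] := ses_surj (beta_ses i) y.
Qed.

Lemma hom0_Psi D X k (f : {linear X -> Psi k}) :
  FP D X -> (forall j, D j -> strict le j k) -> forall x, f x = 0.
Proof.
move=> fX Dk; move: X fX f; apply: FP_elim => [X X0|Y X j a b _ IH Dj s] f x.
  by rewrite (X0 x) linear0.
have [f' f'P] := ses_desc s (IH (f \o a)).
by rewrite -f'P (pcs_hom0 pcs (Dk _ Dj)).
Qed.

Lemma hom0 D U X W (f : {linear X -> W}) : FP D X -> FP U W ->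
  (forall j u, D j -> U u -> strict le j u) -> forall x, f x = 0.
Proof.
move=> fX fW DU; move: W fW f; apply: FP_elim => [W W0|Y W u a b _ IH Uu s] f x; first exact: W0.
have bf0 : forall x, (b \o f) x = 0 by apply: hom0_Psi fX _ => j Dj; exact: DU.
by have [f' f'P] := ses_lift s bf0; rewrite -f'P IH linear0.
Qed.

Lemma Qhom0 j k (f : {linear Q j -> Psi k}) : strict le j k -> forall x, f x = 0.
Proof. by move=> jk; apply: hom0_Psi (FP_Q j) _ => i ij; exact: le_strict_trans ij jk. Qed.

Lemma Q_relproj i D X : FP D X -> relproj (Q i) X.
Proof. by apply: relproj_Filt => Z [j _ ->]; apply/Ext1_relproj/(pcs_ext0 pcs). Qed.

Definition addQ D N : Prop := exists (I : finType) (l : I -> 'I_t),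
  (forall i, D (l i)) /\ sumfac (fun i => Q (l i)) N.

Lemma addQ_relproj D U N X : addQ D N -> FP U X -> relproj N X.
Proof.
by move=> [I [l [_ sN]]] fX; apply: relproj_sumfac sN => i; exact: Q_relproj fX.
Qed.

Lemma addQ1 D i : D i -> addQ D (Q i).
Proof.
move=> Di; exists unit, (fun=> i); split=> //.
by exists (fun=> idfun), (fun=> idfun) => x; rewrite big_const card_unit iterS /= addr0.
Qed.

Lemma addQ_zero D N : zero_module N -> addQ D N.
Proof.
move=> N0; have h (i : void) : 'I_t by case: i.
exists void, h; split=> [[]|]; exists (fun _ => \0), (fun _ => \0) => x.
by rewrite (N0 x) big1.
Qed.

Lemma addQ_prod D M N : addQ D M -> addQ D N -> addQ D (M * N)%type.
Proof.
move=> [I [l [lD [a [b ab]]]]] [J [m [mD [c [d cd]]]]].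
pose lm (k : I + J) := match k with inl i => l i | inr j => m j end.
exists (I + J)%type, lm; split; first by case.
pose u (k : I + J) : {linear (M * N)%type -> Q (lm k)} :=
  match k with inl i => a i \o fst | inr j => c j \o snd end.
pose v (k : I + J) : {linear Q (lm k) -> (M * N)%type} :=
  match k with inl i => inlm M N \o b i | inr j => inrm M N \o d j end.
exists u, v => -[x y]; rewrite big_sumType /= -!linear_sum -ab -cd inlmE inrmE.
by congr (_, _); rewrite /= ?addr0 ?add0r.
Qed.

(** Horseshoe lemma: [beta j] lifts to X because Ext^1(Q(j), X') = 0, and the kernel of the
    resulting map from N x Q(j) onto X is an extension of [kerQ j] by K. *)
Lemma FP_cover D X : downset le D -> FP D X ->
  exists N K (f : {linear K -> N}) (g : {linear N -> X}),
  [/\ ses f g, FP D K, FP D N & addQ D N].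
Proof.
move=> dD; move: X; apply: FP_elim => [X X0|X' X j a b fX' [N [K [f [g [sfg fK fN aN]]]]] Dj sab].
  exists X, X, idfun, idfun; split; [|exact: Filt0|exact: Filt0|exact: addQ_zero].
  by apply: mkses => [//|x|y|z]; rewrite ?(X0 x) //; [exists y|exists z].
have [c cP] := Q_relproj (i := j) fX' sab (beta j).
pose g' := pair_map (a \o g) c.
have g'E u : g' u = a (g u.1) + c u.2 by exact: pair_mapE.
have g's x : exists u, g' u = x.
  have [q qE] := ses_surj (beta_ses j) (b x).
  have [x' x'E] : exists x', a x' = x - c q.
    by apply: (ses_exact sab); rewrite linearB cP qE subrr.
  have [n nE] := ses_surj sfg x'.
  by exists (n, q); rewrite g'E /= nE x'E subrK.
have jD i : le i j -> D i by move=> ij; exact: dD ij Dj.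
exists (N * Q j)%type, (subm (kerS g')), (inclS (kerS g')), g'; split.
- exact: ses_ker.
- have b0 x : beta j (snd (inclS (kerS g') x)) = 0.
    have /kerSP := inclSP x; rewrite g'E => /(congr1 b).
    by rewrite linearD (ses_comp0 sab) add0r cP linear0.
  have [p pP] := ses_lift (h := snd \o inclS (kerS g')) (beta_ses j) b0.
  have iK x : (inlm N (Q j) \o f) x \in kerS g'.
    by apply/kerSP; rewrite g'E /= inlmE (ses_comp0 sfg) !linear0 addr0.
  have [i iP] := corestr iK.
  apply: (Filt_ses (f := i) (g := p) _ fK); last exact: FP_sub jD (FP_kerQ j).
  apply: mkses => [x x0|x|y y0|z].
  + by apply: (ses_inj sfg); have := iP x; rewrite x0 !linear0 /= inlmE => -[<-].
  + by apply: (ses_inj (beta_ses j)); rewrite pP /= iP /= inlmE linear0.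
  + have y2 : (inclS (kerS g') y).2 = 0 by have := pP y; rewrite y0 linear0.
    have /kerSP := inclSP y; rewrite g'E y2 linear0 addr0 -(linear0 a).
    move=> /(ses_inj sab)/(ses_exact sfg)[x xE]; exists x.
    by apply: (@inclS_inj _ _ (kerS g')); rewrite iP /= inlmE xE [RHS]surjective_pairing y2.
  + have [x xE] := ses_exact sab (etrans (cP (alpha j z)) (ses_comp0 (beta_ses j) z)).
    have [n nE] := ses_surj sfg x.
    have [y yE] : exists y, inclS (kerS g') y = (- n, alpha j z).
      by apply/inclS_ex/kerSP; rewrite g'E /= !linearN nE xE addNr.
    by exists y; apply: (ses_inj (beta_ses j)); rewrite pP /= yE.
- apply: Filt_prod fN _; exact: FP_sub jD (FP_Q j).
- by apply: addQ_prod aN _; exact: addQ1.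
Qed.

(** The map lifts to the add(Q)-cover of X, whose kernel is again filtered by the Psi(j) with j in
    D. *)
Lemma FP_factor D X N (f : {linear N -> X}) : downset le D -> FP D X ->
  (forall K, FP D K -> relproj N K) ->
  exists (I : finType) (l : I -> 'I_t) (s : forall i, {linear N -> Q (l i)})
    (r : forall i, {linear Q (l i) -> X}),
  (forall i, D (l i)) /\ forall x, f x = \sum_i r i (s i x).
Proof.
move=> dD fX relN; have [Q0 [K [a [g [sag fK _ [I [l [lD [u [v uv]]]]]]]]]] := FP_cover dD fX.
have [h hP] := relN _ fK _ _ _ _ sag f.
exists I, l, (fun i => u i \o h), (fun i => g \o v i); split=> // x.
by rewrite -hP /= -linear_sum -uv.
Qed.

Lemma Psi_bij i (d : {linear Psi i -> Psi i}) : ~ (forall x, d x = 0) -> bijective d.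
Proof.
move=> nd; have [_ div] := pcs_division pcs i.
have [|e [de ed]] := div (d : endo (Psi i)); first by apply/eqP => d0; apply: nd; rewrite d0.
by exists e => x; [move/lhomP: ed|move/lhomP: de] => /(_ x).
Qed.

(** Induction on the filtration of X, with submodule Y and top factor Psi(j). If g vanishes on Y it
    induces a nonzero map Psi(j) -> Psi(i); then j = i, this map is invertible, and the kernel of g
    is Y. Otherwise Y already maps onto Psi(i) with a filtered kernel K, and the kernel of g is an
    extension of Psi(j) by K. *)
Lemma hom_Psi_surj D X i (g : {linear X -> Psi i}) :
  FP D X -> (forall j, D j -> le j i) -> ~ (forall x, g x = 0) ->
  exists K (k : {linear K -> X}), ses k g /\ FP D K.
Proof.
move=> fX Di; move: X fX g; apply: FP_elim => [X X0|Y X j f p fY IH Dj s] g ng.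
  by case: ng => x; rewrite (X0 x) linear0.
case: (pselect (forall x, (g \o f) x = 0)) => [gf0|/IH[K [k [sk fK]]]].
  have [g' g'P] := ses_desc s gf0.
  case: (eqVneq j i) g' g'P => [ji|ji] g' g'P; last first.
    case: ng => x; rewrite -g'P; apply: (pcs_hom0 pcs).
    by rewrite /strict ji Di.
  subst j; have bg' : bijective g'.
    by apply: Psi_bij => g'0; apply: ng => x; rewrite -g'P.
  exists Y, f; split=> //; have s' := ses_iso_r bg' s.
  split; [exact: ses_inj s|move=> y; split|move=> z].
  - by rewrite -g'P => /(ses_exact s')[x <-]; exists x.
  - by move=> [x ->]; rewrite -g'P; exact: ses_comp0 s' x.
  - by have [y <-] := ses_surj s' z; exists y; rewrite -g'P.
have gs y : exists x, g x = y.
  by have [z <-] := ses_surj sk y; exists (f z).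
exists (subm (kerS g)), (inclS (kerS g)); split; first exact: ses_ker.
have fk x : (f \o k) x \in kerS g by apply/kerSP; exact: ses_comp0 sk x.
have [i' i'P] := corestr fk.
apply: (FiltS (f := i') (g := p \o inclS (kerS g)) fK); first by exists j.
apply: mkses => [x x0|x|x px|z].
- by apply: (ses_inj sk); apply: (ses_inj s); have := i'P x; rewrite x0 !linear0.
- by rewrite /= i'P; exact: ses_comp0 s _.
- have [y yE] := ses_exact s px.
  have [|x' x'E] := ses_exact sk (y := y) _; first by rewrite /= yE; apply/kerSP/inclSP.
  by exists x'; apply: (@inclS_inj _ _ (kerS g)); rewrite i'P /= x'E.
- have [x xE] := ses_surj s z; have [y yE] := ses_surj sk (g x).
  have [w wE] : exists w, inclS (kerS g) w = x - f y.
    by apply/inclS_ex/kerSP; rewrite linearB -yE subrr.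
  by exists w; rewrite /= wE linearB (ses_comp0 s) subr0.
Qed.

Lemma nil_comp0 M N (g : {linear M -> N}) (f : {linear M -> M}) :
  (forall x, g (f x) = g x) -> (exists n, forall x, iter n f x = 0) -> forall x, g x = 0.
Proof.
move=> gf [n fn] x; rewrite -(linear0 g) -(fn x) {fn}.
by elim: n => //= n ->; rewrite gf.
Qed.

(** If beta f is nonzero, it is onto with kernel in F(Psi), so beta = beta f h for some h. By
    Fitting, f h is either bijective, which makes f bijective, or nilpotent, which gives beta =
    0. *)
Lemma beta_nonbij i (f : {linear Q i -> Q i}) : ~ bijective f -> forall x, beta i (f x) = 0.
Proof.
move=> nf; apply: contrapT => nb.
have [K [k [s fK]]] := hom_Psi_surj (g := beta i \o f) (FP_Q i) (fun j => id) nb.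
have [h hP] := Q_relproj (i := i) fK s (beta i).
have [bfh|nil] := fitting (f \o h) (flenQ i) (pcs_indec pcs i).
  by apply: nf; have [] := bij_comp_flen (flenQ i) bfh.
apply: (@beta_nz i); exact: (nil_comp0 (f := f \o h) hP nil).
Qed.

(** Write g = beta h and cover [kerQ k] by modules Q(j), j <= k. For j < k there are no nonzero maps
    to Psi(k). For j = k the map Q(k) -> Q(k) is killed by beta, hence not bijective, and remains so
    after composition with h; so beta kills the composite. Thus g kills [kerQ k]. *)
Lemma hom_Q_Psi k (g : {linear Q k -> Psi k}) :
  exists d : {linear Psi k -> Psi k}, forall x, d (beta k x) = g x.
Proof.
have [h hP] := Q_relproj (i := k) (FP_kerQ k) (beta_ses k) g.
have gr0 j (r : {linear Q j -> Q k}) : le j k -> (forall x, beta k (r x) = 0) ->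
    forall x, g (r x) = 0.
  move=> jk; case: (eqVneq j k) r => [->|nek] r br0; last first.
    by apply: (@Qhom0 _ _ (g \o r)); rewrite /strict jk nek.
  have nr : ~ bijective r.
    by move=> [w _ wK]; apply: (@beta_nz k) => y; rewrite -(wK y).
  move=> x; rewrite -hP; apply: (@beta_nonbij _ (h \o r)) => bhr; apply: nr.
  by have [] := bij_comp_flen (flenQ k) bhr.
apply: (ses_desc (beta_ses k)) => z.
have [N [K [a [b [sab _ _ [I [l [lk [u [v uv]]]]]]]]]] :=
  FP_cover (downset_le lin (k := k)) (FP_kerQ k).
have [n <-] := ses_surj sab z; rewrite [n]uv !linear_sum big1 // => i _.
apply: (gr0 _ (alpha k \o (b \o v i)) (lk i)) => x; exact: ses_comp0 (beta_ses k) _.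
Qed.

(** If the top index j is outside D, Psi(j) joins the quotient. If j is in D, the quotient of X by
    [X1] is an extension of Psi(j) by [X2], whose indices lie outside D. The lift of [beta j] to it
    vanishes on [kerQ j], for lack of maps to larger indices, so the extension splits and Psi(j) can
    join the submodule. *)
Lemma FP_split D U X : downset le D -> FP U X ->
  exists X1 X2 (f : {linear X1 -> X}) (g : {linear X -> X2}),
  [/\ ses f g, FP (fun j => U j && D j) X1 & FP (fun j => U j && ~~ D j) X2].
Proof.
move=> dD; move: X; apply: FP_elim => [X X0|Y X j f p _ [X1 [X2 [a [b [sab f1 f2]]]]] Uj s].
  exists X, X, idfun, idfun; split; [|exact: Filt0|exact: Filt0].
  by apply: mkses => [//|x|y|z]; rewrite ?(X0 x) //; [exists y|exists z].
have [E [q [u [v [s1 s2 vq qf]]]]] := ses_quot_sub sab s.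
case: (boolP (D j)) => [Dj|nDj]; last first.
  by exists X1, E, (f \o a), q; split=> //; apply: FiltS f2 _ s2; exists j; rewrite ?Uj.
have [c cP] := Q_relproj (i := j) f2 s2 (beta j).
have [c0 c0P] : exists c0 : {linear kerQ j -> X2}, forall z, u (c0 z) = (c \o alpha j) z.
  by apply: (ses_lift s2) => z; rewrite /= cP (ses_comp0 (beta_ses j)).
have c00 : forall z, c0 z = 0.
  by apply: hom0 (FP_kerQ j) f2 _ => i k ij /andP[_ nDk]; exact: (downset_sep lin dD Dj ij nDk).
have [sc scP] : exists sc : {linear Psi j -> E}, forall x, sc (beta j x) = c x.
  by apply: (ses_desc (beta_ses j)) => z; rewrite -[c _]c0P c00 linear0.
have vsc y : v (sc y) = y.
  by have [x <-] := ses_surj (beta_ses j) y; rewrite scP cP.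
have [r rP] : exists r : {linear E -> X2},
    forall e, u (r e) = (idfun \+ (\- (sc \o v)) : {linear E -> E}) e.
  by apply: (ses_lift s2) => e; rewrite /= linearB vsc subrr.
have rE e : u (r e) = e - sc (v e) by exact: rP.
have ru x : r (u x) = x.
  by apply: (ses_inj s2); rewrite rE (ses_comp0 s2) linear0 subr0.
(* As r retracts E onto [X2], the kernel of this composite is an extension of Psi(j) by [X1]. *)
pose g : {linear X -> X2} := r \o q.
have gs x : exists y, g y = x.
  by have [y yE] := ses_surj s1 (u x); exists y; rewrite /= yE ru.
exists (subm (kerS g)), X2, (inclS (kerS g)), g; split=> //; first exact: ses_ker.
have fa x : (f \o a) x \in kerS g by apply/kerSP; rewrite /= (ses_comp0 s1) linear0.
have [i iP] := corestr fa.
apply: (FiltS (f := i) (g := p \o inclS (kerS g)) f1); first by exists j; rewrite ?Uj.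
apply: mkses => [x x0|x|x px|z].
- by apply: (ses_inj s1); have := iP x; rewrite x0 !linear0 => ->.
- by rewrite /= iP /= (ses_comp0 s).
- have /kerSP /= rq := inclSP x.
  have [|x' x'E] := ses_exact s1 (y := inclS (kerS g) x) _.
    by have := rE (q (inclS (kerS g) x)); rewrite rq vq (px : p _ = 0) !linear0 addr0 => <-.
  by exists x'; apply: (@inclS_inj _ _ (kerS g)); rewrite iP.
- have [y yE] := ses_surj s1 (sc z).
  have [w wE] : exists w, inclS (kerS g) w = y.
    apply/inclS_ex/kerSP; rewrite /= yE; apply: (ses_inj s2).
    by rewrite rE vsc subrr linear0.
  by exists w; rewrite /= wE -vq yE.
Qed.

End Costratifying.

(** * Kernels and direct summands in F(Psi); description of add(Q) *)

Section CostratifyingClosure.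
Variables (R : comPzRingType) (A : pzRingType) (phi : algstr R A) (t : nat)
  (Psi Q : 'I_t -> lmodType A) (le : rel 'I_t).
Hypotheses (artA : artin_algebra phi) (pcs : proper_costratifying_system Psi Q le).
Implicit Types M N X Y Z K W : lmodType A.
Implicit Types D U : pred 'I_t.

Let lin : linear_order le := pcs_order pcs.
Local Notation FP := (FP Psi).
Local Notation addQ := (addQ Q).

(** With a single index, a nonzero map to Psi(u) is onto with a filtered kernel; replacing Y by that
    kernel removes the top factor of Z. *)
Lemma FP_ker1 D u Y Z K (k : {linear K -> Y}) (g : {linear Y -> Z}) :
  (forall j, D j -> j = u) -> ses k g -> FP D Y -> FP D Z -> FP D K.
Proof.
move=> Du s fY fZ; move: Z fZ Y K k g s fY.
apply: FP_elim => [Z Z0|Z' Z j a p _ IH Dj sap] Y K k g s fY.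
  exact: Filt_iso (iso_sym (ex_intro _ k (ses_bij s Z0))) fY.
have npg : ~ (forall x, (p \o g) x = 0).
  move=> pg0; apply: (Psi_nz pcs (i := j)) => y.
  by have [z <-] := ses_surj sap y; have [x <-] := ses_surj s z; exact: pg0.
have le1 i : D i -> le i j.
  by move=> Di; rewrite (Du _ Di) (Du _ Dj); case: lin.
have [K0 [k0 [s0 fK0]]] := hom_Psi_surj pcs fY le1 npg.
have [g' g'P] : exists g' : {linear K0 -> Z'}, forall x, a (g' x) = (g \o k0) x.
  by apply: (ses_lift sap) => x; exact: ses_comp0 s0 x.
have [i iP] : exists i : {linear K -> K0}, forall x, k0 (i x) = k x.
  by apply: (ses_lift s0) => x; rewrite /= (ses_comp0 s) linear0.
apply: (IH _ _ i g' _ fK0); apply: mkses => [x x0|x|x gx|z].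
- by apply: (ses_inj s); rewrite -iP x0 !linear0.
- by apply: (ses_inj sap); rewrite g'P /= iP (ses_comp0 s) linear0.
- have [|y yE] := ses_exact s (y := k0 x) _; first by have := g'P x; rewrite gx linear0.
  by exists y; apply: (ses_inj s0); rewrite iP.
- have [y yE] := ses_surj s (a z).
  have [|x xE] := ses_exact s0 (y := y) _; first by rewrite /= yE (ses_comp0 sap).
  by exists x; apply: (ses_inj sap); rewrite g'P /= xE.
Qed.

Lemma FP_min U u : (forall j, U j -> le u j) -> forall j, U j && le j u -> j = u.
Proof.
move=> umin j /andP[Uj ju]; have [r a tr to] := lin.
by apply: a; rewrite ju umin.
Qed.

Lemma card_above U u : U u -> (#|[pred j | U j && ~~ le j u]| < #|U|)%N.
Proof.
move=> Uu; apply: proper_card; apply/properP; split.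
  by apply/fintype.subsetP => j; rewrite !inE => /andP[].
by exists u => //; rewrite inE; have [r _ _ _] := lin; rewrite r andbF.
Qed.

Lemma hom0_above U D M N (f : {linear M -> N}) : downset le D ->
  FP (fun j => U j && D j) M -> FP (fun j => U j && ~~ D j) N -> forall x, f x = 0.
Proof.
move=> dD fM fN; apply: (hom0 pcs f fM fN) => j u /andP[_ Dj] /andP[_ nDu].
by apply: (downset_sep lin dD Dj _ nDu); case: lin.
Qed.

(** The parts with the smallest index u are split off from Y and Z. The lifting hypothesis makes the
    map between them onto, so the snake lemma applies; the remaining parts have fewer indices. *)
Lemma FP_ker U Y Z K (k : {linear K -> Y}) (g : {linear Y -> Z}) :
  ses k g ->
  (forall i (h : {linear Q i -> Z}), exists l : {linear Q i -> Y}, forall x, g (l x) = h x) ->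
  FP U Y -> FP U Z -> FP U K.
Proof.
move: {2}(#|U|) (leqnn #|U|) => n; elim: n U Y Z K k g => [|n IH] U Y Z K k g cU s liftQ fY fZ.
  have U0 j : ~~ U j.
    apply/negP => Uj; have jU : j \in U by exact: Uj.
    by move: cU; rewrite leqn0 => /eqP/card0_eq/(_ j); rewrite jU.
  by apply: Filt0 => x; apply: (ses_inj s); rewrite linear0; exact: FP_empty fY _.
case: (pselect (exists j, U j)) => [[j0 Uj0]|nU]; last first.
  apply: Filt0 => x; apply: (ses_inj s); rewrite linear0; apply: (FP_empty _ fY) => j.
  by apply/negP => Uj; apply: nU; exists j.
have [u Uu umin] := linear_order_min lin Uj0.
pose D := [pred j | le j u]; have dD : downset le D by exact: downset_le.
have [Y1 [Y2 [a [b [sab fY1 fY2]]]]] := FP_split pcs dD fY.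
have [Z1 [Z2 [c [d [scd fZ1 fZ2]]]]] := FP_split pcs dD fZ.
have [g1 g1P] : exists g1 : {linear Y1 -> Z1}, forall y, c (g1 y) = (g \o a) y.
  by apply: (ses_lift scd); exact: (hom0_above (d \o (g \o a)) dD fY1 fZ2).
have [g2 g2P] : exists g2 : {linear Y2 -> Z2}, forall y, g2 (b y) = (d \o g) y.
  by apply: (ses_desc sab) => y; rewrite /= -[g _]g1P (ses_comp0 scd).
have QY2 i (l : {linear Q i -> Y}) : D i -> forall x, b (l x) = 0.
  move=> Di; apply: (hom0 pcs (b \o l) (FP_Q pcs i) fY2) => j v ji /andP[_ nDv].
  exact: (downset_sep lin dD Di ji nDv).
(* [Z1] is covered by modules Q(i) with i in D. A lift Q(i) -> Y of the map to Z lands in [Y1], as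
   there are no nonzero maps Q(i) -> [Y2]. *)
have g1s z : exists y, g1 y = z.
  have fZ1' : FP D Z1 by apply: FP_sub fZ1 => j /andP[].
  have [N [L [e [q [seq _ _ [I [l [lD [v [w vw]]]]]]]]]] := FP_cover pcs dD fZ1'.
  have [m <-] := ses_surj seq z; rewrite [m]vw linear_sum; apply/imSP/rpred_sum => i _.
  apply/imSP; have [h hP] := liftQ _ (c \o (q \o w i)).
  have [y yE] := ses_exact sab (QY2 _ h (lD i) (v i m)).
  by exists y; apply: (ses_inj scd); rewrite g1P /= yE hP.
have g2s z : exists y, g2 y = z.
  have [x <-] := ses_surj scd z; have [y <-] := ses_surj s x.
  by exists (b y); rewrite g2P.
have [f [h sfh]] := snake sab scd s g1P g2P g1s.
apply: (Filt_ses sfh).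
  have f1 : FP (fun j => U j && D j) (subm (kerS g1)).
    exact: FP_ker1 (FP_min umin) (ses_ker g1s) fY1 fZ1.
  by apply: FP_sub f1 => j /andP[].
have f2 : FP (fun j => U j && ~~ D j) (subm (kerS g2)).
  apply: IH (ses_ker g2s) _ fY2 fZ2; first by rewrite -ltnS (leq_trans (card_above Uu)).
  move=> i l; have [l1 l1P] := Q_relproj pcs (i := i) fZ1 scd l.
  have [l2 l2P] := liftQ _ l1; exists (b \o l2) => x.
  by rewrite /= g2P /= l2P l1P.
by apply: FP_sub f2 => j /andP[].
Qed.

(** Induction on length. If N maps to zero in the top factor Psi(j) of M, it is a summand of the
    submodule X. Otherwise M -> N -> M -> Psi(j) is onto with a filtered kernel K, and the kernel of
    N -> Psi(j) is a summand of K. *)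
Lemma FP_retract1 D u M N : (forall j, D j -> j = u) -> FP D M -> retract N M -> FP D N.
Proof.
move=> Du fM; have flM := FP_flen artA pcs fM; move: M flM fM N.
apply: flen_ind => M flM IH fM N [a [r ra]].
case: fM (fM) => [M0 _|X Z f p fX [j Dj eZ] s fM].
  by apply: Filt0 => x; rewrite -(ra x) (M0 (a x)) linear0.
subst Z; case: (pselect (forall x, (p \o a) x = 0)) => [pa0|npa].
  have [_ _] := IH _ _ _ _ s; have [a' a'P] := ses_lift s pa0.
  apply: ((IH _ _ _ _ s).1 (Psi_nz pcs (i := j)) fX).
  by exists a', (r \o f) => x; rewrite /= a'P ra.
have le1 i : D i -> le i j by move=> Di; rewrite (Du _ Di) (Du _ Dj); case: lin.
have npar : ~ (forall x, (p \o (a \o r)) x = 0).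
  by move=> par0; apply: npa => x; have := par0 (a x); rewrite /= ra.
have [K [k [sk fK]]] := hom_Psi_surj pcs fM le1 npar.
have pas y : exists x, (p \o a) x = y.
  by have [m <-] := ses_surj sk y; exists (r m).
apply: (FiltS (f := inclS (kerS (p \o a))) _ _ (ses_ker pas)); last by exists j.
apply: ((IH _ _ _ _ sk).1 (Psi_nz pcs (i := j)) fK).
have [b bP] : exists b : {linear subm (kerS (p \o a)) -> K},
    forall x, k (b x) = (a \o inclS (kerS (p \o a))) x.
  by apply: (ses_lift sk) => x /=; rewrite ra; have /kerSP := inclSP x.
have rk x : (r \o k) x \in kerS (p \o a) by apply/kerSP; exact: ses_comp0 sk x.
have [q qP] := corestr rk; exists b, q => x.
by apply: (@inclS_inj _ _ (kerS (p \o a))); rewrite qP /= bP /= ra.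
Qed.

Lemma FP_retract U M N : FP U M -> retract N M -> FP U N.
Proof.
move: {2}(#|U|) (leqnn #|U|) => n; elim: n U M N => [|n IH] U M N cU fM [a [r ra]].
  have U0 j : ~~ U j.
    apply/negP => Uj; have jU : j \in U by exact: Uj.
    by move: cU; rewrite leqn0 => /eqP/card0_eq/(_ j); rewrite jU.
  by apply: Filt0 => x; rewrite -(ra x) (FP_empty U0 fM (a x)) linear0.
case: (pselect (exists j, U j)) => [[j0 Uj0]|nU]; last first.
  apply: Filt0 => x; rewrite -(ra x) (FP_empty _ fM (a x)) ?linear0 // => j.
  by apply/negP => Uj; apply: nU; exists j.
have [u Uu umin] := linear_order_min lin Uj0.
pose D := [pred j | le j u]; have dD : downset le D by exact: downset_le.
have [M1 [M2 [f [g [s f1 f2]]]]] := FP_split pcs dD fM.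
(* There are no nonzero maps from [M1] to [M2], so the idempotent [a \o r] preserves [M1], and N is
   an extension of a summand of [M2] by a summand of [M1]. *)
have gar0 : forall x, (g \o (a \o (r \o f))) x = 0.
  by exact: (hom0_above (g \o (a \o (r \o f))) dD f1 f2).
pose h : {linear N -> M2} := g \o a; have [h' [h'P sh]] := ses_ker_im h.
apply: (Filt_ses sh).
  have rN1 : retract (subm (kerS h)) M1.
    have [b bP] : exists b : {linear subm (kerS h) -> M1},
        forall x, f (b x) = (a \o inclS (kerS h)) x.
      by apply: (ses_lift s) => x; have /kerSP := inclSP x.
    have rf x : (r \o f) x \in kerS h by apply/kerSP; exact: gar0.
    have [q qP] := corestr rf; exists b, q => x.
    by apply: (@inclS_inj _ _ (kerS h)); rewrite qP /= bP /= ra.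
  by apply: FP_sub (FP_retract1 (FP_min umin) f1 rN1) => j /andP[].
have rN2 : retract (subm (imS h)) M2.
  have [q qP] : exists q : {linear M2 -> subm (imS h)}, forall m, q (g m) = (h' \o r) m.
    apply: (ses_desc s) => x; apply: (@inclS_inj _ _ (imS h)).
    by rewrite h'P linear0; exact: gar0.
  exists (inclS (imS h)), q => x; have /imSP[y yE] := inclSP x.
  by rewrite -yE qP; apply: (@inclS_inj _ _ (imS h)); rewrite h'P ra.
have f2' : FP (fun j => U j && ~~ D j) (subm (imS h)).
  by apply: IH f2 rN2; rewrite -ltnS (leq_trans (card_above Uu)).
by apply: FP_sub f2' => j /andP[].
Qed.

Lemma addQ_flen D N : addQ D N -> flen N.
Proof.
move=> [I [l [_ [a [b ab]]]]].
apply: (flen_joint (g := fun k : 'I_#|I| => a (enum_val k))) => [k|x ax].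
  exact: flenQ artA pcs _.
rewrite [x]ab big1 // => i _; have := ax (enum_rank i); rewrite enum_rankK => ->.
exact: linear0.
Qed.

Lemma addQ_retract D M N : retract N M -> addQ D M -> addQ D N.
Proof. by move=> rN [I [l [lD sM]]]; exists I, l; split=> //; exact: sumfac_retract sM. Qed.

Lemma addQ_SumOf D N : addQ D N -> SumOf (fun M => exists2 i, D i & iso M (Q i)) N.
Proof.
move=> aN; apply: flen_SumOf (addQ_flen aN) _ => M rM iM.
have [I [l [lD sM]]] := addQ_retract rM aN.
have [i iMQ] := krull_schmidt (retract_flen rM (addQ_flen aN)) iM (fun i => pcs_indec pcs (l i)) sM.
by exists (l i).
Qed.

Lemma addQ_FP D N : downset le D -> addQ D N -> FP D N.
Proof.
move=> dD /addQ_SumOf; apply: SumOf_Filt => X [i Di iX].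
apply: Filt_iso (iso_sym iX) _; apply: FP_sub (FP_Q pcs i) => j ji; exact: dD ji Di.
Qed.

Lemma addQ_sumfac N : addQ predT N <-> exists n, sumfac (fun _ : 'I_n => dsum Q) N.
Proof.
split=> [[I [l [_ [a [b ab]]]]]|[n sN]]; last first.
  exists ('I_n * 'I_t)%type, snd; split=> //.
  exact: (sumfac_comp sN (fun _ => sumfac_dsum Q)).
exists #|I|, (fun k => dinj Q (l (enum_val k)) \o a (enum_val k)),
  (fun k => b (enum_val k) \o dproj Q (l (enum_val k))) => x /=.
rewrite {1}[x]ab (reindex _ (onW_bij _ (@enum_val_bij I))).
by apply: eq_bigr => k _; rewrite dproj_inj.
Qed.

(** A module of F(Psi) orthogonal to F(Psi) splits off its add(Q)-cover, whose kernel lies in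
    F(Psi); Krull-Schmidt then turns it into a sum of Q(i)'s. *)
Lemma addclassP M : addclass (dsum Q) M <->
  filtered (famclass Psi) M /\ perp1 (filtered (famclass Psi)) M.
Proof.
rewrite FP_famclass; have dT : downset le predT by [].
split=> [[n [N [NQ iM]]]|[fM [_ ext0]]].
  have aM : addQ predT M.
    exists ('I_n * 'I_t)%type, snd; split=> //; apply: sumfac_comp (sumfac_iso iM) _ => i.
    by apply: sumfac_retract (sumfac_dsum Q); exact/retract_summand.
  split; first exact: addQ_FP.
  split; first exact: flen_fg (addQ_flen aM).
  by move=> X /FP_famclass fX; apply: relproj_Ext1; exact: (addQ_relproj pcs aM fX).
have [N [K [f [g [s fK _ aN]]]]] := FP_cover pcs dT fM.
have relM := Ext1_relproj (ext0 _ (proj2 (FP_famclass _ _) fK)).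
have [k kP] := relM _ _ _ _ s (idfun : {linear M -> M}).
have aM : addQ predT M by apply: addQ_retract aN; exists k, g.
have [n [L [LQ iM]]] := SumOf_dsum (addQ_SumOf aM).
exists n, L; split=> // i; have [j _ iL] := LQ i; apply/retract_summand.
apply: retract_trans (iso_retract iL) _; exists (dinj Q j), (dproj Q j).
exact: dproj_inj.
Qed.

End CostratifyingClosure.

(** * The functors Hom(Q, -) and Q (x) - *)

Section Idempotents.
Variables (A : pzRingType).
Implicit Types M : lmodType A.

(** In terms of idempotent endomorphisms, indecomposability transports along functors that are fully
    faithful on add(Q). *)
Lemma indecomposable_idem M : indecomposable M <-> ~ zero_module M /\
  forall e : {linear M -> M}, (forall x, e (e x) = e x) ->
    (forall x, e x = 0) \/ (forall x, e x = x).
Proof.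
split=> -[nM ind]; split=> //.
  move=> e ee; have [p [pP ps]] := corestr_im e.
  have rp x : p (inclS (imS e) x) = x.
    apply: (@inclS_inj _ _ (imS e)); rewrite pP; have /imSP[y <-] := inclSP x.
    exact: ee.
  case: (ind _ _ (retract_iso rp)) => [I0|K0]; [left|right] => x.
    by rewrite -pP (I0 (p x)) linear0.
  have [k kE] : exists k, inclS (kerS p) k = x - e x.
    apply/inclS_ex/kerSP; rewrite linearB; apply/eqP; rewrite subr_eq0; apply/eqP.
    by apply: (@inclS_inj _ _ (imS e)); rewrite !pP ee.
  by move/eqP: kE; rewrite (K0 k) linear0 eq_sym subr_eq0 => /eqP.
move=> X Y [f /bijective_linv[g [fK gK]]].
pose e : {linear M -> M} := g \o (inlm X Y \o (fst \o f)).
have eE x : e x = g ((f x).1, 0) by rewrite /e /= inlmE.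
case: (ind e) => [x|e0|e1]; first by rewrite !eE gK.
  left=> x; have := e0 (g (x, 0)); rewrite eE gK => /(congr1 f).
  by rewrite gK linear0 => -[].
right=> y; have := e1 (g (0, y)); rewrite eE gK => /(congr1 f).
by rewrite !gK => -[].
Qed.

End Idempotents.

Lemma lhom_sumE (A : pzRingType) (M N : lmodType A) (I : Type) (r : seq I) (f : I -> lhom M N) x :
  (\sum_(i <- r) f i : lhom M N) x = \sum_(i <- r) f i x.
Proof. exact: (big_morph (fun h : lhom M N => h x)). Qed.

(** * The functor Hom(Q, -) on add(Q) *)

Section HomFunctorTheory.
Variables (A : pzRingType) (Q : lmodType A).
Local Notation Gamma := ((endo Q)^c).
Local Notation F := (Hom_functor Q).
Implicit Types M N X Y Z : lmodType A.

Definition homF_of M (f : {linear Q -> M}) : F M := f.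
Definition of_homF M (h : F M) : {linear Q -> M} := h.

Lemma homF_ext M (h h' : F M) : (forall q, of_homF h q = of_homF h' q) -> h = h'.
Proof. by move=> hh'; apply/lhomP. Qed.

Lemma of_homF_map M N (f : {linear M -> N}) (h : F M) q :
  of_homF (fmap F f h) q = f (of_homF h q).
Proof. by []. Qed.

Lemma of_homF_scale M (g : Gamma) (h : F M) q :
  of_homF (g *: h) q = of_homF h ((g : endo Q) q).
Proof. by []. Qed.

Lemma of_homF_sum M (I : Type) (r : seq I) (h : I -> F M) q :
  of_homF (\sum_(i <- r) h i) q = \sum_(i <- r) of_homF (h i) q.
Proof. exact: lhom_sumE. Qed.

Lemma of_homFD M (h h' : F M) q : of_homF (h + h') q = of_homF h q + of_homF h' q.
Proof. by []. Qed.
Lemma homF_comp0 M N (f : {linear M -> N}) : (forall h : F M, fmap F f h = 0) <->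
  (forall g : {linear Q -> M}, forall q, f (g q) = 0).
Proof.
split=> [f0 g q|f0 h]; last by apply: homF_ext => q; exact: f0.
by rewrite -(of_homF_map f (homF_of g)) f0.
Qed.

(* add(Q), up to isomorphism                                                    *)
Definition addm N : Prop := exists n, sumfac (fun _ : 'I_n => Q) N.

Lemma addm_Q : addm Q.
Proof. by exists 1%N, (fun _ => idfun), (fun _ => idfun) => x; rewrite big_ord1. Qed.

(** Every h is the combination of the [b k] with coefficients [a k \o h] in Gamma, so p is
    determined by the images of the [b k]. *)
Lemma yoneda N M (p : {linear F N -> F M}) : addm N ->
  exists f : {linear N -> M}, forall h, p h = fmap F f h.
Proof.
move=> [n [a [b ab]]].
have [f fE] := lin_sum_fun (fun k => of_homF (p (homF_of (b k))) \o a k : {linear N -> M}).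
exists f => h; have hE : h = \sum_k (a k \o of_homF h : Gamma) *: homF_of (b k).
  by apply: homF_ext => q; rewrite of_homF_sum {1}[of_homF h q]ab.
rewrite {1}hE linear_sum; apply: homF_ext => q; rewrite of_homF_sum of_homF_map fE.
by apply: eq_bigr => k _; rewrite linearZ_LR.
Qed.

Lemma addm_faithful N M (f f' : {linear N -> M}) : addm N ->
  (forall h, fmap F f h = fmap F f' h) -> forall x, f x = f' x.
Proof.
move=> [n [a [b ab]]] ff' x; rewrite [x]ab !linear_sum; apply: eq_bigr => k _.
by have := congr1 (fun h : F M => of_homF h (a k x)) (ff' (homF_of (b k))).
Qed.

Lemma homF_iso_inv M N : addm M -> addm N -> iso (F M) (F N) -> iso M N.
Proof.
move=> aM aN [p /bijective_linv[p' [pK p'K]]].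
have [f fP] := yoneda p aM; have [g gP] := yoneda p' aN.
exists f; exists g => x.
  apply: (addm_faithful (f := g \o f) (f' := idfun) aM) => h.
  transitivity (p' (p h)); first by rewrite fP gP; apply: homF_ext.
  by rewrite pK; apply: homF_ext => q; rewrite of_homF_map.
apply: (addm_faithful (f := f \o g) (f' := idfun) aN) => h.
transitivity (p (p' h)); first by rewrite gP fP; apply: homF_ext.
by rewrite p'K; apply: homF_ext => q; rewrite of_homF_map.
Qed.

Lemma homF_indecomposable N : addm N -> indecomposable N -> indecomposable (F N).
Proof.
move=> aN /indecomposable_idem[nN idN]; apply/indecomposable_idem; split.
  move=> z; apply: nN => x; apply: (addm_faithful (f := idfun) (f' := \0) aN) => h.
  by rewrite (z (fmap F _ h)) [RHS]z.
move=> e ee; have [f fP] := yoneda e aN.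
have [x|f0|f1] := idN f.
- apply: (addm_faithful (f := f \o f) (f' := f) aN) => h.
  by transitivity (e (e h)); [rewrite !fP; apply: homF_ext|rewrite ee fP].
- by left=> h; rewrite fP; apply: homF_ext => q; rewrite of_homF_map f0.
- by right=> h; rewrite fP; apply: homF_ext => q; rewrite of_homF_map f1.
Qed.

Lemma homF_regular : iso (Gamma^o : lmodType Gamma) (F Q).
Proof.
have lf : linear (fun g : Gamma^o => homF_of (g : endo Q) : F Q).
  by move=> a g h; apply: homF_ext => q.
by exists (mklin lf); exists (fun h => of_homF h : endo Q).
Qed.

Lemma homF_left_exact X Y Z (f : {linear X -> Y}) (g : {linear Y -> Z}) : ses f g ->
  relproj Q X -> ses (fmap F f) (fmap F g).
Proof.
move=> s rel; apply: mkses => [h h0|h|h gh|h].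
- apply: homF_ext => q; apply: (ses_inj s).
  by have := congr1 (fun h => of_homF h q) h0; rewrite of_homF_map => ->; rewrite linear0.
- by apply: homF_ext => q; rewrite !of_homF_map (ses_comp0 s).
- have gh0 q : g (of_homF h q) = 0.
    by have := congr1 (fun h => of_homF h q) gh; rewrite of_homF_map.
  have [k kP] := ses_lift s gh0; exists (homF_of k).
  by apply: homF_ext => q; rewrite of_homF_map; exact: kP.
- have [k kP] := rel _ _ _ _ s (of_homF h); exists (homF_of k).
  by apply: homF_ext => q; rewrite of_homF_map; exact: kP.
Qed.

End HomFunctorTheory.

Section HomFunctorDsum.
Variables (A : pzRingType) (t : nat) (Q : 'I_t -> lmodType A).
Local Notation QQ := (dsum Q).
Local Notation F := (Hom_functor (dsum Q)).

Lemma addm_Qi i : addm QQ (Q i).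
Proof.
by exists 1%N, (fun _ => dinj Q i), (fun _ => dproj Q i) => x; rewrite big_ord1 dproj_inj.
Qed.

Lemma homF_dsum : iso (((endo QQ)^c)^o : lmodType (endo QQ)^c) (dsum (fun i => F (Q i))).
Proof.
apply: iso_trans (homF_regular _) _.
have [f fP] := dsum_to (fun i => fmap F (dproj Q i)).
have [g gP] := dsum_from (fun i => fmap F (dinj Q i)).
exists f; exists g => h.
  rewrite [f h]dsumE linear_sum; apply: homF_ext => q; rewrite of_homF_sum.
  by rewrite [RHS]dsumE; apply: eq_bigr => i _; rewrite gP fP.
apply: dsum_ext => i; rewrite fP [h in LHS]dsumE linear_sum; apply: homF_ext => q.
rewrite of_homF_map of_homF_sum linear_sum (bigD1 i) //= gP big1 ?addr0 => [|j ji].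
  by rewrite of_homF_map dproj_inj.
by rewrite gP of_homF_map dproj_inj_neq.
Qed.

End HomFunctorDsum.

Section ArtinGamma.
Variables (R : comPzRingType) (A : pzRingType) (phi : algstr R A) (Q : lmodType A).
Hypotheses (artA : artin_algebra phi) (fgQ : fg Q).

Lemma artin_op (B : pzRingType) (psi : algstr R B) :
  artin_algebra psi -> artin_algebra (op_algstr psi).
Proof.
move=> [artR [n [v vP]]]; split=> //; exists n, v => x; have [c ->] := vP x.
exists c; apply: eq_bigr => i _; exact: (alg_central psi (c i) (v i)).
Qed.

Lemma artin_endo : artin_algebra (endo_algstr phi Q).
Proof.
split; first by case: artA.
have [n [v vP]] := flen_fg (homR_flen artA fgQ fgQ).
exists n, v => f; have [c fE] := vP f; exists c; apply/lhomP => x.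
by rewrite fE (lhom_sumE _ _ x) (lhom_sumE _ _ x).
Qed.

Lemma homF_fg M : fg M -> fg (Hom_functor Q M).
Proof.
move=> fgM; have [n [v vP]] := homR_span artA fgQ fgM.
exists n, (fun i => homF_of (v i)) => h; have [c cE] := vP (of_homF h).
exists (fun i => endo_map phi Q (c i)); apply: homF_ext => q; rewrite of_homF_sum cE.
by apply: eq_bigr => i _; rewrite of_homF_scale /= linearZ_LR.
Qed.

End ArtinGamma.

(** * The tensor functor, the unit and the counit *)

Section TensorTheory.
Variables (A : pzRingType) (Q : lmodType A).
Local Notation Gamma := ((endo Q)^c).
Local Notation F := (Hom_functor Q).
Local Notation G := (Tensor_functor Q).
Implicit Types (M N X Y Z K L : lmodType A) (V W : lmodType Gamma).

Lemma tensor_lin V M (h : Q -> V -> M) :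
  (forall q q' n, h (q + q') n = h q n + h q' n) ->
  (forall q n n', h q (n + n') = h q n + h q n') ->
  (forall q (g : Gamma) n, h ((g : endo Q) q) n = h q (g *: n)) ->
  (forall a q n, h (a *: q) n = a *: h q n) ->
  exists f : {linear G V -> M}, forall q n, f (tens q n) = h q n.
Proof.
move=> hDl hDr hbal hZ; pose f0 := @tensor_lift A Q V (zmodule M : lmodType int) h.
have f0D : {morph f0 : u v / u + v} by exact: tensor_liftD.
have f0E q n : f0 (tens q n) = h q n by exact: tensor_liftE.
have f0B (u v : tensor V) : f0 (u - v) = f0 u - f0 v.
  by apply/(canRL (addrK _)); rewrite -f0D subrK.
have lf : linear (f0 : G V -> M).
  move=> a u v; transitivity (f0 (a *: u : G V) + f0 v); first exact: f0D.
  congr (_ + _); elim/tensor_ind: u => [u w IHu IHw|q n].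
    by rewrite !(scalerBr, f0B) IHu IHw.
  by rewrite scale_tens !f0E hZ.
by exists (mklin lf); exact: f0E.
Qed.

Lemma tensor_ext V M (f f' : {linear G V -> M}) :
  (forall q n, f (tens q n) = f' (tens q n)) -> forall u, f u = f' u.
Proof.
move=> ff' u; elim/tensor_ind: u => [u v IHu IHv|q n]; last exact: ff'.
by rewrite !linearB IHu IHv.
Qed.

Lemma G_map V W (f : {linear V -> W}) q n : fmap G f (tens q n) = tens q (f n).
Proof. exact: tensor_mapE. Qed.

Lemma tensor_counit_ex M : exists f : {linear G (F M) -> M}, forall q h, f (tens q h) = of_homF h q.
Proof.
apply: (@tensor_lin (F M) M (fun q h => of_homF h q)) => // [q q' n|a q n].
  exact: linearD.
exact: linearZ_LR.
Qed.
Definition tensor_counit M : {linear G (F M) -> M} := projT1 (cid (tensor_counit_ex M)).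
Lemma tensor_counitE M q (h : F M) : tensor_counit M (tens q h) = of_homF h q.
Proof. exact: (projT2 (cid (tensor_counit_ex M))). Qed.

Lemma tensor_counit_nat M N (f : {linear M -> N}) u :
  tensor_counit N (fmap G (fmap F f) u) = f (tensor_counit M u).
Proof.
apply: (tensor_ext (f := tensor_counit N \o fmap G (fmap F f)) (f' := f \o tensor_counit M)) => q h.
by rewrite /= [tensor_map _ _]G_map !tensor_counitE.
Qed.

Fact tensl_linear V (n : V) : linear (fun q : Q => tens q n : G V).
Proof. by move=> a q q'; rewrite tensDl -scale_tens. Qed.
Definition tensl V (n : V) : {linear Q -> G V} := mklin (tensl_linear n).

Fact tensor_unit_linear V : linear (fun n : V => homF_of (tensl n) : F (G V)).
Proof.
move=> g n n'; apply: homF_ext => q; rewrite of_homFD of_homF_scale /of_homF /homF_of /=.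
by rewrite tensDr tens_bal.
Qed.
Definition tensor_unit V : {linear V -> F (G V)} := mklin (@tensor_unit_linear V).

Lemma tensor_unitE V n q : of_homF (tensor_unit V n) q = tens q n.
Proof. by []. Qed.

Lemma tensor_unit_nat V W (f : {linear V -> W}) n :
  fmap F (fmap G f) (tensor_unit V n) = tensor_unit W (f n).
Proof. by apply: homF_ext => q; rewrite of_homF_map !tensor_unitE G_map. Qed.

Lemma tensor_counit_eta M (h : F M) : fmap F (tensor_counit M) (tensor_unit (F M) h) = h.
Proof. by apply: homF_ext => q; rewrite of_homF_map tensor_unitE tensor_counitE. Qed.

Lemma G_surj V W (f : {linear V -> W}) : (forall y, exists x, f x = y) ->
  forall u, exists v, fmap G f v = u.
Proof.
move=> fs u; elim/tensor_ind: u => [_ _ [u <-] [v <-]|q n].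
  by exists (u - v); rewrite linearB.
by have [m <-] := fs n; exists (tens q m); rewrite G_map.
Qed.

(** Balancing gives q (x) h = sum over k of a_k(h(q)) (x) b_k, which depends only on the counit
    value h(q). The map f is this reconstruction. *)
Lemma tensor_counit_inj N : addm Q N -> injective (tensor_counit N).
Proof.
move=> [n [a [b ab]]].
have [f fE] := lin_sum_fun (fun k =>
  tensl (homF_of (b k)) \o (a k \o tensor_counit N) : {linear G (F N) -> G (F N)}).
have fid u : f u = u.
  apply: (tensor_ext (f := f) (f' := idfun)) => q h; rewrite fE /=.
  have hE : h = \sum_k (a k \o of_homF h : Gamma) *: homF_of (b k).
    by apply: homF_ext => r; rewrite of_homF_sum {1}[of_homF h r]ab.
  transitivity (tens q (\sum_k (a k \o of_homF h : Gamma) *: homF_of (b k))); last by rewrite -hE.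
  have tensr : {morph (fun v : F N => tens q v) : x y / x + y} by exact: tensDr.
  have tens0 : tens q (0 : F N) = 0 by apply: (@addrI _ (tens q 0)); rewrite -tensr !addr0.
  rewrite (big_morph _ tensr tens0); apply: eq_bigr => k _.
  by rewrite -[LHS]/(tens (a k (tensor_counit N (tens q _))) _) tensor_counitE -tens_bal.
by apply: lin_inj => u u0; rewrite -(fid u) fE big1 // => k _;
  rewrite -[LHS]/(tensl (homF_of (b k)) (a k (tensor_counit N u))) u0 !linear0.
Qed.

Lemma tensor_counit_surj L K (e : {linear L -> K}) : addm Q L -> (forall y, exists x, e x = y) ->
  forall y, exists u, tensor_counit K u = y.
Proof.
move=> [n [a [b ab]]] es y; have [x <-] := es y.
exists (\sum_k (tens (a k x) (homF_of (e \o b k) : F K) : G (F K))).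
rewrite linear_sum {2}[x]ab linear_sum; apply: eq_bigr => k _; exact: tensor_counitE.
Qed.

(** Five lemma: an element killed by the counit of X lifts to G(F(N)); there its counit value comes
    from K, hence from G(F(K)), and injectivity for N shows that the lift itself comes from
    G(F(K)). *)
Lemma tensor_counit_bij K N X L (k : {linear K -> N}) (g : {linear N -> X}) (e : {linear L -> K}) :
  ses k g -> relproj Q K -> addm Q N -> addm Q L -> (forall y, exists x, e x = y) ->
  bijective (tensor_counit X).
Proof.
move=> s rel aN aL es; have sF := homF_left_exact s rel.
apply: inj_surj_bij; last exact: tensor_counit_surj aN (ses_surj s).
apply: lin_inj => u eu; have [v vE] := G_surj (ses_surj sF) u.
have [x xE] := ses_exact s (y := tensor_counit N v)
  (etrans (esym (tensor_counit_nat g v)) (etrans (congr1 _ vE) eu)).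
have [w wE] := tensor_counit_surj aL es x.
have vw : v = fmap G (fmap F k) w by apply: (tensor_counit_inj aN); rewrite tensor_counit_nat wE.
rewrite -vE vw; apply: (tensor_ext (f := fmap G (fmap F g) \o fmap G (fmap F k)) (f' := \0)).
move=> q h; rewrite /= [tensor_map (fmap F k) _]G_map [tensor_map _ _]G_map.
have -> : fmap F g (fmap F k h) = 0 by exact: ses_comp0 sF h.
by apply: (@addrI _ (tens q 0)); rewrite -tensDr !addr0.
Qed.

Lemma homF_full X Y : bijective (tensor_counit X) ->
  forall p : {linear F X -> F Y}, exists f : {linear X -> Y}, fmap F f =1 p.
Proof.
move=> /bijective_linv[e [eK Ke]] p; exists (tensor_counit Y \o (fmap G p \o e)) => h.
apply: homF_ext => q; rewrite of_homF_map /= -tensor_counitE eK.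
by rewrite [tensor_map _ _]G_map tensor_counitE.
Qed.

Lemma homF_faithful L X Y (e : {linear L -> X}) (f f' : {linear X -> Y}) :
  addm Q L -> (forall y, exists x, e x = y) ->
  fmap F f =1 fmap F f' -> f =1 f'.
Proof.
move=> aL es ff' x; have [l <-] := es x.
apply: (addm_faithful (f := f \o e) (f' := f' \o e) aL) => h.
have := ff' (fmap F e h) => ffe; apply: homF_ext => q.
by have := congr1 (fun h => of_homF h q) ffe; rewrite !of_homF_map.
Qed.

(** L covers Y, and each composite Q -> L -> Y lifts along f. *)
Lemma homF_surj L X Y (e : {linear L -> Y}) (f : {linear X -> Y}) :
  addm Q L -> (forall y, exists x, e x = y) -> (forall h, exists h', fmap F f h' = h) ->
  forall y, exists x, f x = y.
Proof.
move=> [n [a [b ab]]] es fs y; have [l <-] := es y.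
rewrite [l]ab linear_sum; apply/imSP/rpred_sum => k _; apply/imSP.
have [h' h'E] := fs (homF_of (e \o b k)); exists (of_homF h' (a k l)).
by rewrite -of_homF_map h'E.
Qed.

(** On F(X) the unit is inverse to F of the counit, by the triangle identity; naturality carries
    this along the isomorphism. *)
Lemma tensor_unit_bij V X : bijective (tensor_counit X) -> iso (F X) V -> bijective (tensor_unit V).
Proof.
move=> /bijective_linv[e [eK Ke]] [v /bijective_linv[w [vK wK]]].
have eta0 : bijective (tensor_unit (F X)).
  exists (fmap F (tensor_counit X)) => h; first exact: tensor_counit_eta.
  have -> : h = fmap F e (fmap F (tensor_counit X) h).
    by apply: homF_ext => q; rewrite !of_homF_map eK.
  set h' := fmap F (tensor_counit X) h; apply: homF_ext => q.
  rewrite tensor_unitE of_homF_map; have -> : fmap F (tensor_counit X) (fmap F e h') = h'.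
    by apply: homF_ext => r; rewrite !of_homF_map Ke.
  by rewrite -tensor_counitE eK.
have b1 : bijective (fmap F (fmap G v)).
  exists (fmap F (fmap G w)) => h; apply: homF_ext => q; rewrite !of_homF_map.
    apply: (tensor_ext (f := fmap G w \o fmap G v) (f' := idfun)) => r n.
    by rewrite /= [tensor_map v _]G_map [tensor_map _ _]G_map vK.
  apply: (tensor_ext (f := fmap G v \o fmap G w) (f' := idfun)) => r n.
  by rewrite /= [tensor_map w _]G_map [tensor_map _ _]G_map wK.
have bw : bijective w by exists v.
apply: (eq_bij (bij_comp b1 (bij_comp eta0 bw))) => n /=.
by rewrite [homF_map _ _]tensor_unit_nat wK.
Qed.

Lemma tensor_fg V : fg Q -> fg V -> fg (G V).
Proof.
move=> [m [x xP]] [n [v vP]].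
apply: (@fg_fin A ('I_m * 'I_n)%type (G V) (fun k => tens (x k.1) (v k.2))) => u.
elim/tensor_ind: u => [_ _ [c ->] [d ->]|q y].
  exists (fun k => c k - d k); rewrite -sumrB; apply: eq_bigr => k _.
  by rewrite scalerBl.
have [c ->] := vP y; have [d dE] := choice (fun j => xP ((c j : endo Q) q)).
exists (fun k => d k.2 k.1).
rewrite -(pair_bigA _ (fun i j => d j i *: (tens (x i) (v j) : G V))) /= exchange_big /=.
have tensr : {morph (fun w : V => tens q w) : x y / x + y} by exact: tensDr.
have tens0 : tens q (0 : V) = 0 by apply: (@addrI _ (tens q 0)); rewrite -tensr !addr0.
rewrite (big_morph _ tensr tens0); apply: eq_bigr => j _.
rewrite -tens_bal (dE j) -[LHS]/(tensl (v j) _) linear_sum; apply: eq_bigr => i _.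
by rewrite linearZ_LR.
Qed.

End TensorTheory.

(** * The proper standard modules of Gamma *)

Section Gamma.
Variables (R : comPzRingType) (A : pzRingType) (phi : algstr R A) (t : nat)
  (Psi Q : 'I_t -> lmodType A) (le : rel 'I_t).
Hypotheses (artA : artin_algebra phi) (pcs : proper_costratifying_system Psi Q le).
Implicit Types M N X Y Z K : lmodType A.
Local Notation QQ := (dsum Q).
Local Notation Gamma := ((endo QQ)^c).
Local Notation F := (Hom_functor QQ).
Local Notation G := (Tensor_functor QQ).
Local Notation P := (fun i => F (Q i)).
Local Notation DeltaBar := (proper_standard P (op_order le)).
Local Notation FPsi := (FP Psi predT).
Local Notation FDelta := (Filt (famclass DeltaBar)).

Let lin : linear_order le := pcs_order pcs.
Let dT : downset le predT. Proof. by []. Qed.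

Lemma fgQQ : fg QQ.
Proof.
apply/flen_fg/(flen_joint (g := dproj Q)) => [i|x x0]; first exact: flenQ artA pcs i.
by apply: dsum_ext => i; rewrite x0 linear0.
Qed.

Lemma artin_Gamma : artin_algebra (op_algstr (endo_algstr phi QQ)).
Proof. exact: artin_op (artin_endo artA fgQQ). Qed.

Lemma flen_Gamma : flen (Gamma^o : lmodType Gamma).
Proof. by apply: (artin_flen artin_Gamma); exact: fg_regular. Qed.

(** For k < l there are no nonzero maps Q(k) -> Psi(l), whereas Q(l) maps onto the nonzero module
    Psi(l). *)
Lemma Q_iso_inj i j : iso (Q i) (Q j) -> i = j.
Proof.
have no k l : strict le k l -> ~ iso (Q k) (Q l).
  move=> kl [f [g _ gK]]; apply: (beta_nz (pcs := pcs) (i := l)) => x.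
  by rewrite -[x]gK; exact: (Qhom0 pcs (beta pcs l \o f) kl).
have [r a tr to] := lin => ij; apply/eqP; apply: contrapT => /negP nij.
case/orP: (to i j) => h; first by apply: (no i j) => //; rewrite /strict h.
by apply: (no j i); [rewrite /strict h eq_sym|exact: iso_sym].
Qed.

Lemma P_indec i : indecomposable (F (Q i)).
Proof. exact: homF_indecomposable (addm_Qi Q i) (pcs_indec pcs i). Qed.

Lemma P_inj i j : iso (F (Q i)) (F (Q j)) -> i = j.
Proof. by move/(homF_iso_inv (addm_Qi Q i) (addm_Qi Q j))/Q_iso_inj. Qed.

Lemma P_retract i : retract (F (Q i)) (Gamma^o : lmodType Gamma).
Proof. exact: (summand_regular (homF_dsum Q) i). Qed.

Lemma P_flen i : flen (F (Q i)).
Proof. exact: retract_flen (P_retract i) flen_Gamma. Qed.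

Lemma P_projective i : projective (F (Q i)).
Proof. exact: retract_projective (P_retract i) (@projective_regular Gamma). Qed.

Lemma P_rep : rep_indec_proj P.
Proof. exact: basic_rep_indec_proj flen_Gamma (homF_dsum Q) P_indec P_inj. Qed.

Lemma FPsi_relproj X : FPsi X -> relproj QQ X.
Proof.
by move=> fX; apply: relproj_sumfac (sumfac_dsum Q) => i; exact: (Q_relproj pcs fX).
Qed.

Lemma FPsi_cover X : FPsi X -> exists N K (k : {linear K -> N}) (g : {linear N -> X}),
  [/\ ses k g, FPsi K & addm QQ N].
Proof.
move=> /(FP_cover pcs dT)[N [K [k [g [s fK _ aN]]]]]; exists N, K, k, g; split=> //.
exact/addQ_sumfac.
Qed.

Lemma tensor_counit_FPsi X : FPsi X -> bijective (tensor_counit QQ X).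
Proof.
move=> /FPsi_cover[N [K [k [g [s fK aN]]]]].
have [L [K' [k' [e [s' _ aL]]]]] := FPsi_cover fK.
exact: tensor_counit_bij s (FPsi_relproj fK) aN aL (ses_surj s').
Qed.

Lemma F_exact X Y Z (f : {linear X -> Y}) (g : {linear Y -> Z}) :
  FPsi X -> ses f g -> ses (fmap F f) (fmap F g).
Proof. by move=> fX s; exact: homF_left_exact s (FPsi_relproj fX). Qed.

Lemma FPsi_sub D X : FP Psi D X -> FPsi X. Proof. exact: FP_sub. Qed.

(** A map from F(Q(j)), j <= i, into the radical is F(u) by Yoneda, and beta u = 0: for j < i
    because Hom(Q(j), Psi(i)) = 0, for j = i because u is not bijective. Conversely, the kernel of
    F(beta) is proper, hence inside the radical, and its elements factor through Q(l)'s with l <=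
    i. *)
Lemma DeltaBar_mem i (x : F (Q i)) :
  x \in sub_image (val : {linear subm (Defs.rad (F (Q i))) -> F (Q i)})
      (trace (dsum (fun j : {j | op_order le i j} => P (val j))) (subm (Defs.rad (F (Q i)))))
  <-> fmap F (beta pcs i) x = 0.
Proof.
have [x0 x0r] := rad_proper (P_flen i) (P_indec i).
have bx0 : exists x, fmap F (beta pcs i) x <> 0.
  apply: contrapT => nb; apply: (beta_nz (pcs := pcs) (i := i)) => y.
  have /homF_comp0/(_ (dproj Q i) (dinj Q i y)) : forall h, fmap F (beta pcs i) h = 0.
    by move=> h; apply: contrapT => nh; apply: nb; exists h.
  by rewrite dproj_inj.
split=> [/sub_imageP[y ytr ->]|bx].
  have := @gen_submod_ker _ _ _ _ (fmap F (beta pcs i) \o inclS (Defs.rad (F (Q i)))).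
  move=> /(_ _ _ _ ytr); rewrite /= inclSE; apply=> _ [f [z ->]].
  rewrite /= [z]dsumE !linear_sum big1 // => -[j lej] _; set zj := dproj _ _ z.
  pose g : {linear F (Q j) -> F (Q i)} := inclS (Defs.rad (F (Q i))) \o
    (f \o dinj (fun j : {j | op_order le i j} => P (val j)) (exist _ j lej)).
  have gr h : g h \in Defs.rad (F (Q i)) by exact: inclSP.
  rewrite -[LHS]/(fmap F (beta pcs i) (g zj)); move: g gr zj => g gr zj.
  have [u uP] := yoneda g (addm_Qi Q j); rewrite uP; apply: homF_ext => q.
  rewrite !of_homF_map; case: (eqVneq j i) => [eji|nji]; last first.
    by apply: (Qhom0 pcs (beta pcs i \o u)); rewrite /strict nji andbT; exact: lej.
  move: u uP {zj} (of_homF zj q); subst j => u uP z1.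
  (* If u were bijective, g would be onto, although its values lie in the radical, which misses
     [x0]. *)
  apply: (beta_nonbij artA pcs) => bu; have [v [_ vK]] := bijective_linv bu.
  move: x0r; have -> : x0 = g (fmap F v x0).
    by rewrite uP; apply: homF_ext => r; rewrite !of_homF_map vK.
  by rewrite gr.
have [w wP] := ses_lift (h := of_homF x) (beta_ses pcs i)
  (fun q => congr1 (fun h : F (Psi i) => of_homF h q) bx).
have [I [l [s [r [lD wE]]]]] := FP_factor pcs w (downset_le lin (k := i)) (FP_kerQ pcs i)
  (fun K fK => FPsi_relproj (FPsi_sub fK)).
have sub_rad : {subset kerS (fmap F (beta pcs i)) <= Defs.rad (F (Q i))}.
  apply: (proper_sub_rad (P_flen i) (P_indec i) (@P_projective i)).
  by have [y by0] := bx0; move=> /(_ y)/kerSP.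
pose f k : {linear F (Q (l k)) -> F (Q i)} := fmap F (alpha pcs i \o r k).
have frad k h : f k h \in Defs.rad (F (Q i)).
  apply/sub_rad/kerSP/homF_ext => q; rewrite !of_homF_map /=.
  exact: ses_comp0 (beta_ses pcs i) _.
have xr : x \in Defs.rad (F (Q i)) by apply/sub_rad/kerSP.
have [y yE] := inclS_ex xr; apply/sub_imageP; exists y; last by rewrite -yE inclSE.
have [f' f'P] : exists f' : forall k, {linear F (Q (l k)) -> subm (Defs.rad (F (Q i)))},
    forall k h, inclS _ (f' k h) = f k h.
  have ex k := cid (corestr (frad k)).
  by exists (fun k => projT1 (ex k)) => k; exact: (projT2 (ex k)).
have -> : y = \sum_k f' k (homF_of (s k)).
  apply: (@inclS_inj _ _ (Defs.rad (F (Q i)))); rewrite yE linear_sum.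
  apply: homF_ext => q; rewrite of_homF_sum -wP wE linear_sum; apply: eq_bigr => k _.
  by rewrite f'P.
apply: rpred_sum => k _; apply: mem_gen_submod.
pose kk : {j | op_order le i j} := exist _ (l k) (lD k).
exists (f' k \o dproj (fun j : {j | op_order le i j} => P (val j)) kk),
  (dinj (fun j : {j | op_order le i j} => P (val j)) kk (homF_of (s k))).
by rewrite /= dproj_inj.
Qed.

Lemma F_Psi i : iso (F (Psi i)) (DeltaBar i).
Proof.
apply: iso_sym; apply: (iso_ker (f := fmap F (beta pcs i))) => [y|x]; last exact: DeltaBar_mem.
exact: ses_surj (F_exact (FPsi_sub (FP_kerQ pcs i)) (beta_ses pcs i)) y.
Qed.

Lemma F_FPsi X : FPsi X -> FDelta (F X).
Proof.
move: X; apply: FP_elim => [X X0|X Y j f g fX IH _ s].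
  by apply: Filt0 => h; apply: homF_ext => q; exact: X0.
have [v bv] := F_Psi j; have s' := ses_iso_r bv (F_exact fX s).
by apply: FiltS IH _ s'; exists j.
Qed.

Lemma F_full X Y : FPsi X -> forall p : {linear F X -> F Y},
  exists f : {linear X -> Y}, fmap F f =1 p.
Proof. by move=> /tensor_counit_FPsi; exact: homF_full. Qed.

Lemma F_faithful X Y (f f' : {linear X -> Y}) : FPsi X -> fmap F f =1 fmap F f' -> f =1 f'.
Proof.
by move=> /FPsi_cover[N [K [k [g [s fK aN]]]]]; exact: homF_faithful aN (ses_surj s).
Qed.

(* The pushout of Z(j) -> Q(j) along the map Z(j) -> X' that F sends to the     *)
(* restriction of a lift P(j) -> Y is mapped by F to Y.                         *)
Lemma F_dense (Y : lmodType Gamma) : FDelta Y -> exists2 X, FPsi X & iso (F X) Y.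
Proof.
elim=> {Y} [Y Y0|Y Y' Z u w0 _ [X' fX' [th bth]] [j eZ] s].
  have [X [_ X0]] : exists X : lmodType A, FPsi X /\ zero_module X.
    have Z0 : zero_module (subm (zeroS QQ)).
      by move=> x; apply: (@inclS_inj _ _ (zeroS QQ)); rewrite linear0; apply/zeroSP/inclSP.
    by exists (subm (zeroS QQ)); split=> //; exact: Filt0.
  exists X; first exact: Filt0.
  by apply: zero_iso => // h; apply: homF_ext => q; exact: X0.
subst Z; have [w {}s] : exists w : {linear Y -> F (Psi j)}, ses u w.
  have [v bv] := iso_sym (F_Psi j); exists (v \o w0); exact: ses_iso_r bv s.
have fZ := FPsi_sub (FP_kerQ pcs j); have sj := F_exact fZ (beta_ses pcs j).
set al := alpha pcs j in sj *; set be := beta pcs j in sj *.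
have [l lP] := P_projective (fmap F be) (ses_surj s).
have [m mP] : exists m : {linear F (kerQ pcs j) -> Y'}, forall h, u (m h) = (l \o fmap F al) h.
  by apply: (ses_lift s) => h; rewrite /= lP; exact: ses_comp0 sj h.
have [th' [thK th'K]] := bijective_linv bth.
have [f fP] := F_full fZ (th' \o m).
pose sg : {linear kerQ pcs j -> (X' * Q j)%type} := into_pair (\- f) al.
pose p := projQ (imS sg).
have ssg : ses sg p.
  apply: mkses => [z|z|x|]; last exact: projQ_surj.
  - by rewrite /sg into_pairE => -[_]; rewrite -(linear0 al) => /(ses_inj (beta_ses pcs j)).
  - by apply/projQ0/imSP; exists z.
  - by move/projQ0/imSP.
have [b bP] : exists b : {linear quotm (imS sg) -> Psi j}, forall x, b (p x) = (be \o snd) x.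
  by apply: quot_desc => _ /imSP[z <-]; rewrite /sg into_pairE; exact: ses_comp0 (beta_ses pcs j) z.
have sX : ses (p \o inlm X' (Q j)) b.
  apply: mkses => [x|x|y|y].
  - move/projQ0/imSP=> [z]; rewrite /sg into_pairE inlmE => -[fz /esym].
    rewrite -fz => /esym; rewrite -(linear0 al) => /(ses_inj (beta_ses pcs j)) ->.
    by rewrite !linear0.
  - by rewrite bP /= inlmE linear0.
  - have [[x q] <-] := projQ_surj y; rewrite bP /= => /(ses_exact (beta_ses pcs j))[z zE].
    exists (x + f z); apply/eqP; rewrite -subr_eq0 -linearB; apply/eqP/projQ0/imSP.
    exists (- z); rewrite /sg into_pairE inlmE !linearN opprK; congr (_, _) => /=.
      by rewrite addrAC subrr add0r.
    by rewrite zE sub0r.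
  - have [q <-] := ses_surj (beta_ses pcs j) y; exists (p (inrm X' (Q j) q)).
    by rewrite bP /= inrmE.
exists (quotm (imS sg)); first by apply: FiltS fX' _ sX; exists j.
have sF := F_exact fZ ssg.
(* F of the pushout and Y are both quotients of F(X' x Q(j)); the two kernels agree, being the image
   of the antidiagonal [sg]. *)
pose e : {linear F (X' * Q j)%type -> Y} :=
  (u \o (th \o fmap F (fst : {linear (X' * Q j)%type -> X'}))) \+
  (l \o fmap F (snd : {linear (X' * Q j)%type -> Q j})).
have eE h : e h = u (th (fmap F (fst : {linear (X' * Q j)%type -> X'}) h))
   + l (fmap F (snd : {linear (X' * Q j)%type -> Q j}) h) by [].
apply: (surj_iso (ses_surj sF) (f' := e)) => [y|h].
  have [c cE] := ses_surj sj (w y).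
  have [|y' y'E] := ses_exact s (y := y - l c) _.
    by rewrite linearB lP cE subrr.
  exists (homF_of (into_pair (of_homF (th' y')) (of_homF c))); rewrite eE.
  rewrite (_ : fmap F _ _ = th' y'); last first.
    by apply: homF_ext => q; rewrite of_homF_map /of_homF /homF_of into_pairE.
  rewrite (_ : fmap F _ _ = c); last first.
    by apply: homF_ext => q; rewrite of_homF_map /of_homF /homF_of into_pairE.
  by rewrite th'K y'E subrK.
have esg z : e (fmap F sg z) = 0.
  rewrite eE (_ : fmap F _ (fmap F sg z) = - th' (m z)); last first.
    by apply: homF_ext => q; rewrite -[th' _]/((th' \o m) z) -fP /of_homF /= /sg into_pairE.
  rewrite (_ : fmap F _ (fmap F sg z) = fmap F al z); last first.
    by apply: homF_ext => q; rewrite /of_homF /= /sg into_pairE.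
  by rewrite !linearN th'K mP /= addNr.
split=> [/(ses_exact sF)[z <-]|eh]; first exact: esg.
have [|z zE] := ses_exact sj (y := fmap F (snd : {linear (X' * Q j)%type -> Q j}) h) _.
  by have := congr1 w eh; rewrite eE linearD (ses_comp0 s) add0r lP linear0.
suff -> : h = fmap F sg z by exact: ses_comp0 sF z.
have h1 : fmap F (fst : {linear (X' * Q j)%type -> X'}) h = - th' (m z).
  apply: (can_inj thK); apply: (ses_inj s); rewrite linearN th'K linearN mP /=.
  by apply/eqP; rewrite -subr_eq0 opprK [fmap F al z]zE -eE eh.
apply: homF_ext => q; rewrite of_homF_map /sg into_pairE [LHS]surjective_pairing.
congr (_, _); last by have := congr1 (fun h => of_homF h q) zE; rewrite !of_homF_map.
have := congr1 (fun h => of_homF h q) h1; rewrite of_homF_map /= => ->.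
by rewrite -[th' _]/((th' \o m) z) -fP.
Qed.

Lemma G_FDelta (Y : lmodType Gamma) : FDelta Y -> FPsi (G Y).
Proof.
move=> /F_dense[X fX [v /bijective_linv[w [vK wK]]]]; apply: (Filt_iso _ fX).
apply: iso_trans (iso_sym (ex_intro _ (tensor_counit QQ X) (tensor_counit_FPsi fX))) _.
exists (fmap G v); exists (fmap G w) => u.
  apply: (tensor_ext (f := fmap G w \o fmap G v) (f' := idfun)) => r n.
  by rewrite /= [tensor_map v _]G_map [tensor_map _ _]G_map vK.
apply: (tensor_ext (f := fmap G v \o fmap G w) (f' := idfun)) => r n.
by rewrite /= [tensor_map w _]G_map [tensor_map _ _]G_map wK.
Qed.

Lemma tensor_unit_FDelta (Y : lmodType Gamma) : FDelta Y -> bijective (tensor_unit Y).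
Proof. by move=> /F_dense[X fX i]; exact: (tensor_unit_bij (tensor_counit_FPsi fX) i). Qed.

Lemma F_equivalence : exact_equivalence_on F FPsi FDelta.
Proof.
split; first exact: F_FPsi.
- by move=> X Y fX _; exact: F_full.
- by move=> X Y fX _ f f'; exact: F_faithful.
- exact: F_dense.
- by move=> X Y Z f g fX _ _; exact: F_exact.
Qed.

Lemma FG_quasi_inverse : quasi_inverse_on F G FPsi FDelta.
Proof.
split; [exact: F_FPsi|exact: G_FDelta| |].
  exists (tensor_counit QQ); split; first exact: tensor_counit_FPsi.
  by move=> M N f _ _ x; exact: tensor_counit_nat.
(* The inverse of the unit where the unit is bijective; elsewhere 0 is a default value. *)
pose theta (Y : lmodType Gamma) : {linear F (G Y) -> Y} :=
  match pselect (bijective (tensor_unit Y)) with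
  | left b => projT1 (cid (bijective_linv b)) | right _ => \0 end.
have thetaP (Y : lmodType Gamma) : FDelta Y ->
    cancel (tensor_unit Y) (theta Y) /\ cancel (theta Y) (tensor_unit Y).
  move=> /tensor_unit_FDelta b; rewrite /theta; case: pselect => // b'.
  exact: (projT2 (cid (bijective_linv b'))).
exists theta; split=> [Y /thetaP[h1 h2]|Y Z f /thetaP[h1 h2] /thetaP[h3 h4] x].
  by exists (tensor_unit Y).
by apply: (can_inj h3); rewrite h4 -tensor_unit_nat h2.
Qed.

(** An epimorphism between objects of F(DeltaBar) is F(g') for a map g' in F(Psi). Surjectivity of
    F(g') makes g' onto and lets every map from Q(i) lift along it, so [FP_ker] applies to its
    kernel. Projectives are sums of F(Q(i))'s. *)
Lemma FDelta_resolving : resolving FDelta.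
Proof.
split=> [X Y Z f g _ _ _ s fX fZ|X Y Z f g _ _ _ s fY fZ|Y fgY pY]; first exact: Filt_ses s fX fZ.
  have [Y' fY' [v bv]] := F_dense fY; have [Z' fZ' iZ] := F_dense fZ.
  have [w bw] := iso_sym iZ.
  have [v' [vK v'K]] := bijective_linv bv.
  have [g' g'P] := F_full fY' (w \o (g \o v)).
  have [w' _ w'K] := bw.
  have Fs h : exists h', fmap F g' h' = h.
    have [y yE] := ses_surj s (w' h); exists (v' y).
    by rewrite g'P /= v'K yE w'K.
  have [N [K [k [e [sN _ aN]]]]] := FPsi_cover fZ'.
  have sg' := ses_ker (homF_surj aN (ses_surj sN) Fs).
  have fK : FPsi (subm (kerS g')).
    apply: (FP_ker pcs sg') fY' fZ' => i h.
    have [h' h'E] := Fs (homF_of (h \o dproj Q i)); exists (of_homF h' \o dinj Q i) => x.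
    by rewrite /= -of_homF_map h'E /of_homF /homF_of /= dproj_inj.
  apply: Filt_iso (F_FPsi fK); have sK := F_exact fK sg'.
  have [q qP] : exists q : {linear F (subm (kerS g')) -> X},
      forall h, f (q h) = (v \o fmap F (inclS (kerS g'))) h.
    apply: (ses_lift s) => h; apply: (bij_inj bw); rewrite linear0.
    rewrite -[LHS]/((w \o (g \o v)) (fmap F (inclS (kerS g')) h)) -g'P.
    exact: ses_comp0 sK h.
  exists q; apply: inj_surj_bij.
    apply: lin_inj => h h0; apply: (ses_inj sK); apply: (can_inj vK).
    by rewrite -[v _]qP h0 !linear0.
  move=> x; have [|h hE] := ses_exact sK (y := v' (f x)) _.
    by rewrite g'P /= v'K (ses_comp0 s) linear0.
  by exists h; apply: (ses_inj s); rewrite qP /= [homF_map _ _]hE v'K.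
apply: SumOf_Filt (fg_proj_SumOf flen_Gamma (homF_dsum Q) P_indec fgY pY) => N [i iN].
apply: Filt_iso (iso_sym iN) _; apply: F_FPsi; exact: FPsi_sub (FP_Q pcs i).
Qed.

(** The projection onto the summand is F(f) for an idempotent f of X, whose image is a direct
    summand of X and so stays in F(Psi). *)
Lemma FDelta_summand : summand_closed FDelta.
Proof.
move=> Y N _ _ fY /retract_summand rN; have [X fX iX] := F_dense fY.
have [a [r ra]] := retract_trans rN (iso_retract (iso_sym iX)).
have [f fP] := F_full fX (a \o r).
have [p [pP ps]] := corestr_im f.
have ff x : f (f x) = f x.
  apply: (F_faithful (f := f \o f) (f' := f) fX) => h.
  transitivity (fmap F f (fmap F f h)); first by apply: homF_ext.
  by rewrite !fP /= ra.
have pi y : p (inclS (imS f) y) = y.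
  apply: (@inclS_inj _ _ (imS f)); have [x <-] := ps y; by rewrite !pP ff.
have fI : FPsi (subm (imS f)) by apply: (FP_retract artA pcs) fX _; exists (inclS (imS f)), p.
apply: Filt_iso (F_FPsi fI).
have ip h : fmap F (inclS (imS f)) (fmap F p h) = a (r h).
  by rewrite -[RHS]/((a \o r) h) -fP; apply: homF_ext => q; rewrite !of_homF_map pP.
exists (r \o fmap F (inclS (imS f))); exists (fmap F p \o a) => [h|n] /=.
  rewrite -[a _]ip; apply: homF_ext => q; rewrite !of_homF_map /= !pi //.
by rewrite [homF_map _ _]ip !ra.
Qed.

End Gamma.

(** * The opposite algebra *)

Section Cohom.
Variables (A : pzRingType) (Q : lmodType A).
Local Notation Gamma := ((endo Q)^c).
Local Notation F := (Hom_functor Q).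

(** Hom(M, Q) with End(Q) acting by postcomposition: a concrete model, for M in add(Q), of the dual
    of F(M), see [dual_homF]. *)
Definition cohom (M : lmodType A) : Type := lhom M Q.

Section Object.
Variable M : lmodType A.
HB.instance Definition _ := GRing.Zmodule.on (cohom M).
Definition cohom_scale (a : Gamma^c) (f : cohom M) : cohom M :=
  ((a : endo Q) \o (f : lhom M Q) : {linear M -> Q}).
Fact cohom_scaleA a b f : cohom_scale a (cohom_scale b f) = cohom_scale (a * b) f.
Proof. by apply/lhomP. Qed.
Fact cohom_scale1 : left_id 1 cohom_scale.
Proof. by move=> f; apply/lhomP. Qed.
Fact cohom_scaleDr : right_distributive cohom_scale +%R.
Proof. by move=> a f g; apply/lhomP => x; exact: linearD. Qed.
Fact cohom_scaleDl f : {morph cohom_scale^~ f : a b / a + b}.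
Proof. by move=> a b; apply/lhomP. Qed.
HB.instance Definition _ := GRing.Zmodule_isLmodule.Build Gamma^c (cohom M)
  cohom_scaleA cohom_scale1 cohom_scaleDr cohom_scaleDl.
End Object.

Implicit Types M N : lmodType A.

Definition cohom_of M (f : {linear M -> Q}) : cohom M := f.
Definition of_cohom M (f : cohom M) : {linear M -> Q} := f.

Lemma cohom_ext M (f g : cohom M) : (forall x, of_cohom f x = of_cohom g x) -> f = g.
Proof. by move=> fg; apply/lhomP. Qed.

Lemma of_cohom_scale M (a : Gamma^c) (f : cohom M) x :
  of_cohom (a *: f) x = (a : endo Q) (of_cohom f x).
Proof. by []. Qed.

Lemma of_cohom_sum M (I : Type) (r : seq I) (f : I -> cohom M) x :
  of_cohom (\sum_(i <- r) f i) x = \sum_(i <- r) of_cohom (f i) x.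
Proof. exact: lhom_sumE. Qed.

Lemma of_cohomD M (f g : cohom M) x : of_cohom (f + g) x = of_cohom f x + of_cohom g x.
Proof. by []. Qed.
Lemma of_cohomN M (f : cohom M) x : of_cohom (- f) x = - of_cohom f x.
Proof. by []. Qed.

Fact cohom_map_linear M N (u : {linear M -> N}) :
  linear (fun f : cohom N => cohom_of (of_cohom f \o u) : cohom M).
Proof. by move=> a f g; apply: cohom_ext. Qed.
Definition cohom_map M N (u : {linear M -> N}) : {linear cohom N -> cohom M} :=
  mklin (cohom_map_linear u).

Lemma cohom_mapE M N (u : {linear M -> N}) f x : of_cohom (cohom_map u f) x = of_cohom f (u x).
Proof. by []. Qed.

Lemma coyoneda N M (p : {linear cohom N -> cohom M}) : addm Q N ->
  exists u : {linear M -> N}, forall f, p f = cohom_map u f.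
Proof.
move=> [n [a [b ab]]].
have [u uE] := lin_sum_fun (fun k => b k \o of_cohom (p (cohom_of (a k))) : {linear M -> N}).
exists u => f.
have fE : f = \sum_k (of_cohom f \o b k : Gamma^c) *: cohom_of (a k).
  by apply: cohom_ext => x; rewrite of_cohom_sum {1}[x]ab linear_sum.
rewrite {1}fE linear_sum; apply: cohom_ext => x; rewrite of_cohom_sum cohom_mapE uE linear_sum.
by apply: eq_bigr => k _; rewrite linearZ_LR.
Qed.

Lemma cohom_faithful M N (u v : {linear M -> N}) : addm Q N ->
  (forall f, cohom_map u f = cohom_map v f) -> forall x, u x = v x.
Proof.
move=> [n [a [b ab]]] uv x; rewrite [LHS]ab [RHS]ab; apply: eq_bigr => k _.
by have := congr1 (fun f => of_cohom f x) (uv (cohom_of (a k))); rewrite !cohom_mapE => ->.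
Qed.

Lemma cohom_iso_inv M N : addm Q M -> addm Q N -> iso (cohom M) (cohom N) -> iso N M.
Proof.
move=> aM aN [p /bijective_linv[p' [pK p'K]]].
have [f fP] := coyoneda p aM; have [g gP] := coyoneda p' aN.
exists f; exists g => x.
  apply: (cohom_faithful (u := g \o f) (v := idfun) aN) => h.
  transitivity (p (p' h)); first by rewrite gP fP; apply: cohom_ext.
  by rewrite p'K; apply: cohom_ext.
apply: (cohom_faithful (u := f \o g) (v := idfun) aM) => h.
transitivity (p' (p h)); first by rewrite fP gP; apply: cohom_ext.
by rewrite pK; apply: cohom_ext.
Qed.

Lemma cohom_indecomposable N : addm Q N -> indecomposable N -> indecomposable (cohom N).
Proof.
move=> aN /indecomposable_idem[nN idN]; apply/indecomposable_idem; split.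
  move=> z; apply: nN => x; apply: (cohom_faithful (u := idfun) (v := \0) aN) => h.
  by rewrite (z (cohom_map _ h)) [RHS]z.
move=> e ee; have [f fP] := coyoneda e aN.
have [x|f0|f1] := idN f.
- apply: (cohom_faithful (u := f \o f) (v := f) aN) => h.
  by transitivity (e (e h)); [rewrite !fP; apply: cohom_ext|rewrite ee fP].
- by left=> h; rewrite fP; apply: cohom_ext => q; rewrite cohom_mapE f0 linear0.
- by right=> h; rewrite fP; apply: cohom_ext => q; rewrite cohom_mapE f1.
Qed.

(** A Gamma-linear map from F(N) to Gamma, which is F(Q), is by Yoneda composition with a unique map
    N -> Q. *)
Lemma dual_homF N : addm Q N ->
  exists th : {linear (dualm (F N) : lmodType Gamma^c) -> cohom N},
    bijective th /\
    forall (w : dualm (F N)) (h : F N) q,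
      ((w : lhom _ _) h : endo Q) q = of_cohom (th w) (of_homF h q).
Proof.
move=> aN.
pose rel (w : dualm (F N)) (f : cohom N) := forall (h : F N) q,
  ((w : lhom _ _) h : endo Q) q = of_cohom f (of_homF h q).
have [w|f f0|a w f w' f' wf wf'|th thP] :=
  @linrel_fun _ (dualm (F N) : lmodType Gamma^c) (cohom N) rel.
- have lw : linear (fun h : F N => homF_of ((w : lhom _ _) h : endo Q) : F Q).
    move=> a h h'; apply: homF_ext => q; rewrite of_homFD of_homF_scale.
    by rewrite -[LHS]/(((w : lhom _ _) (a *: h + h') : endo Q) q) linearP.
  have [f fP] := yoneda (mklin lw) aN; exists (cohom_of f) => h q.
  by have := congr1 (fun h => of_homF h q) (fP h).
- apply: cohom_ext => x; apply: (addm_faithful (f := of_cohom f) (f' := \0) aN) => h.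
  by apply: homF_ext => q; rewrite of_homF_map -f0.
- move=> h q; exact: (congr2 +%R (congr1 (a : endo Q) (wf h q)) (wf' h q)).
exists th; split; last by move=> w; exact: thP.
apply: inj_surj_bij.
  apply: lin_inj => w w0; apply/lhomP => h; apply/lhomP => q.
  by rewrite -[LHS]/(((w : lhom _ _) h : endo Q) q) thP w0.
move=> f.
have lw : linear (fun h : F N => (of_cohom f \o of_homF h : endo Q) : Gamma^o).
  by move=> a h h'; apply/lhomP => q /=; rewrite -linearD.
pose w : dualm (F N) := mklin lw; exists w.
apply: cohom_ext => x; apply: (addm_faithful (f := of_cohom (th w)) (f' := of_cohom f) aN) => h.
by apply: homF_ext => q; rewrite !of_homF_map -thP.
Qed.

Lemma cohom_regular : iso ((Gamma^c)^o : lmodType Gamma^c) (cohom Q).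
Proof.
have lf : linear (fun a : (Gamma^c)^o => cohom_of (a : endo Q) : cohom Q).
  by move=> a g h; apply: cohom_ext => q.
by exists (mklin lf); exists (fun h => of_cohom h : endo Q).
Qed.

End Cohom.

Lemma iso_dsum (A : pzRingType) (I : finType) (M N : I -> lmodType A) :
  (forall i, iso (M i) (N i)) -> iso (dsum M) (dsum N).
Proof.
move=> iMN.
have [f fP] : exists f : forall i, {linear M i -> N i}, forall i, bijective (f i).
  by exists (fun i => projT1 (cid (iMN i))) => i; exact: (projT2 (cid (iMN i))).
have [g gP] : exists g : forall i, {linear N i -> M i},
    forall i, cancel (f i) (g i) /\ cancel (g i) (f i).
  exists (fun i => projT1 (cid (bijective_linv (fP i)))) => i.
  exact: (projT2 (cid (bijective_linv (fP i)))).
have [u uP] := dsum_to (fun i => f i \o dproj M i : {linear dsum M -> N i}).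
have [v vP] := dsum_to (fun i => g i \o dproj N i : {linear dsum N -> M i}).
exists u; exists v => x; apply: dsum_ext => i.
  by rewrite vP /= uP /= (gP i).1.
by rewrite uP /= vP /= (gP i).2.
Qed.

Section CohomDsum.
Variables (A : pzRingType) (t : nat) (Q : 'I_t -> lmodType A).
Local Notation QQ := (dsum Q).
Local Notation Gamma := ((endo QQ)^c).

Lemma cohom_dsum : iso ((Gamma^c)^o : lmodType Gamma^c) (dsum (fun i => cohom QQ (Q i))).
Proof.
apply: iso_trans (cohom_regular _) _.
have [f fP] := dsum_to (fun i => cohom_map QQ (dinj Q i)).
have [g gP] := dsum_from (fun i => cohom_map QQ (dproj Q i)).
exists f; exists g => h.
  rewrite [f h]dsumE linear_sum; apply: cohom_ext => q; rewrite of_cohom_sum.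
  rewrite {2}[q]dsumE linear_sum; apply: eq_bigr => i _.
  by rewrite gP fP !cohom_mapE.
apply: dsum_ext => i; rewrite fP [h in LHS]dsumE linear_sum; apply: cohom_ext => q.
rewrite cohom_mapE of_cohom_sum (bigD1 i) //= gP big1 ?addr0 => [|j ji].
  by rewrite cohom_mapE dproj_inj.
by rewrite gP cohom_mapE dproj_inj_neq 1?eq_sym // linear0.
Qed.

End CohomDsum.

(** * Standard filtrations of the projective modules of the opposite algebra *)

Section GammaOp.
Variables (R : comPzRingType) (A : pzRingType) (phi : algstr R A) (t : nat)
  (Psi Q : 'I_t -> lmodType A) (le : rel 'I_t).
Hypotheses (artA : artin_algebra phi) (pcs : proper_costratifying_system Psi Q le).
Implicit Types M N X Y Z K : lmodType A.
Implicit Types D : pred 'I_t.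
Local Notation QQ := (dsum Q).
Local Notation Gamma := ((endo QQ)^c).
Local Notation F := (Hom_functor QQ).
Local Notation cohom := (cohom QQ).
Local Notation dualP := (fun i => dualm (F (Q i)) : lmodType Gamma^c).
Local Notation Delta := (standard dualP (op_order le)).

Let lin : linear_order le := pcs_order pcs.

Fact Q_dual_ex i : exists th : {linear dualP i -> cohom (Q i)}, bijective th.
Proof. by have [th [bth _]] := dual_homF (addm_Qi Q i); exists th. Qed.

Definition theta i : {linear dualP i -> cohom (Q i)} := projT1 (cid (Q_dual_ex i)).
Lemma theta_bij i : bijective (theta i).
Proof. exact: (projT2 (cid (Q_dual_ex i))). Qed.

Lemma dualP_iso i : iso (dualP i) (cohom (Q i)).
Proof. by exists (theta i); exact: theta_bij. Qed.

Lemma dualP_regular : iso ((Gamma^c)^o : lmodType Gamma^c) (dsum dualP).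
Proof.
by apply: iso_trans (cohom_dsum Q) (iso_dsum _) => i; exact: iso_sym (dualP_iso i).
Qed.

Lemma dualP_indec i : indecomposable (dualP i).
Proof.
apply: indecomposable_iso (iso_sym (dualP_iso i)) _.
exact: cohom_indecomposable (addm_Qi Q i) (pcs_indec pcs i).
Qed.

Lemma dualP_inj i j : iso (dualP i) (dualP j) -> i = j.
Proof.
move=> ij; apply: (Q_iso_inj pcs); apply: iso_sym.
apply: (cohom_iso_inv (addm_Qi Q i) (addm_Qi Q j)).
exact: iso_trans (iso_sym (dualP_iso i)) (iso_trans ij (dualP_iso j)).
Qed.

Lemma artin_Gamma_op : artin_algebra (op_algstr (op_algstr (endo_algstr phi QQ))).
Proof. exact: artin_op (artin_Gamma artA pcs). Qed.

Lemma flen_Gamma_op : flen ((Gamma^c)^o : lmodType Gamma^c).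
Proof. by apply: (artin_flen artin_Gamma_op); exact: fg_regular. Qed.

(** Maps N -> Q through finite sums of Q(j)'s with j in D; for growing down-sets D and N = Q(i) they
    form the standard filtration of the dual of F(Q(i)). *)
Definition factors D N (f : cohom N) : Prop :=
  exists (I : finType) (l : I -> 'I_t) (s : forall k, {linear N -> Q (l k)})
    (r : forall k, {linear Q (l k) -> QQ}),
  (forall k, D (l k)) /\ forall x, of_cohom f x = \sum_k r k (s k x).

Fact factors_closed D N : closed_prop (@factors D N).
Proof.
split.
- have l (k : void) : 'I_t by case: k.
  exists void, l, (fun _ => \0), (fun _ => \0); split=> [[]|x]; by rewrite big1.
- move=> f g [I [l [s [r [lD fE]]]]] [J [m [u [v [mD gE]]]]].
  pose lm (k : I + J) := match k with inl i => l i | inr j => m j end.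
  exists (I + J)%type, lm, (fun k : I + J => match k as k return {linear N -> Q (lm k)} with
    inl i => s i | inr j => u j end), (fun k : I + J =>
    match k as k return {linear Q (lm k) -> QQ} with inl i => r i | inr j => v j end).
  split; first by case.
  by move=> x; rewrite big_sumType /= -fE -gE.
- move=> a f [I [l [s [r [lD fE]]]]].
  exists I, l, s, (fun k => (a : endo QQ) \o r k); split=> // x.
  by rewrite of_cohom_scale fE linear_sum.
Qed.
Definition factorS D N : submodule (cohom N) := submodule_of (@factors_closed D N).
Lemma factorSP D N f : reflect (factors D f) (f \in factorS D N).
Proof. exact: submodule_ofP. Qed.

Lemma factorS_sub D D' N : (forall j, D j -> D' j) -> {subset factorS D N <= factorS D' N}.
Proof.
move=> DD' f /factorSP[I [l [s [r [lD fE]]]]]; apply/factorSP; exists I, l, s, r; split=> // k.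
exact: DD'.
Qed.

Lemma factorS_comp D j N (r : {linear Q j -> QQ}) (s : {linear N -> Q j}) : D j ->
  cohom_of (r \o s) \in factorS D N.
Proof.
move=> Dj; apply/factorSP; exists unit, (fun=> j), (fun=> s), (fun=> r); split=> // x.
by rewrite big_const card_unit iterS /= addr0.
Qed.

Lemma factorS_precomp D M N (u : {linear M -> N}) (f : cohom N) :
  f \in factorS D N -> cohom_map QQ u f \in factorS D M.
Proof.
move=> /factorSP[I [l [s [r [lD fE]]]]]; apply/factorSP.
by exists I, l, (fun k => s k \o u), r; split=> // x; rewrite cohom_mapE fE.
Qed.

(** By [coyoneda] a map between these duals is precomposition with a map between the Q's, so the
    trace from the duals with j < k consists of sums of maps that factor through those Q(j). *)
Lemma trace_LD k w : w \in trace (dsum (fun j : {j | strict (op_order le) k j} => dualP (val j)))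
    (dualP k) <-> theta k w \in factorS (fun j => strict le j k) (Q k).
Proof.
have str j : strict (op_order le) k j = strict le j k.
  by rewrite /strict /op_order eq_sym.
have [th' [thK th'K]] := bijective_linv (theta_bij k).
split=> [/asboolP tr|].
  apply/preSP; apply: (tr (preS (theta k) (factorS _ (Q k)))) => _ [f [x ->]]; apply/preSP.
  rewrite [x]dsumE !linear_sum; apply: rpred_sum => -[j kj] _; set xj := dproj _ _ x.
  have [tj [tjK tjK']] := bijective_linv (theta_bij j).
  pose g : {linear cohom (Q j) -> cohom (Q k)} := theta k \o (f \o
    (dinj (fun j : {j | strict (op_order le) k j} => dualP (val j)) (exist _ j kj) \o tj)).
  have [u uP] := coyoneda g (addm_Qi Q j).
  have -> : theta k (f (dinj _ _ xj)) = cohom_map QQ u (theta j xj).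
    by rewrite -uP /g /= tjK.
  by apply: (@factorS_comp _ j _ (of_cohom (theta j xj)) u); rewrite -str.
move=> /factorSP[I [l [s [r [lD wE]]]]].
have -> : w = \sum_i th' (cohom_map QQ (s i) (cohom_of (r i))).
  rewrite -[LHS]thK -linear_sum; congr (th' _); apply: cohom_ext => x.
  by rewrite of_cohom_sum wE.
apply: rpred_sum => i _; apply: mem_gen_submod.
have ki : strict (op_order le) k (l i) by rewrite str.
pose kk : {j | strict (op_order le) k j} := exist _ (l i) ki.
have [ti [tiK tiK']] := bijective_linv (theta_bij (l i)).
exists (th' \o (cohom_map QQ (s i) \o
   (theta (l i) \o dproj (fun j : {j | strict (op_order le) k j} => dualP (val j)) kk))),
  (dinj (fun j : {j | strict (op_order le) k j} => dualP (val j)) kk (ti (cohom_of (r i)))).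
by rewrite /= dproj_inj tiK'.
Qed.

Lemma Delta_desc k : exists sg : {linear cohom (Q k) -> Delta k},
  (forall y, exists x, sg x = y) /\
  forall f, sg f = 0 <-> f \in factorS (fun j => strict le j k) (Q k).
Proof.
have [th' [thK th'K]] := bijective_linv (theta_bij k).
pose tr := trace (dsum (fun j : {j | strict (op_order le) k j} => dualP (val j))) (dualP k).
exists (projQ tr \o th'); split=> [y|f] /=.
  by have [w <-] := projQ_surj y; exists (theta k w); rewrite /= thK.
by rewrite projQ0 trace_LD th'K.
Qed.

Lemma Psi_basis i k : exists m (b : 'I_m -> {linear Q i -> Psi k}),
  (forall f : {linear Q i -> Psi k}, exists d : 'I_m -> {linear Psi k -> Psi k},
     forall x, f x = \sum_j d j (b j x)) /\
  (forall d : 'I_m -> {linear Psi k -> Psi k}, (forall x, \sum_j d j (b j x) = 0) ->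
     forall j x, d j x = 0).
Proof.
have [n [b bs]] := homR_span artA (pcs_fgQ pcs i) (pcs_fgPsi pcs k).
have {bs} : forall f : {linear Q i -> Psi k}, exists d : 'I_n -> {linear Psi k -> Psi k},
    forall x, f x = \sum_j d j (b j x).
  move=> f; have [c cE] := bs f.
  by exists (fun j => endo_map phi (Psi k) (c j)) => x; rewrite cE.
elim: n b => [|n IH] b bs; first by exists 0%N, b; split=> // d _ [].
case: (pselect (forall d : 'I_n.+1 -> {linear Psi k -> Psi k},
    (forall x, \sum_j d j (b j x) = 0) -> forall j x, d j x = 0)) => [ind|].
  by exists n.+1, b.
move=> /existsNP[d /not_implyP[d0 /existsNP[l /(Psi_bij pcs)/bijective_linv[e [de ed]]]]].
apply: (IH (fun j => b (fintype.lift l j))) => f; have [c cE] := bs f.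
exists (fun j => c (fintype.lift l j) \+ (\- (c l \o (e \o d (fintype.lift l j))))) => x.
rewrite cE (bigD1_ord l) //= big_split /= addrC; congr (_ + _).
have : b l x = - \sum_(j < n) e (d (fintype.lift l j) (b (fintype.lift l j) x)).
  rewrite -linear_sum -linearN -[LHS]de; congr (e _); apply/eqP.
  by rewrite -addr_eq0 -[X in _ == X](d0 x) (bigD1_ord l).
by move=> ->; rewrite linearN linear_sum sumrN.
Qed.

(** * One layer of the filtration of Hom(Q(i), Q) *)

Section Layer.
Variables (i k : 'I_t) (m : nat) (b : 'I_m -> {linear Q i -> Psi k})
  (c : 'I_m -> {linear Q i -> Q k}).
Hypotheses
  (bs : forall f : {linear Q i -> Psi k}, exists d : 'I_m -> {linear Psi k -> Psi k},
     forall x, f x = \sum_j d j (b j x))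
  (bi : forall d : 'I_m -> {linear Psi k -> Psi k}, (forall x, \sum_j d j (b j x) = 0) ->
     forall j x, d j x = 0)
  (cb : forall j x, beta pcs k (c j x) = b j x).

(** With [layer_surj] this identifies Hom(Q(k), T)^m with Hom(Q(i), T). In the top factor of T each
    [f j] becomes [d j] after beta, independence of the [b j] gives [d j] = 0, and so the [f j] land
    one step lower. *)
Lemma layer_inj D T : (forall j, D j -> j = k) -> FP Psi D T ->
  forall f : 'I_m -> {linear Q k -> T}, (forall x, \sum_j f j (c j x) = 0) ->
  forall j x, f j x = 0.
Proof.
move=> Dk; move: T; apply: FP_elim => [T T0|T' T l a p fT' IH Dl s] f f0 j x; first exact: T0.
move: p s; rewrite (Dk _ Dl) => p s.
have [d dE] : exists d : 'I_m -> {linear Psi k -> Psi k},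
    forall j x, d j (beta pcs k x) = p (f j x).
  have ex j' := cid (hom_Q_Psi artA pcs (p \o f j')).
  by exists (fun j => projT1 (ex j)) => j'; exact: (projT2 (ex j')).
have d0 : forall j x, d j x = 0.
  apply: bi => y; rewrite -[RHS](linear0 p) -(f0 y) linear_sum.
  by apply: eq_bigr => j' _; rewrite -dE cb.
have [f' f'E] : exists f' : 'I_m -> {linear Q k -> T'}, forall j x, a (f' j x) = f j x.
  have ex j' := cid (ses_lift (h := f j') s (fun x => etrans (esym (dE j' x)) (d0 j' _))).
  by exists (fun j => projT1 (ex j)) => j'; exact: (projT2 (ex j')).
rewrite -f'E (IH f') ?linear0 // => y; apply: (ses_inj s).
by rewrite linear_sum linear0 -[RHS](f0 y); apply: eq_bigr => j' _; rewrite f'E.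
Qed.

(** The component in the top factor is expanded in the basis, the coefficients are lifted to maps
    Q(k) -> T, and the difference lands one step lower. *)
Lemma layer_surj D T : (forall j, D j -> j = k) -> FP Psi D T ->
  forall f : {linear Q i -> T}, exists g : 'I_m -> {linear Q k -> T},
    forall x, f x = \sum_j g j (c j x).
Proof.
move=> Dk; move: T; apply: FP_elim => [T T0|T' T l a p fT' IH Dl s] f.
  by exists (fun _ => \0) => x; rewrite (T0 (f x)) big1.
move: p s; rewrite (Dk _ Dl) => p s; have [d dE] := bs (p \o f).
have [g gE] : exists g : 'I_m -> {linear Q k -> T},
    forall j x, p (g j x) = d j (beta pcs k x).
  have ex j := cid (Q_relproj pcs (i := k) fT' s (d j \o beta pcs k)).
  by exists (fun j => projT1 (ex j)) => j; exact: (projT2 (ex j)).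
have [h hE] := lin_sum_fun (fun j => g j \o c j : {linear Q i -> T}).
have [f' f'E] : exists f' : {linear Q i -> T'},
    forall x, a (f' x) = (f \+ (\- h) : {linear Q i -> T}) x.
  apply: (ses_lift s) => x; rewrite /= linearB hE linear_sum [p (f x)]dE; apply/eqP.
  by rewrite subr_eq0; apply/eqP/eq_bigr => j _; rewrite /= gE cb.
have [g' g'E] := IH f'.
exists (fun j => g j \+ (a \o g' j)) => x; rewrite big_split /= -linear_sum -g'E f'E /= hE.
by rewrite addrC subrK.
Qed.

(** Let D' be D without its greatest index k, and let [Y1] in [X1] be the parts of Q with indices in
    D' and in D. Maps from Q(l) that factor through D, or D', are those landing in [X1], or [Y1]. So
    the layer for Q(i) is Hom(Q(i), T) with T = [X1]/[Y1] filtered by Psi(k), a power of Hom(Q(k),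
    T). As all maps from Q(k) factor through D, Hom(Q(k), T) is Hom(Q(k), Q) modulo the maps through
    D', the standard module at k. *)
Lemma factorS_step D : downset le D -> D k -> (forall j, D j -> le j k) ->
  Filt (famclass Delta) (subm (factorS [pred j | D j && (j != k)] (Q i))) ->
  Filt (famclass Delta) (subm (factorS D (Q i))).
Proof.
move=> dD Dk Dmax fD'; pose D' : pred 'I_t := [pred j | D j && (j != k)].
have [r0 asym tr tot] := lin.
have dD' : downset le D'.
  move=> j l jl /andP[Dl lk]; rewrite /D' /= (dD _ _ jl Dl) /=.
  apply: contra lk => /eqP jk; apply/eqP/asym; rewrite Dmax //= -jk //.
have D'D j : D' j -> D j by case/andP.
have D'E j : D' j = strict le j k.
  apply/andP/andP => -[h1 h2]; split=> //; [exact: Dmax|exact: dD h1 Dk].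
have dT : downset le predT by [].
have [X1 [X2 [a [g [s1 fX1' fX2]]]]] := FP_split pcs dD (addQ_FP artA pcs dT
  (proj2 (addQ_sumfac Q QQ) (addm_Q QQ))).
have [Y1 [T [a' [p [s2 fY1' fT]]]]] := FP_split pcs dD' fX1'.
have Tk j : (predT j && D j) && ~~ D' j -> j = k.
  by rewrite /D' /= => /andP[Dj]; rewrite Dj negbK => /eqP.
have fY1 : FP Psi D' Y1 by apply: FP_sub fY1' => j /andP[].
have fX1 : FP Psi D X1 by apply: FP_sub fX1' => j /andP[].
have to_X1 j (r : {linear Q j -> QQ}) : D j -> forall x, g (r x) = 0.
  move=> Dj; apply: (hom0 pcs (g \o r) (FP_Q pcs j) fX2) => l u lj /andP[_ nDu].
  exact: (downset_sep lin dD Dj lj nDu).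
have to_Y1 j (r : {linear Q j -> X1}) : D' j -> forall x, p (r x) = 0.
  move=> Dj; apply: (hom0 pcs (p \o r) (FP_Q pcs j) fT) => l u lj /andP[_ nDu].
  exact: (downset_sep lin dD' Dj lj nDu).
have LD_X1 l (f : cohom (Q l)) : f \in factorS D (Q l) -> exists f1 : {linear Q l -> X1},
    forall x, a (f1 x) = of_cohom f x.
  move=> /factorSP[I [n [s [r [lD fE]]]]]; apply: (ses_lift s1) => x.
  by rewrite fE linear_sum big1 // => u _; exact: to_X1 (lD u) _.
have X1_LD l (f1 : {linear Q l -> X1}) : cohom_of (a \o f1) \in factorS D (Q l).
  have [I [n [s [r [lD fE]]]]] := FP_factor pcs f1 dD fX1 (fun K fK => Q_relproj pcs (i := l) fK).
  apply/factorSP; exists I, n, s, (fun u => a \o r u); split=> // x.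
  by rewrite -linear_sum -fE.
have LD'_p l (f1 : {linear Q l -> X1}) :
    cohom_of (a \o f1) \in factorS D' (Q l) <-> forall x, p (f1 x) = 0.
  split=> [/factorSP[I [n [s [r [lD fE]]]]] x|pf].
    have [r' r'E] : exists r' : forall u, {linear Q (n u) -> X1}, forall u x, a (r' u x) = r u x.
      have ex u := cid (ses_lift (h := r u) s1 (to_X1 _ (r u) (D'D _ (lD u)))).
      by exists (fun u => projT1 (ex u)) => u; exact: (projT2 (ex u)).
    have -> : f1 x = \sum_u r' u (s u x).
      apply: (ses_inj s1); rewrite linear_sum -[LHS]/(of_cohom (cohom_of (a \o f1)) x) fE.
      by apply: eq_bigr => u _; rewrite r'E.
    by rewrite linear_sum big1 // => u _; exact: to_Y1 (lD u) _.
  have [h hE] := ses_lift s2 pf.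
  have [I [n [s [r [lD h'E]]]]] := FP_factor pcs h dD' fY1 (fun K fK => Q_relproj pcs (i := l) fK).
  apply/factorSP; exists I, n, s, (fun u => a \o (a' \o r u)); split=> // x.
  by rewrite -linear_sum /= -hE h'E !linear_sum.
have [sg [sgs sg0]] := Delta_desc k.
have sgD' f : sg f = 0 <-> f \in factorS D' (Q k).
  by rewrite sg0; split; apply: factorS_sub => j; rewrite D'E.
have LDk (f : cohom (Q k)) : f \in factorS D (Q k).
  exact: (@factorS_comp D k (Q k) (of_cohom f) idfun Dk).
have sum_ex (f : 'I_m -> cohom (Q k)) : exists v : 'I_m -> {linear Q k -> X1},
    forall j x, a (v j x) = of_cohom (f j) x.
  have ex j := cid (LD_X1 _ _ (LDk (f j))).
  by exists (fun j => projT1 (ex j)) => j; exact: (projT2 (ex j)).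
pose S (f : 'I_m -> cohom (Q k)) : cohom (Q i) := \sum_j cohom_map QQ (c j) (f j).
have SE f x : of_cohom (S f) x = \sum_j of_cohom (f j) (c j x).
  by rewrite of_cohom_sum.
pose DD := dsum (fun _ : 'I_m => Delta k).
(* y is the coordinate vector of f: its components are the classes of the [f' j], where f is the sum
   of the [f' j \o c j] modulo maps through D'. *)
pose rel (f : subm (factorS D (Q i))) (y : DD) := exists f' : 'I_m -> cohom (Q k),
  (forall j, dproj (fun _ : 'I_m => Delta k) j y = sg (f' j)) /\
  inclS _ f - S f' \in factorS D' (Q i).
(* By [layer_inj] the coordinates vanish on maps through D'; in particular they are well defined. *)
have rel0 f y : rel f y -> inclS _ f \in factorS D' (Q i) -> y = 0.
  move=> [f' [yE fS]] fD; apply: dsum_ext => j; rewrite yE linear0; apply/sgD'.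
  have [v vE] := sum_ex f'; have [h hE] := lin_sum_fun (fun j => v j \o c j : {linear Q i -> X1}).
  have ph : forall x, p (h x) = 0.
    apply/LD'_p; have -> : cohom_of (a \o h) = S f'.
      apply: cohom_ext => x; rewrite SE /of_cohom /cohom_of /= hE linear_sum.
      by apply: eq_bigr => j' _; rewrite /= vE.
    by rewrite -[S f'](subKr (inclS _ f)) rpredB.
  have -> : f' j = cohom_of (a \o v j) by apply: cohom_ext => x; rewrite -vE.
  apply/LD'_p; apply: (layer_inj Tk fT (f := fun j => p \o v j)) => x.
  by rewrite -[RHS](ph x) hE linear_sum; apply: eq_bigr.
have [f|y ry|u f y f' y' [h [hy hf]] [h' [hy' hf']]|rho rhoP] :=
    @linrel_fun _ (subm (factorS D (Q i))) DD rel.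
- have [f1 f1E] := LD_X1 _ _ (inclSP f).
  have [u uE] := layer_surj Tk fT (p \o f1).
  have [v vE] : exists v : 'I_m -> {linear Q k -> X1}, forall j x, p (v j x) = u j x.
    have ex j := cid (Q_relproj pcs (i := k) fY1 s2 (u j)).
    by exists (fun j => projT1 (ex j)) => j; exact: (projT2 (ex j)).
  pose f' j := cohom_of (a \o v j).
  exists ([ffun j => sg (f' j)] : DD), f'; split=> [j|]; first by rewrite dprojE ffunE.
  have [h hE] := lin_sum_fun (fun j => v j \o c j : {linear Q i -> X1}).
  have -> : inclS _ f - S f' = cohom_of (a \o (f1 \+ (\- h) : {linear Q i -> X1})).
    apply: cohom_ext => x; transitivity (a (f1 x) - a (h x)); last exact: esym (linearB a _ _).
    by rewrite of_cohomD of_cohomN SE -f1E hE (linear_sum a).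
  apply/LD'_p => x; rewrite /= linearB hE linear_sum [p (f1 x)]uE; apply/eqP.
  by rewrite subr_eq0; apply/eqP/eq_bigr => j _; rewrite /= vE.
- by apply: rel0 ry _; rewrite linear0 rpred0.
- exists (fun j => u *: h j + h' j); split=> [j|]; first by rewrite !linearP hy hy'.
  have -> : S (fun j => u *: h j + h' j) = u *: S h + S h'.
    rewrite /S scaler_sumr -big_split; apply: eq_bigr => j _; exact: linearP.
  by rewrite linearP opprD addrACA -scalerBr rpredD // rpredZ.
have fDD : Filt (famclass Delta) DD.
  apply: (SumOf_Filt (C := famclass Delta)); first by move=> X; exact: Filt1.
  by apply: dsum_SumOf => _; exists k.
have DLD (f : subm (factorS D' (Q i))) : inclS _ f \in factorS D (Q i).
  exact: factorS_sub D'D _ (inclSP f).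
have [inc incE] := corestr DLD.
apply: (Filt_ses (f := inc) (g := rho) _ fD' fDD); apply: mkses => [f f0|f|f f0|y].
- by apply: (@inclS_inj _ _ (factorS D' (Q i))); rewrite -incE f0 !linear0.
- by apply: (rel0 _ _ (rhoP _)); rewrite incE inclSP.
- have [f' [f'0 fS]] := rhoP f; have fD : inclS _ f \in factorS D' (Q i).
    rewrite -[inclS _ f](subrK (S f')) rpredD // rpred_sum // => j _.
    by apply: factorS_precomp; apply/sgD'; rewrite -f'0 f0 linear0.
  have [f1 f1E] := inclS_ex fD; exists f1.
  by apply: (@inclS_inj _ _ (factorS D (Q i))); rewrite incE.
- have [f' f'E] := choice (fun j => sgs (dproj (fun _ : 'I_m => Delta k) j y)).
  have SD : S f' \in factorS D (Q i) by rewrite rpred_sum // => j _; exact: factorS_precomp.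
  have [f fE] := inclS_ex SD; exists f; have [f'' [f''E fS]] := rhoP f.
  apply/eqP; rewrite -subr_eq0; apply/eqP; apply: (rel0 0); last by rewrite linear0 rpred0.
  exists (fun j => f'' j - f' j); split=> [j|]; first by rewrite !linearB f''E f'E.
  rewrite linear0 sub0r rpredN (_ : S _ = S f'' - S f').
    by rewrite -rpredN opprB -fE.
  by rewrite /S -sumrB; apply: eq_bigr => j _; exact: linearB.
Qed.

End Layer.

Lemma factorS_Filt D i : downset le D -> Filt (famclass Delta) (subm (factorS D (Q i))).
Proof.
move: {2}(#|D|) (leqnn #|D|) => n; elim: n D => [|n IH] D cD dD;
  (case: (pselect (exists j, D j)) => [[j0 Dj0]|nD]; last first).
- apply: Filt0 => f; apply: (@inclS_inj _ _ (factorS D (Q i))); rewrite linear0.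
  have /factorSP[I [l [s [r [lD fE]]]]] := inclSP f; apply: cohom_ext => x.
  by rewrite fE big1 // => k _; case: nD; exists (l k).
- have jD : j0 \in D by exact: Dj0.
  by move: cD; rewrite leqn0 => /eqP/card0_eq/(_ j0); rewrite jD.
- apply: Filt0 => f; apply: (@inclS_inj _ _ (factorS D (Q i))); rewrite linear0.
  have /factorSP[I [l [s [r [lD fE]]]]] := inclSP f; apply: cohom_ext => x.
  by rewrite fE big1 // => k _; case: nD; exists (l k).
(* Least for the opposite order, so the greatest index of D; removing it leaves a down-set. *)
have [k Dk kmax] := linear_order_min (linear_order_op lin) Dj0.
have [m [b [bs bi]]] := Psi_basis i k.
have [c cb] : exists c : 'I_m -> {linear Q i -> Q k}, forall j x, beta pcs k (c j x) = b j x.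
  have ex j := cid (Q_relproj pcs (i := i) (FP_kerQ pcs k) (beta_ses pcs k) (b j)).
  by exists (fun j => projT1 (ex j)) => j; exact: (projT2 (ex j)).
apply: (factorS_step bs bi cb dD Dk kmax); apply: IH.
  rewrite -ltnS (leq_trans _ cD) //; apply: proper_card; apply/properP; split.
    by apply/fintype.subsetP => j; rewrite !inE => /andP[].
  by exists k => //; rewrite inE eqxx andbF.
have [r0 asym tr tot] := lin.
move=> j l jl /andP[Dl lk]; rewrite /= (dD _ _ jl Dl) /=.
apply: contra lk => /eqP jk; apply/eqP/asym.
by rewrite (kmax _ Dl : le l k) -jk.
Qed.

Lemma dualP_Filt i : Filt (famclass Delta) (dualP i).
Proof.
have dT : downset le predT by [].
apply: Filt_iso (factorS_Filt i dT); apply: iso_trans (iso_sym (dualP_iso i)).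
exists (inclS (factorS predT (Q i))); apply: inj_surj_bij; first exact: inclS_inj.
move=> f; apply: inclS_ex.
exact: (@factorS_comp predT i (Q i) (of_cohom f) idfun).
Qed.

Lemma Gamma_op_stratified :
  standardly_stratified (op_algstr (op_algstr (endo_algstr phi QQ))) dualP (op_order le).
Proof.
split; first exact: artin_Gamma_op.
- exact: linear_order_op lin.
- exact: basic_rep_indec_proj flen_Gamma_op dualP_regular dualP_indec dualP_inj.
move=> X fgX pX; apply/filteredP.
apply: SumOf_Filt (fg_proj_SumOf flen_Gamma_op dualP_regular dualP_indec fgX pX) => N [i iN].
exact: Filt_iso (iso_sym iN) (dualP_Filt i).
Qed.

End GammaOp.

Theorem theorem4p3 (R : comPzRingType) (Lambda : pzRingType)
    (phi : algstr R Lambda) (t : nat) (Psi Q : 'I_t -> lmodType Lambda)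
    (le : rel 'I_t) :
  artin_algebra phi -> proper_costratifying_system Psi Q le ->
  let QQ : lmodType Lambda := dsum Q in
  let Gamma : pzRingType := (endo QQ)^c in
  let phiGamma : algstr R Gamma := op_algstr (endo_algstr phi QQ) in
  let F : modfunctor Lambda Gamma := Hom_functor QQ in
  let G : modfunctor Gamma Lambda := Tensor_functor QQ in
  let P : 'I_t -> lmodType Gamma := fun i => F (Q i) in
  let DeltaBar : 'I_t -> lmodType Gamma := proper_standard P (op_order le) in
  let FPsi : lmodType Lambda -> Prop := filtered (famclass Psi) in
  let FDelta : lmodType Gamma -> Prop := filtered (famclass DeltaBar) in
  (preserves_fg F /\ preserves_fg G) /\
  (rep_indec_proj P /\ basic_algebra phiGamma /\ rank_is (K0 Gamma) t) /\
  (exact_equivalence_on F FPsi FDelta /\ quasi_inverse_on F G FPsi FDelta) /\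
  (forall i, iso (F (Psi i)) (DeltaBar i)) /\
  standardly_stratified (op_algstr phiGamma) (fun i => dualm (P i) : lmodType Gamma^c)
    (op_order le) /\
  (forall M : lmodType Lambda, addclass QQ M <-> (FPsi M /\ perp1 FPsi M)) /\
  (resolving FDelta /\ summand_closed FDelta).
Proof.
move=> artA pcs QQ Gamma phiGamma F G P DeltaBar FPsi FDelta.
have fgQ := fgQQ artA pcs.
(* Chain filtrations are exchanged for the inductive ones, in which the equivalence and the closure
   properties are proved. *)
have eFPsi : FPsi = FP Psi predT by apply/funext => X; apply/propext; exact: FP_famclass.
have eFDelta : FDelta = Filt (famclass DeltaBar).
  by apply/funext => X; apply/propext; exact: filteredP.
split; first by split=> M fgM; [exact: (homF_fg artA)|exact: tensor_fg].
split.
  split; first exact: P_rep artA pcs.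
  split; last first.
    exact: K0_rank (flen_Gamma artA pcs) (homF_dsum Q) (P_indec pcs) (P_inj pcs).
  split; first exact: artin_Gamma artA pcs.
  exists t, P; split; [exact: P_indec pcs|exact: P_inj pcs|exact: homF_dsum].
split.
  rewrite eFPsi eFDelta; split; first exact: F_equivalence artA pcs.
  exact: FG_quasi_inverse artA pcs.
split; first exact: F_Psi artA pcs.
split; first exact: Gamma_op_stratified artA pcs.
split; first by move=> M; exact: addclassP artA pcs M.
by rewrite eFDelta; split; [exact: FDelta_resolving artA pcs|exact: FDelta_summand artA pcs].
Qed.
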